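(* Let $X$ be a Polish space, $\Omega=C([0,+\infty)\to X)$, and let $\mathscr{P}$ be the space of Borel probability measures on $\Omega$. Let $\mathscr{C}:X\to2^{\mathscr{P}}$ be a set-valued map such that: (C1) $\mathscr{C}(x)$ is a non-empty compact convex subset of $\mathscr{P}$ for every $x\in X$; (C2) $\{x\in X:\mathscr{C}(x)\cap K\neq\emptyset\}$ is a Borel subset of $X$ for every closed subset $K\subset\mathscr{P}$; (C3) $P(\Omega_x)=1$ for every $P\in\mathscr{C}(x)$ and every $x\in X$; (MP1) for every $x\in X$, $P\in\mathscr{C}(x)$ and every non-negative stopping time $\tau$, $$P[\theta_\tau^{-1}(\cdot)\,|\,\mathcal{F}_\tau](w)\in\mathscr{C}(w(\tau(w)))\quad(P,\mathcal{F}_\tau)\text{-a.s.};$$ (MP2) for every $x\in X$, $P\in\mathscr{C}(x)$ and every non-negative stopping time $\tau$, if $w\mapsto Q_w$ is an $\mathcal{F}_\tau$-measurable selection of $w\mapsto\mathscr{C}(w(\tau(w)))$, then $P\otimes_\tau Q\in\mathscr{C}(x)$. Then there exists a measurable selection $x\mapsto P_x\in\mathscr{C}(x)$, $x\in X$, with the strong Markov property: for every $x\in X$ and all stopping times $\tau$, $$P_x[\theta_\tau^{-1}(\cdot)\,|\,\mathcal{F}_\tau](w)=P_{w(\tau(w))}\quad(P_x,\mathcal{F}_\tau)\text{-a.s.}$$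
   Context: $\Omega$ is the space of continuous paths $w:[0,+\infty)\to X$ with the compact-open topology; $\Omega_x=\{w\in\Omega:w(0)=x\}$; $\mathcal{F}$ is its Borel $\sigma$-algebra and $\mathcal{F}_t$ is generated by the coordinate maps $w\mapsto w(r)$, $0\le r\le t$. A stopping time is a map $\tau:\Omega\to[0,\infty)$ with $\{\tau\le s\}\in\mathcal{F}_s$ for all $s\ge0$; $\mathcal{F}_\tau=\{A\in\mathcal{F}:A\cap\{\tau\le s\}\in\mathcal{F}_s\ \forall s\ge0\}$; $(\theta_\tau w)(\cdot)=w(\tau(w)+\cdot)$. $\mathscr{P}$ carries the weak (weak$^*$) topology generated by $P\mapsto\int f\,dP$, $f\in C_b(\Omega)$ (bounded continuous functions). $P[\,\cdot\,|\mathcal{F}_\tau]$ is the regular conditional probability distribution of $P$ given $\mathcal{F}_\tau$, and $P[\theta_\tau^{-1}(\cdot)|\mathcal{F}_\tau](w)$ is the probability measure $B\mapsto P[\theta_\tau^{-1}(B)|\mathcal{F}_\tau](w)$ on $\mathcal{F}$. ''$(P,\mathcal{F}_\tau)$-a.s.'' means: for all $w$ outside a $P$-null set belonging to $\mathcal{F}_\tau$. A map $w\mapsto Q_w\in\mathscr{P}$ is $\mathcal{F}_\tau$-measurable if $w\mapsto\int f\,dQ_w$ is $\mathcal{F}_\tau$-measurable for every $f\in C_b(\Omega)$; it is a selection of $w\mapsto\mathscr{C}(w(\tau(w)))$ if $Q_w\in\mathscr{C}(w(\tau(w)))$ for every $w\in\Omega$. For such $Q$ with each $Q_w$ supported on $\Omega_{w(\tau(w))}$,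 and for $P\in\mathscr{P}$, $P\otimes_\tau Q$ denotes the unique probability measure $R$ on $(\Omega,\mathcal{F})$ that agrees with $P$ on $\mathcal{F}_\tau$ and satisfies $R[\theta_\tau^{-1}(\cdot)|\mathcal{F}_\tau](w)=Q_w$ for $R$-almost all $w$. A measurable selection is a Borel measurable map $X\to\mathscr{P}$, $x\mapsto P_x$, with $P_x\in\mathscr{C}(x)$ for all $x$. *)

(* Defs.v *)
From HB Require Import structures.
From mathcomp Require Import all_boot all_order all_algebra.
From mathcomp Require Import all_classical all_reals all_analysis.
Set Implicit Arguments.
Unset Strict Implicit.
Unset Printing Implicit Defensive.
Import Order.TTheory GRing.Theory Num.Theory numFieldNormedType.Exports.
Local Open Scope classical_set_scope.
Local Open Scope ring_scope.

Definition borel (T : topologicalType) : set (set T) := <<s @open T >>.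

Definition borel_fun (T U : topologicalType) (f : T -> U) : Prop :=
  forall B, borel B -> borel (f @^-1` B).

Definition polish (R : realType) (X : topologicalType) : Prop :=
  (exists2 D : set X, countable D & dense D) /\
  exists d : X -> X -> R,
    [/\ (forall x y, d x y = 0 <-> x = y),
        (forall x y, d x y = d y x),
        (forall x y z, d x z <= d x y + d y z),
        (forall x (A : set X), nbhs x A <->
           exists2 e, 0 < e & [set y | d x y < e] `<=` A)
      & (forall u : nat -> X,
           (forall e, 0 < e -> exists N, forall m n,
              (N <= m)%N -> (N <= n)%N -> d (u m) (u n) < e) ->
           exists l : X, u @ \oo --> l)].

Notation borelType T := (g_sigma_algebraType (@open T)).

Section Law.
Context (R : realType) (T : ptopologicalType).

(* Terms of [probability] are functions on all subsets of the carrier, and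
   their values outside the sigma-algebra are unconstrained. Requiring the value
   0 there selects exactly one term per Borel probability measure, so that
   Leibniz equality of laws is equality of measures: see [law_ext] and
   [law_of_probability]. *)
Record law : Type := Law {
  law_prob :> probability (borelType T) R ;
  law_out : forall A : set T, ~ borel A -> law_prob A = 0%E }.

Lemma law_ext (P Q : law) : (forall A, borel A -> P A = Q A) -> P = Q.
Proof.
case: P Q => [P Po] [Q Qo] /= PQ.
have fPQ : (P : set (borelType T) -> \bar R) = Q.
  apply/funext => A; have [/PQ//|nA] := pselect (borel A).
  by rewrite Po// Qo.
have {PQ} EPQ : P = Q.
  clear -fPQ.
  destruct P as [p [[a1 a2] [a4] [a5] [a6] [a7] [a8] [a9]]].
  destruct Q as [q [[b1 b2] [b4] [b5] [b6] [b7] [b8] [b9]]].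
  rewrite /= in fPQ.
  subst q.
  have e1 := Prop_irrelevance a1 b1; subst b1.
  have e2 := Prop_irrelevance a2 b2; subst b2.
  have e4 := Prop_irrelevance a4 b4; subst b4.
  have e5 := Prop_irrelevance a5 b5; subst b5.
  have e6 := Prop_irrelevance a6 b6; subst b6.
  have e7 := Prop_irrelevance a7 b7; subst b7.
  have e8 := Prop_irrelevance a8 b8; subst b8.
  by have e9 := Prop_irrelevance a9 b9; subst b9.
by subst Q; congr Law; exact: Prop_irrelevance.
Qed.

Section Restrict.
Variable P : probability (borelType T) R.

Definition law_restr (A : set (borelType T)) : \bar R :=
  if `[< borel A >] then P A else 0%E.

Let law_restrE A : borel A -> law_restr A = P A.
Proof. by move=> bA; rewrite /law_restr asboolT. Qed.

Let law_restr0 : law_restr set0 = 0%E.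
Proof. by rewrite law_restrE ?measure0//; exact: sigma_algebra0. Qed.

Let law_restr_ge0 A : (0 <= law_restr A)%E.
Proof. by rewrite /law_restr; case: ifP. Qed.

Let law_restr_sigma_additive : semi_sigma_additive law_restr.
Proof.
move=> F mF tF mUF; rewrite law_restrE//.
have -> : (fun n => (\sum_(0 <= i < n) law_restr (F i))%E) =
          (fun n => (\sum_(0 <= i < n) P (F i))%E).
  by apply/funext => n; apply: eq_bigr => i _; rewrite law_restrE//; exact: mF.
exact: measure_semi_sigma_additive.
Qed.

HB.instance Definition _ := isMeasure.Build _ _ _ law_restr
  law_restr0 law_restr_ge0 law_restr_sigma_additive.

Let law_restr_setT : law_restr [set: borelType T] = 1%E.
Proof. by rewrite law_restrE ?probability_setT//; exact: (@measurableT _ (borelType T)). Qed.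

HB.instance Definition _ :=
  Measure_isProbability.Build _ _ _ law_restr law_restr_setT.

Lemma law_of_probability : exists Q : law, forall A, borel A -> Q A = P A.
Proof.
have h A : ~ borel A -> law_restr A = 0%E.
  by move=> nA; rewrite /law_restr asboolF.
by exists (@Law law_restr h) => A /law_restrE.
Qed.

End Restrict.

HB.instance Definition _ := gen_eqMixin law.
HB.instance Definition _ := gen_choiceMixin law.

Definition Cb : Type := {f : T -> R | continuous f /\ bounded_fun f}.

Definition law_int (f : T -> R) (P : law) : R := \int[P]_w f w.

HB.instance Definition _ := Topological.copy law
  (sup_topology (fun f : Cb =>
     Topological.class (initial_topology (law_int (proj1_sig f))))).

Definition convex_laws (C : set law) : Prop :=
  forall P Q M : law, C P -> C Q -> forall t : R, 0 <= t <= 1 ->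
  (forall A, borel A -> M A = (t%:E * P A + (1 - t)%:E * Q A)%E) -> C M.

End Law.

Section Paths.
Context (R : realType) (X : ptopologicalType).

Definition time : Type := {nonneg R}.
HB.instance Definition _ := Choice.on time.
HB.instance Definition _ := Topological.copy time
  (initial_topology (fun t : time => t%:num)).

Definition time0 : time := 0%:nng.
Definition time_add (s t : time) : time := (s%:num + t%:num)%:nng.

Definition paths : Type := continuousType time X.
Definition path_at (w : paths) (t : time) : X := w t.

HB.instance Definition _ := Choice.on paths.
HB.instance Definition _ := isPointed.Build paths (cst point).
HB.instance Definition _ := Topological.copy paths
  (initial_topology (path_at : paths -> {compact-open, time -> X})).

Let shift_fun (s : time) (w : paths) (t : time) : X := path_at w (time_add s t).

Let shift_continuous s w : continuous (shift_fun s w).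
Proof.
have cadd : continuous (time_add s : time -> time).
  have := @continuous_comp_initial time time R (fun u : time => u%:num)
    (time_add s).
  apply=> u /=.
  have cnum := @initial_continuous time R (fun v : time => v%:num) u.
  exact: (cvgD (cvg_cst (s%:num : R)) cnum).
move=> t; apply: (@continuous_comp time time X (time_add s)).
  exact: cadd.
exact: cts_fun.
Qed.

HB.instance Definition _ s w :=
  isContinuous.Build _ _ (shift_fun s w) (@shift_continuous s w).

Definition shift (s : time) (w : paths) : paths := shift_fun s w.

Lemma path_at_shift s w t : path_at (shift s w) t = path_at w (time_add s t).
Proof. by []. Qed.

Definition filtration (t : time) : set (set paths) :=
  <<s [set path_at^~ r @^-1` B | r in [set r : time | r%:num <= t%:num]
                               & B in @borel X] >>.

Definition stopping_time (tau : paths -> time) : Prop :=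
  forall s : time, filtration s [set w | (tau w)%:num <= s%:num].

Definition stopped (tau : paths -> time) : set (set paths) :=
  [set A | borel A /\
     forall s : time, filtration s (A `&` [set w | (tau w)%:num <= s%:num])].

Definition theta (tau : paths -> time) (w : paths) : paths := shift (tau w) w.

Definition path_at_stop (tau : paths -> time) (w : paths) : X :=
  path_at w (tau w).

Definition measurable_wrt (G : set (set paths)) (U : topologicalType)
    (f : paths -> U) : Prop :=
  forall B, borel B -> G (f @^-1` B).

Definition is_rcpd (P : law R paths) (tau : paths -> time)
    (k : paths -> law R paths) : Prop :=
  (forall B, borel B -> measurable_wrt (stopped tau) (fun w => k w B)) /\
  (forall A B, stopped tau A -> borel B ->
     P (A `&` B) = (\int[P]_(w in A) k w B)%E).

(* [shift_cond_as P tau G S] says that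
   P[theta_tau^-1(.) | F_tau](w) belongs to S w for all w outside a P-null set
   belonging to G. A conditional distribution is only defined up to null sets, so
   this is required of every version k; the existence of a version (automatic on
   a Polish space) is part of the meaning of P[. | F_tau]. The measure
   B |-> k w (theta_tau^-1 B) is denoted nu. *)
Definition shift_cond_as (P : law R paths) (tau : paths -> time)
    (G : set (set paths)) (S : paths -> set (law R paths)) : Prop :=
  (exists k, is_rcpd P tau k) /\
  forall k, is_rcpd P tau k ->
  exists N, [/\ G N, P N = 0%E & forall w, ~ N w ->
    exists2 nu, S w nu & forall B, borel B -> nu B = k w (theta tau @^-1` B)].

Definition is_concat (P : law R paths) (tau : paths -> time)
    (Q : paths -> law R paths) (M : law R paths) : Prop :=
  (forall A, stopped tau A -> M A = P A) /\
  shift_cond_as M tau (@borel paths) (fun w => [set Q w]).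

Definition measurable_selection_at (tau : paths -> time)
    (C : X -> set (law R paths)) (Q : paths -> law R paths) : Prop :=
  (forall f : Cb R paths,
     measurable_wrt (stopped tau) (fun w => law_int (proj1_sig f) (Q w))) /\
  (forall w, C (path_at_stop tau w) (Q w)).

End Paths.

(* Main.v *)
(* Krylov's selection by successive optimization. For a continuous
   [f : X -> [0, 1]] and [n] put [F w = int_0^oo e^(-(n+1)t) f (w t) dt], up to
   normalization, and replace each [C x] by the set of its laws which maximize
   the expectation of [F]. Non-emptiness, compactness and measurability survive.
   So do (MP1) and (MP2), by dynamic programming: since
   [F = a + e^(-(n+1)tau) (F o theta_tau)] with [a] and [tau] depending on
   the path up to time [tau] only, a maximizer whose conditional laws after
   [tau] failed to be maximizers with positive probability could be improved by
   concatenation with a measurable selection of maximizers. Repeat this for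
   countably many [n] and [f], and intersect. Two laws in the intersection at
   [x] give the same Laplace transforms to [t |-> E f (w t)], hence, by Lerch's
   theorem, have the same one-dimensional marginals; the Markov property at
   fixed times then identifies their finite-dimensional distributions. So the
   intersection is a single law, and (MP1) for it is the strong Markov
   property. *)
Require Import Defs.
From HB Require Import structures.
From mathcomp Require Import all_boot all_order all_algebra.
From mathcomp Require Import all_classical all_reals all_analysis.
From mathcomp Require Import measurable_realfun ring lra.
Import Order.TTheory GRing.Theory Num.Theory numFieldNormedType.Exports.
Set Implicit Arguments.
Unset Strict Implicit.
Unset Printing Implicit Defensive.
Local Open Scope classical_set_scope.
Local Open Scope ring_scope.

(** One countable family of continuous functions [g j] on [X], whose sets [0 < g j] form a base,
    carries the separability. It gives countable pi-systems generating the Borel sets of [X] and of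
    path space, so that equality of laws is tested on countably many events and an almost sure
    identity of laws costs countably many null sets. Lexicographic maximization occurs in two roles.
    With functionals that separate laws it yields a Borel selector, with no claim of stability under
    conditioning or concatenation. With the discounted rewards it keeps that stability, but that a
    single law remains is known only at the end. Since improving a law requires a selector of
    maximizers at every stage, each stage borrows one from the first role. Membership in [F_tau]
    mostly comes from Galmarini's test: Borel measurability together with dependence on the path up
    to [tau] only. The discount factor is strictly positive, which is what turns equality of
    expected rewards into almost sure optimality of the conditional laws. *)

(** * Monotone class arguments for integrals *)

Section monotone_class.
Context d (S : measurableType d) (R : realType).
Local Open Scope ereal_scope.
Import HBNNSimple.

(** A non-negative measurable function is an increasing limit of simple functions, and each of these
    is a finite sum of scaled indicators. *)
Lemma ge0_measurable_ind (Pr : (S -> \bar R) -> Prop) :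
  (forall A, measurable A -> Pr (EFin \o \1_A)) ->
  (forall (c : R) (f : S -> \bar R), (0 <= c)%R -> (forall x, 0 <= f x) ->
    measurable_fun [set: S] f -> Pr f -> Pr (fun x => c%:E * f x)) ->
  (forall f g : S -> \bar R, (forall x, 0 <= f x) -> (forall x, 0 <= g x) ->
    measurable_fun [set: S] f -> measurable_fun [set: S] g ->
    Pr f -> Pr g -> Pr (f \+ g)) ->
  (forall f_ : (S -> \bar R)^nat, (forall n x, 0 <= f_ n x) ->
    (forall n, measurable_fun [set: S] (f_ n)) ->
    (forall x, nondecreasing_seq (f_ ^~ x)) ->
    (forall n, Pr (f_ n)) -> Pr (fun x => limn (f_ ^~ x))) ->
  forall f, (forall x, 0 <= f x) -> measurable_fun [set: S] f -> Pr f.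
Proof.
move=> indicPr scalePr addPr limPr f f0 mf.
have sumPr (A : R -> set S) (s : seq R) :
    (forall y, measurable (A y)) -> {in s, forall y, (0 <= y)%R} ->
    Pr (fun x => \sum_(y <- s) (y * \1_(A y) x)%:E).
  move=> mA; elim: s => [|y s ih] s0.
    rewrite (_ : (fun _ => _) = EFin \o \1_set0) //; first exact: indicPr.
    by apply/funext => x; rewrite big_nil/= indic0.
  have m1 r : measurable_fun [set: S] (EFin \o \1_(A r) : S -> \bar R).
    exact/measurable_EFinP.
  rewrite (_ : (fun _ => _) = (fun x => y%:E * (EFin \o \1_(A y)) x) \+
      (fun x => \sum_(y <- s) (y * \1_(A y) x)%:E)); last first.
    by apply/funext => x; rewrite big_cons EFinM.
  have y0 : (0 <= y)%R by apply: s0; rewrite mem_head.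
  have s0' : {in s, forall y, (0 <= y)%R}.
    by move=> r rs; apply: s0; rewrite in_cons rs orbT.
  apply: addPr.
  - by move=> x; rewrite mule_ge0 ?lee_fin.
  - move=> x; rewrite big_seq; apply: sume_ge0 => r rs.
    by rewrite lee_fin mulr_ge0// s0'.
  - exact: measurable_funeM.
  - apply: emeasurable_sum => r; apply/measurable_EFinP.
    exact: measurable_funM.
  - by apply: scalePr => //; [move=> x; rewrite lee_fin|exact: indicPr].
  - exact: ih.
pose f_ := nnsfun_approx measurableT mf.
have -> : f = fun x => limn (fun n => (f_ n x)%:E).
  apply/funext => x; apply/esym/cvg_lim => //=; exact: cvg_nnsfun_approx.
apply: (limPr (fun n => EFin \o f_ n)) => /=.
- by move=> n x; rewrite lee_fin.
- by move=> n; exact/measurable_EFinP.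
- by move=> x a b ab; rewrite lee_fin; exact/lefP/nd_nnsfun_approx.
move=> n.
have -> : EFin \o f_ n = fun x =>
  \sum_(y <- finmap.enum_fset (fset_set (range (f_ n))))
    (y * \1_(f_ n @^-1` [set y]) x)%:E.
  by apply/funext => x /=; rewrite fimfunE -fsumEFin// fsbig_finite.
apply: sumPr => //.
move=> y; rewrite in_fset_set// inE => -[x _ <-].
exact: fun_ge0.
Qed.

End monotone_class.

Section integrals.
Local Open Scope ereal_scope.
Context (R : realType).

(** The hypothesis says that two measures on [S] agree: the image under [p1] of [mu1] weighted by
    [H1], and the image under [p2] of [mu2] weighted by [H2]. When [p1] and [p2] are the identity
    into a smaller sigma-algebra, this extends the defining property of a conditional expectation
    from sets to integrands. *)
Lemma ge0_integral_weight d1 d2 dS (T1 : measurableType d1)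
    (T2 : measurableType d2) (S : measurableType dS)
    (mu1 : {measure set T1 -> \bar R}) (mu2 : {measure set T2 -> \bar R})
    (p1 : T1 -> S) (p2 : T2 -> S) (H1 : T1 -> R) (H2 : T2 -> R) :
  measurable_fun [set: T1] p1 -> measurable_fun [set: T2] p2 ->
  measurable_fun [set: T1] H1 -> measurable_fun [set: T2] H2 ->
  (forall x, 0 <= H1 x)%R -> (forall x, 0 <= H2 x)%R ->
  (forall A, measurable A -> \int[mu1]_(x in p1 @^-1` A) (H1 x)%:E =
     \int[mu2]_(x in p2 @^-1` A) (H2 x)%:E) ->
  forall b : S -> \bar R, (forall x, 0 <= b x) -> measurable_fun [set: S] b ->
  \int[mu1]_x (b (p1 x) * (H1 x)%:E) = \int[mu2]_x (b (p2 x) * (H2 x)%:E).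
Proof.
move=> mp1 mp2 mH1 mH2 H10 H20 HH.
have mbp d (T : measurableType d) (p : T -> S) (H : T -> R) (b : S -> \bar R) :
    measurable_fun setT p -> measurable_fun setT H -> measurable_fun setT b ->
    measurable_fun setT (fun x => b (p x) * (H x)%:E).
  move=> mp mH mb; apply: emeasurable_funM; last exact/measurable_EFinP.
  exact: measurableT_comp.
apply: ge0_measurable_ind.
- move=> A mA.
  have key d (T : measurableType d) (mu : {measure set T -> \bar R})
      (p : T -> S) (H : T -> R) :
      \int[mu]_x ((EFin \o \1_A) (p x) * (H x)%:E) =
      \int[mu]_(x in p @^-1` A) (H x)%:E.
    rewrite [RHS]integral_mkcond; apply: eq_integral => x _ /=.
    rewrite patchE indicE; case: ifPn; rewrite ?inE ?notin_setE/= => xA.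
      by rewrite mem_set// mul1e.
    by rewrite memNset// mul0e.
  by rewrite !key HH.
- move=> c f c0 f0 mf ih.
  under eq_integral do rewrite -muleA.
  rewrite ge0_integralZl_EFin//;
    [|by move=> x _; rewrite mule_ge0 ?lee_fin|exact: mbp].
  under [RHS]eq_integral do rewrite -muleA.
  rewrite ge0_integralZl_EFin//;
    [|by move=> x _; rewrite mule_ge0 ?lee_fin|exact: mbp].
  by rewrite ih.
- move=> f g f0 g0 mf mg ihf ihg.
  under eq_integral do rewrite /= ge0_muleDl//.
  rewrite ge0_integralD//; last 4 first.
    + by move=> x _; rewrite mule_ge0 ?lee_fin.
    + exact: mbp.
    + by move=> x _; rewrite mule_ge0 ?lee_fin.
    + exact: mbp.
  under [RHS]eq_integral do rewrite /= ge0_muleDl//.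
  rewrite ge0_integralD//; last 4 first.
    + by move=> x _; rewrite mule_ge0 ?lee_fin.
    + exact: mbp.
    + by move=> x _; rewrite mule_ge0 ?lee_fin.
    + exact: mbp.
  by rewrite ihf ihg.
- move=> f f0 mf ndf ih.
  have key d (T : measurableType d) (mu : {measure set T -> \bar R})
      (p : T -> S) (H : T -> R) : measurable_fun setT p ->
      measurable_fun setT H -> (forall x, 0 <= H x)%R ->
      \int[mu]_x (limn (f^~ (p x)) * (H x)%:E) =
      limn (fun n => \int[mu]_x (f n (p x) * (H x)%:E)).
    move=> mp mH H0.
    rewrite -monotone_convergence//; last 3 first.
    + by move=> n; exact: mbp.
    + by move=> n x _; rewrite mule_ge0 ?lee_fin.
    + by move=> x _ m n mn; rewrite lee_wpmul2r ?lee_fin//; exact: ndf.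
    apply: eq_integral => x _; apply/esym/cvg_lim => //.
    apply: cvgeMr => //; exact: ereal_nondecreasing_is_cvgn.
  by rewrite !key//; congr (limn _); apply/funext => n; exact: ih.
Qed.

End integrals.

Lemma borel_real (R : realType) : @borel R = @measurable _ R.
Proof.
apply/seteqP; split.
  by apply: smallest_sub; [exact: sigma_algebra_measurable|move=> A;
    exact: open_measurable].
rewrite [X in X `<=` _]RGenOpens.measurableE.
apply: smallest_sub; first exact: smallest_sigma_algebra.
by move=> A [x [y ->]]; apply: sub_sigma_algebra; exact: itv_open.
Qed.

(** An open set of extended reals is the image of an open set of reals together with some of the two
    infinities. *)
Lemma borel_ereal (R : realType) : @borel (\bar R) = @measurable _ (\bar R).
Proof.
apply/seteqP; split.
  apply: smallest_sub; first exact: sigma_algebra_measurable.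
  move=> A oA.
  have mE : measurable (EFin @^-1` A : set R).
    apply: open_measurable; rewrite openE => r /= Ar.
    by move: oA; rewrite openE => /(_ _ Ar).
  have -> : A = (EFin @` (EFin @^-1` A)) `|` (A `&` [set +oo%E]) `|`
    (A `&` [set -oo%E]).
    apply/seteqP; split => [[r| |] Ar|x]; [left; left|left; right|right| ] => //.
    by move=> [[[r /= Ar <-]|[]]|[]].
  have m1 (x : \bar R) : measurable [set x] -> measurable (A `&` [set x]).
    move=> mx; have [Ax|nAx] := pselect (A x).
      by rewrite (_ : _ `&` _ = [set x])//; apply/seteqP; split => [y []|y ->].
    by rewrite (_ : _ `&` _ = set0)//; apply/seteqP; split => [y [] /[swap] ->|].
  by apply: measurableU; [apply: measurableU|];
    [exact: measurable_image_EFin|exact: m1|exact: m1].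
rewrite [X in X `<=` _]ErealGenOInfty.measurableE.
apply: smallest_sub; first exact: smallest_sigma_algebra.
move=> A [x ->]; apply: sub_sigma_algebra.
rewrite (_ : [set` _] = [set y : \bar R | (x%:E < y)%E]);
  first exact: open_ereal_gt_ereal.
by apply/seteqP; split => y /=; rewrite in_itv/= ?andbT.
Qed.

Section mixture.
Local Open Scope ereal_scope.
Context (R : realType) d1 d2 dY (T1 : measurableType d1)
  (T2 : measurableType d2) (Y : measurableType dY).

(** Extends a disintegration formula from sets to non-negative integrands; through it a conditional
    distribution computes conditional expectations. *)
Lemma integral_mixture (mu1 : {measure set T1 -> \bar R})
    (mu2 : {measure set T2 -> \bar R}) (p : T1 -> Y)
    (k : T2 -> {measure set Y -> \bar R}) (A1 : set T1) (A2 : set T2) :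
  measurable A1 -> measurable A2 -> measurable_fun [set: T1] p ->
  (forall B, measurable B -> measurable_fun [set: T2] (k ^~ B)) ->
  (forall B, measurable B ->
     mu1 (A1 `&` p @^-1` B) = \int[mu2]_(x in A2) k x B) ->
  forall H : Y -> \bar R, (forall y, 0 <= H y) -> measurable_fun [set: Y] H ->
  \int[mu1]_(x in A1) H (p x) = \int[mu2]_(x in A2) \int[k x]_y H y.
Proof.
move=> mA1 mA2 mp mk hk.
have mHp (H : Y -> \bar R) : measurable_fun [set: Y] H ->
    measurable_fun A1 (H \o p).
  by move=> mH; apply: measurable_funTS; exact: measurableT_comp.
have mkH (H : Y -> \bar R) : (forall y, 0 <= H y) -> measurable_fun [set: Y] H ->
    measurable_fun A2 (fun x => \int[k x]_y H y).
  move=> H0 mH; apply: measurable_funTS; exact: measurable_fun_integral_kernel.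
apply: ge0_measurable_ind.
- move=> B mB.
  rewrite (eq_integral (fun x => (\1_(p @^-1` B) x)%:E)); last first.
    by move=> x _ /=; rewrite !indicE.
  rewrite integral_indic//; last by rewrite -[X in measurable X]setTI; exact: mp.
  rewrite setIC hk//; apply: eq_integral => x _.
  by rewrite integral_indic// setIT.
- move=> c f c0 f0 mf ih /=.
  rewrite (@ge0_integralZl_EFin _ _ _ mu1 A1 mA1 (f \o p))//;
    [|by move=> x _; exact: f0|exact: mHp].
  under [RHS]eq_integral do rewrite ge0_integralZl_EFin//.
  rewrite ge0_integralZl_EFin//; [by rewrite ih| |exact: mkH].
  by move=> x _; exact: integral_ge0.
- move=> f g f0 g0 mf mg ihf ihg /=.
  rewrite (@ge0_integralD _ _ _ mu1 A1 mA1 (f \o p) (g \o p))//;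
    [|by move=> x _; exact: f0|exact: mHp|by move=> x _; exact: g0|exact: mHp].
  under [RHS]eq_integral do rewrite ge0_integralD//.
  rewrite ge0_integralD//; [by rewrite ihf ihg| |exact: mkH| |exact: mkH];
    by move=> x _; exact: integral_ge0.
- move=> f f0 mf ndf ih /=.
  rewrite (@monotone_convergence _ _ _ mu1 A1 mA1 (fun n => f n \o p))//;
    last 3 first.
  + by move=> n; exact: mHp.
  + by move=> n x _; exact: f0.
  + by move=> x _ m n mn; exact: ndf.
  rewrite (_ : (fun n => _) =
      fun n => \int[mu2]_(x in A2) \int[k x]_y f n y); last first.
    by apply/funext => n; exact: ih.
  rewrite -monotone_convergence//; last 3 first.
  + by move=> n; exact: mkH.
  + by move=> n x _; exact: integral_ge0.
  + move=> x _ m n mn; apply: ge0_le_integral => // y _; exact: ndf.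
  by apply: eq_integral => x _; rewrite monotone_convergence// => y _ m n mn;
    exact: ndf.
Qed.

End mixture.

(** * Countable families of test functions that separate laws *)

Section borel_functions.
Context (R : realType) (T : ptopologicalType).

Lemma continuous_borel (f : T -> R) : continuous f ->
  measurable_fun [set: borelType T] (f : borelType T -> R).
Proof.
move=> /continuousP cf.
apply: (@measurability _ _ (borelType T) R setT f open); first exact/esym/borel_real.
by move=> _ [B oB <-]; rewrite setTI; apply: sub_sigma_algebra; exact: cf.
Qed.

End borel_functions.

Section separation.
Context (R : realType) (T : ptopologicalType) (g : nat -> T -> R).
Hypothesis cg : forall j, continuous (g j).
Hypothesis bg : @borel T `<=` <<s range (fun j => [set x | 0 < g j x]) >>.

Definition cutoff (n : nat) (r : R) : R := Num.min 1 (n%:R * Num.max 0 r).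

Lemma cutoff_ge0 n r : 0 <= cutoff n r.
Proof. by rewrite /cutoff le_min ler01 mulr_ge0// le_max lexx. Qed.

Lemma cutoff_le1 n r : cutoff n r <= 1.
Proof. by rewrite /cutoff ge_min lexx. Qed.

Lemma cutoff_homo m n r : (m <= n)%N -> cutoff m r <= cutoff n r.
Proof.
move=> mn; rewrite /cutoff le_min ge_min lexx/= ge_min; apply/orP; right.
by rewrite ler_wpM2r ?ler_nat// le_max lexx.
Qed.

Lemma cutoff_continuous n : continuous (cutoff n).
Proof.
move=> r; apply: (@continuous_min R R (cst 1) (fun r => n%:R * Num.max 0 r)).
  exact: cst_continuous.
apply: (@continuousM R R (cst n%:R)); first exact: cst_continuous.
by apply: (@continuous_max R R (cst 0) id); [exact: cst_continuous|].
Qed.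

Lemma cutoff_cvg r : cutoff n r @[n --> \oo] --> ((0 < r)%R%:R : R).
Proof.
case: ltP => r0; last first.
  rewrite (_ : (fun _ => _) = cst 0); first exact: cvg_cst.
  by apply/funext => n; rewrite /cutoff max_l// mulr0 min_r.
apply: cvg_near_cst; near=> n.
rewrite /cutoff max_r ?(ltW r0)// min_l// -ler_pdivrMr//.
by near: n; exact: nbhs_infty_ger.
Unshelve. all: by end_near. Qed.

(* As [L.2] grows, these increase to the indicator of the finite intersection of
   the sets [0 < g j] with [j] in [L.1]. *)
Definition test_fun (L : seq nat * nat) (x : T) : R :=
  \prod_(j <- L.1) cutoff L.2 (g j x).

Lemma test_fun_ge0 L x : 0 <= test_fun L x.
Proof. by apply: prodr_ge0 => j _; exact: cutoff_ge0. Qed.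

Lemma test_fun_le1 L x : test_fun L x <= 1.
Proof.
rewrite /test_fun; elim: L.1 => [|j s ih]; rewrite ?big_nil// big_cons.
by rewrite mulr_ile1 ?cutoff_ge0 ?cutoff_le1// prodr_ge0// => i _; exact: cutoff_ge0.
Qed.

Lemma test_fun_continuous L : continuous (test_fun L).
Proof.
move=> x; rewrite /test_fun; elim: L.1 => [|j s ih].
  by under eq_fun do rewrite big_nil; exact: cst_continuous.
under eq_fun do rewrite big_cons.
apply: (@continuousM R T (fun y => cutoff L.2 (g j y))
  (fun y => \prod_(i <- s) cutoff L.2 (g i y))) => //.
by apply: (@continuous_comp T R R (g j) (cutoff L.2));
  [exact: cg|exact: cutoff_continuous].
Qed.

(** Cut out by a product of indicators, because that product is the pointwise limit of
    [test_fun (s, n)] as [n] grows. Concatenation of lists is intersection of sets, so these sets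
    form a countable pi-system. *)
Definition gt0_set (s : seq nat) : set T :=
  [set x | \prod_(j <- s) (0 < g j x)%R%:R = 1 :> R].

Lemma gt0_set_cat s1 s2 : gt0_set (s1 ++ s2) = gt0_set s1 `&` gt0_set s2.
Proof.
apply/seteqP; split => x; rewrite /gt0_set/= big_cat/=.
  move=> h; suff: gt0_set s1 x /\ gt0_set s2 x by [].
  rewrite /gt0_set/=; move: h; rewrite -!natr_prod -natrM => /eqP.
  rewrite -[1]/(1%:R) eqr_nat muln_eq1 => /andP[/eqP -> /eqP ->//].
by move=> [-> ->]; rewrite mulr1.
Qed.

Lemma measurable_gt0_set s : borel (gt0_set s).
Proof.
elim: s => [|j s ih].
  rewrite (_ : gt0_set _ = setT); first exact: (@measurableT _ (borelType T)).
  by apply/seteqP; split => // x _; rewrite /gt0_set/= big_nil.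
rewrite -cat1s gt0_set_cat; apply: (@measurableI _ (borelType T)) => //.
rewrite (_ : gt0_set _ = [set x | 0 < g j x]); last first.
  apply/seteqP; split => x; rewrite /gt0_set/= big_seq1; case: ltP => //.
  by move=> _ /eqP; rewrite eq_sym oner_eq0.
apply: sub_sigma_algebra.
by apply: (@open_comp T R (g j) [set r | 0 < r]) => //; exact: open_gt.
Qed.

Lemma measurable_test_fun L :
  measurable_fun [set: borelType T] (test_fun L : borelType T -> R).
Proof. by apply: continuous_borel; exact: test_fun_continuous. Qed.

Lemma cvg_test_fun (mu : probability (borelType T) R) s :
  (\int[mu]_x (test_fun (s, n) x)%:E)%E @[n --> \oo] --> mu (gt0_set s).
Proof.
have mtest := measurable_test_fun.
have mU := measurable_gt0_set.
have lim1 x : (test_fun (s, n) x)%:E @[n --> \oo] --> (\1_(gt0_set s) x : R)%:E.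
  apply: cvg_EFin; first exact: nearW.
  rewrite indicE (_ : _%:R = \prod_(j <- s) (0 < g j x)%R%:R)%R; last first.
    case: (asboolP (gt0_set s x)) => Ux; first by rewrite Ux mem_set.
    rewrite memNset//; apply/esym; move: Ux; rewrite /gt0_set/= -natr_prod.
    elim: s => [|j s ih]; rewrite ?big_nil// big_cons.
    by case: (0 < g j x); rewrite ?mul0n// mul1n.
  rewrite /test_fun/=; elim: s => [|j s ih].
    by rewrite big_nil; under eq_fun do rewrite big_nil; exact: cvg_cst.
  rewrite big_cons; under eq_fun do rewrite big_cons.
  by apply: cvgM => //; exact: cutoff_cvg.
have -> : mu (gt0_set s) = (\int[mu]_x limn (fun n => (test_fun (s, n) x)%:E))%E.
  rewrite -[in LHS](setIT (gt0_set s)) -integral_indic//; last exact: mU.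
  by apply: eq_integral => x _; apply/esym/cvg_lim => //; exact: lim1.
apply: cvg_monotone_convergence => //.
- by move=> n; exact/measurable_EFinP.
- by move=> n x _; rewrite lee_fin test_fun_ge0.
- move=> x _ m n mn; rewrite lee_fin.
  rewrite /test_fun/=; apply: ler_prod => j _.
  by rewrite cutoff_ge0 cutoff_homo.
Qed.

Lemma gt0_set_generate : <<s range gt0_set >> = @borel T.
Proof.
apply/seteqP; split.
  apply: smallest_sub; first exact: smallest_sigma_algebra.
  by move=> _ [s _ <-]; exact: measurable_gt0_set.
apply: (subset_trans bg); apply: smallest_sub; first exact: smallest_sigma_algebra.
move=> _ [j _ <-]; apply: sub_sigma_algebra; exists [:: j] => //.
apply/seteqP; split => x; rewrite /gt0_set/= big_seq1; case: ltP => //.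
by move=> _ /eqP; rewrite eq_sym oner_eq0.
Qed.

Lemma gt0_setI_closed : setI_closed (range gt0_set).
Proof. by move=> _ _ [s1 _ <-] [s2 _ <-]; exists (s1 ++ s2) => //;
  exact: gt0_set_cat. Qed.

Lemma gt0_setT : range gt0_set setT.
Proof. by exists [::] => //; apply/seteqP; split => // x _; rewrite /gt0_set/=
  big_nil. Qed.

Lemma gt0_set_unique (P Q : probability (borelType T) R) :
  (forall s, P (gt0_set s) = Q (gt0_set s)) -> forall A, borel A -> P A = Q A.
Proof.
move=> PQ A bA.
apply: (@measure_unique _ R (borelType T) (range gt0_set) (fun=> setT)) => //.
- exact/esym/gt0_set_generate.
- exact: gt0_setI_closed.
- by move=> _; exact: gt0_setT.
- by rewrite bigcup_const.
- by move=> _ [s _ <-]; exact: PQ.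
- by move=> _ /=; rewrite probability_setT ltry.
Qed.

Lemma test_fun_separates (P Q : probability (borelType T) R) :
  (forall L, \int[P]_x (test_fun L x)%:E = \int[Q]_x (test_fun L x)%:E)%E ->
  forall A, borel A -> P A = Q A.
Proof.
move=> PQ; apply: gt0_set_unique => s.
have e : (fun n => \int[P]_x (test_fun (s, n) x)%:E)%E =
         (fun n => \int[Q]_x (test_fun (s, n) x)%:E)%E by apply/funext.
by have := @cvg_test_fun P s; rewrite e => k;
  exact: cvg_unique k (@cvg_test_fun Q s).
Qed.

(** The sets [B] with [k s B] measurable in [s] form a Dynkin system, and every [gt0_set] is reached
    as a limit of integrals of test functions. This passes from measurability against continuous
    functions, as in the definition of a measurable selection, to measurability on Borel sets. *)
Lemma measurable_law_family d (S : measurableType d)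
  (k : S -> probability (borelType T) R) :
  (forall L, measurable_fun [set: S] (fun s => \int[k s]_x (test_fun L x)%:E)%E) ->
  forall B, borel B -> measurable_fun [set: S] (fun s => k s B).
Proof.
move=> mk.
suff : <<d range gt0_set >> `<=` [set B | borel B /\ measurable_fun [set: S]
  (fun s => k s B)].
  rewrite setI_closed_g_dynkin_g_sigma_algebra; last exact: gt0_setI_closed.
  by rewrite gt0_set_generate => h B /h[].
have bE (B : set T) : borel B <-> measurable (B : set (borelType T)) by [].
apply: smallest_sub.
  split.
  - split; first exact: (@measurableT _ (borelType T)).
    by under eq_fun do rewrite probability_setT; exact: measurable_cst.
  - move=> B [bB mB]; split; first exact: (@measurableC _ (borelType T)).
    under eq_fun do rewrite probability_setC//.
    exact: emeasurable_funB.
  - move=> F tF hF; have bF n := (hF n).1.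
    split; first exact: (@bigcupT_measurable _ (borelType T)).
    rewrite (_ : (fun s => _) = fun s => (\sum_(0 <= n <oo) k s (F n))%E).
      by apply: ge0_emeasurable_sum => // n _; case: (hF n).
    by apply/funext => s; apply/esym/cvg_lim => //; exact: measure_sigma_additive.
move=> _ [s _ <-]; split; first exact: measurable_gt0_set.
apply: (emeasurable_fun_cvg (fun n t => \int[k t]_x (test_fun (s, n) x)%:E)%E) => //.
by move=> t _; exact: cvg_test_fun.
Qed.

End separation.

(** * Measurable selection for compact-valued maps *)

Section selection.
Context (R : realType) (X : ptopologicalType) (L : topologicalType).
Hypothesis hL : hausdorff_space L.

Definition selectable (D : X -> set L) : Prop :=
  [/\ forall x, D x !=set0, forall x, compact (D x) &
      forall K, closed K -> borel [set x | D x `&` K !=set0]].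

Definition argmax (Phi : L -> R) (D : X -> set L) (x : X) : set L :=
  [set p | D x p /\ forall q, D x q -> Phi q <= Phi p].

Lemma compact_max (Phi : L -> R) (A : set L) : continuous Phi ->
  compact A -> A !=set0 -> exists2 p, A p & forall q, A q -> Phi q <= Phi p.
Proof.
move=> cPhi cA A0.
have [p pA pmax] := compact_EVT_max A0 cA (continuous_subspaceT cPhi).
by exists p; [exact: set_mem|move=> q Aq; apply: pmax; exact: mem_set].
Qed.

(** The maximizers meet [K] exactly when [D x] meets [K] and the maximum over the part of [D x] in
    [K] is the maximum over [D x]. If it is smaller, a rational level lies between the two. *)
Lemma argmax_selectable (Phi : L -> R) (D : X -> set L) :
  continuous Phi -> selectable D -> selectable (argmax Phi D).
Proof.
move=> cPhi [D0 cD mD].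
have cPhige r : closed [set p | r <= Phi p].
  by apply: (closed_comp (f := Phi) (D := [set s | r <= s])) => [p _|];
    [exact: cPhi|exact: closed_ge].
split=> [x|x|K cK].
- by have [p Dp pmax] := compact_max cPhi (cD x) (D0 x); exists p.
- have [p Dp pmax] := compact_max cPhi (cD x) (D0 x).
  rewrite (_ : argmax Phi D x = D x `&` [set q | Phi p <= Phi q]); last first.
    apply/seteqP; split => q [Dq]; first by move=> /(_ _ Dp).
    by move=> /= pq; split => // r Dr; rewrite (le_trans (pmax _ Dr)).
  exact: compact_closedI.
- pose bad q := [set x | D x `&` [set p | ratr q <= Phi p] !=set0] `\`
    [set x | D x `&` (K `&` [set p | ratr q <= Phi p]) !=set0].
  rewrite (_ : [set x | _] = [set x | D x `&` K !=set0] `\` \bigcup_q bad q).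
    apply: (@measurableD _ (borelType X)); first exact: mD.
    apply: (@bigcupT_measurable_rat _ (borelType X)) => q.
    apply: (@measurableD _ (borelType X)); first exact: mD.
    by apply: mD; exact: closedI.
  apply/seteqP; split => x.
    move=> [p [[Dp pmax] Kp]]; split; first by exists p.
    move=> [q _ [[p' [Dp' /= qp']] nKx]]; apply: nKx; exists p; split => //.
    by split => //=; rewrite (le_trans qp')// pmax.
  move=> [DK nbad].
  have [p [Dp Kp] pmax] := compact_max cPhi (compact_closedI (cD x) cK) DK.
  exists p; split => //; split => // q Dq; rewrite leNgt; apply/negP.
  move=> /rat_in_itvoo[s]; rewrite in_itv/= => /andP[ps sq].
  apply: nbad; exists s => //; split; first by exists q; split => //=; exact: ltW.
  move=> [r [Dr [Kr /= sr]]]; have := pmax _ (conj Dr Kr).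
  by rewrite leNgt (lt_le_trans ps).
Qed.

(** Cantor's intersection theorem: if every stage meets the closed set [K], so does the
    intersection. The whole space as [K] gives non-emptiness; a general [K] gives measurability as a
    countable intersection. *)
Lemma bigcap_selectable (D : nat -> X -> set L) :
  (forall n, selectable (D n)) -> (forall n x, D n.+1 x `<=` D n x) ->
  selectable (fun x => \bigcap_n D n x).
Proof.
move=> sD dD.
have {}dD m n x : (m <= n)%N -> D n x `<=` D m x.
  by move=> /subnK <-; elim: (n - m)%N => // k ih; exact: subset_trans (dD _ _) ih.
have clD n x : closed (D n x) by apply: compact_closed => //; have [_ h _] := sD n.
have key x K : closed K ->
    (\bigcap_n D n x) `&` K !=set0 <-> forall n, D n x `&` K !=set0.
  move=> cK; split=> [[p [Dp Kp]] n|h].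
    by exists p; split => //; exact: Dp.
  have [p hp] := choice h.
  have pK m : \forall n \near \oo, (D m x `&` K) (p n).
    near=> n; split; last by case: (hp n).
    by apply: (@dD _ n); [near: n; exists m|case: (hp n)].
  have [_ c0 _] := sD 0%N.
  (* A cluster point of the chosen [p n] lies in each closed set [D m x] intersected with [K],
     because a tail of the sequence does. *)
  have [q [Dq]] : D 0%N x `&` cluster (p @ \oo) !=set0.
    by apply: c0; apply: filterS (pK 0%N) => y [].
  rewrite clusterE => hq.
  have {}hq n : (D n x `&` K) q.
    have : closed (D n x `&` K) by exact: closedI.
    by rewrite closure_id => ->; apply: hq; exact: pK.
  exists q; split; last by case: (hq 0%N).
  by move=> n _; case: (hq n).
split=> [x|x|K cK].
- have [|p [Dp _]] := (key x setT closedT).2; last by exists p.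
  by move=> n; rewrite setIT; have [h _ _] := sD n.
- rewrite (_ : \bigcap_n D n x = D 0%N x `&` \bigcap_n D n x).
    apply: compact_closedI; first by have [_ h _] := sD 0%N.
    by apply: closed_bigI => n _; exact: clD.
  by apply/esym/setIidPr => p /(_ 0%N); exact.
- rewrite (_ : [set x | _] = \bigcap_n [set x | D n x `&` K !=set0]).
    apply: (@bigcapT_measurable _ (borelType X)) => n.
    by have [_ _ h] := sD n; exact: h.
  apply/seteqP; split => x /=; rewrite key//; first by move=> h n _; exact: h.
  by move=> h n; exact: h.
Unshelve. all: by end_near. Qed.

Fixpoint iter_argmax (Phi : nat -> L -> R) (D : X -> set L) n : X -> set L :=
  if n is m.+1 then argmax (Phi m) (iter_argmax Phi D m) else D.

Definition lex_argmax (Phi : nat -> L -> R) (D : X -> set L) : X -> set L :=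
  fun x => \bigcap_n iter_argmax Phi D n x.

Lemma lex_argmax_selectable (Phi : nat -> L -> R) (D : X -> set L) :
  (forall n, continuous (Phi n)) -> selectable D ->
  selectable (lex_argmax Phi D).
Proof.
move=> cPhi sD; apply: bigcap_selectable => [n|n x p []//].
by elim: n => //= n ih; exact: argmax_selectable.
Qed.

Lemma lex_argmax_eq (Phi : nat -> L -> R) (D : X -> set L) x p q n :
  lex_argmax Phi D x p -> lex_argmax Phi D x q -> Phi n p = Phi n q.
Proof.
move=> hp hq; have [Dp maxp] := hp n.+1 I; have [Dq maxq] := hq n.+1 I.
by apply/eqP; rewrite eq_le maxp// maxq.
Qed.

(* A measurable selection theorem: when countably many continuous functions
   separate the points of [L], maximizing them lexicographically leaves
   exactly one point in each [D x]. *)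
Lemma selectable_selection (Phi : nat -> L -> R) (D : X -> set L) :
  (forall n, continuous (Phi n)) ->
  (forall p q, (forall n, Phi n p = Phi n q) -> p = q) ->
  selectable D -> exists2 h : X -> L, borel_fun h & forall x, D x (h x).
Proof.
move=> cPhi sepPhi sD.
have [ne _ mK] := lex_argmax_selectable cPhi sD.
have [h hD] := choice ne; exists h; last by move=> x; exact: (hD x 0%N I).
(* Only the point [h x] is left in [lex_argmax Phi D x], so [h x] lies in [K] exactly when that set
   meets [K]. *)
have clopen K : closed K -> borel (h @^-1` K).
  move=> cK; rewrite (_ : _ @^-1` _ = [set x | lex_argmax Phi D x `&` K !=set0]).
    exact: mK.
  apply/seteqP; split => x /=; first by move=> Kh; exists (h x).
  move=> [p [Dp Kp]]; rewrite (sepPhi (h x) p)// => n.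
  exact: lex_argmax_eq (hD x) Dp.
have : <<s @open L >> `<=` [set B | borel (h @^-1` B)].
  apply: smallest_sub; first split.
  - by rewrite /= preimage_set0; exact: (@measurable0 _ (borelType X)).
  - move=> B bB; rewrite /= setTD preimage_setC.
    exact: (@measurableC _ (borelType X)).
  - move=> F bF; rewrite /= preimage_bigcup.
    exact: (@bigcupT_measurable _ (borelType X)).
  move=> B oB /=; rewrite -[B]setCK preimage_setC.
  by apply: (@measurableC _ (borelType X)); exact: (clopen _ (open_closedC oB)).
by move=> h' B bB; exact: h'.
Qed.

End selection.

(** * Paths as functions of a real variable *)

Section time_param.
Context (R : realType) (X : ptopologicalType).

(* Paths are evaluated at negative reals through the absolute value, so that
   [rpath w] is continuous on the whole line. *)
Definition rtime (r : R) : time R := (`|r|)%:nng.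

Lemma rtime_num (t : time R) : rtime t%:num = t.
Proof. by apply: val_inj; rewrite /= ger0_norm. Qed.

Lemma continuous_num : continuous (fun t : time R => t%:num).
Proof. exact: initial_continuous. Qed.

Lemma continuous_rtime : continuous rtime.
Proof.
have := @continuous_comp_initial (time R) R R (fun u : time R => u%:num) rtime.
by apply=> u /=; exact: norm_continuous.
Qed.

Definition rpath (w : paths R X) (r : R) : X := path_at w (rtime r).

Lemma rpath_num w (t : time R) : rpath w t%:num = path_at w t.
Proof. by rewrite /rpath rtime_num. Qed.

Lemma continuous_path_at (w : paths R X) : continuous (path_at w).
Proof. exact: cts_fun. Qed.

Lemma continuous_rpath w : continuous (rpath w).
Proof.
move=> r; apply: (@continuous_comp _ _ _ rtime (path_at w)).
  exact: continuous_rtime.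
exact: continuous_path_at.
Qed.

Lemma rpath_norm w r : rpath w `|r| = rpath w r.
Proof. by rewrite /rpath; congr (path_at w _); apply: val_inj;
  rewrite /= normr_id. Qed.

Lemma path_ext (w w' : paths R X) :
  (forall r, 0 <= r -> rpath w r = rpath w' r) -> w = w'.
Proof.
move=> ww'; apply/continuousEP => t.
by have := ww' t%:num; rewrite !rpath_num; exact.
Qed.

Let mkpath_continuous (F : R -> X) (cF : continuous F) :
  continuous (fun t : time R => F t%:num).
Proof.
move=> t; apply: (@continuous_comp _ _ _ (fun t : time R => t%:num) F).
  exact: continuous_num.
exact: cF.
Qed.

Definition mkpath (F : R -> X) (cF : continuous F) : paths R X :=
  mkcts (mkpath_continuous cF).

Lemma mkpathE F cF r : rpath (@mkpath F cF) r = F `|r|.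
Proof. by []. Qed.

Lemma rpath_shift (s : time R) (w : paths R X) (r : R) : 0 <= r ->
  rpath (Defs.shift s w) r = rpath w (s%:num + r).
Proof.
move=> r0; rewrite /rpath path_at_shift; congr (path_at w _); apply: val_inj.
by rewrite /= [RHS]ger0_norm ?addr_ge0// ger0_norm.
Qed.

End time_param.
Arguments rtime {R}.
Arguments rpath : simpl never.

(** * The Borel sigma-algebra of path space *)

Section borel_paths.
Context (R : realType) (X : ptopologicalType) (g : nat -> X -> R).
Hypothesis cg : forall j, continuous (g j).
Hypothesis baseg : forall x (A : set X), nbhs x A ->
  exists2 j, 0 < g j x & [set y | 0 < g j y] `<=` A.

Lemma open_gt0 j : open [set x | 0 < g j x].
Proof. by apply: (@open_comp X R (g j) [set r | 0 < r]) => //; exact: open_gt. Qed.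

Lemma borel_base : @borel X `<=` <<s range (fun j => [set x | 0 < g j x]) >>.
Proof.
apply: smallest_sub; first exact: smallest_sigma_algebra.
move=> A oA.
rewrite (_ : A = \bigcup_j if `[< [set y | 0 < g j y] `<=` A >]
   then [set y | 0 < g j y] else set0).
  apply: (@bigcupT_measurable _ (g_sigma_algebraType _)) => j.
  by case: ifP => _; [apply: sub_sigma_algebra; exists j|exact: measurable0].
apply/seteqP; split => [x Ax|x [j _]].
  have [j gx gA] := baseg (open_nbhs_nbhs (conj oA Ax)).
  by exists j => //; rewrite asboolT.
by case: ifPn => // /asboolP; exact.
Qed.

Definition tube (a b : R) (U : set X) : set (paths R X) :=
  [set w | forall r, a <= r <= b -> U (rpath w r)].

Lemma open_tube a b U : open U -> open (tube a b U).
Proof.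
move=> oU; pose K := rtime @` `[a, b].
have cK : compact K.
  apply: continuous_compact; last exact: segment_compact.
  by apply: continuous_subspaceT; exact: continuous_rtime.
exists [set f : {compact-open, time R -> X} | f @` K `<=` U].
  exact: compact_open_open.
apply/seteqP; split => w /=.
  by move=> h r rab; apply: h; exists (rtime r) => //; exists r.
by move=> h _ [_ [r rab <-] <-]; apply: h.
Qed.

(** Integers that code no pair stand for [(0, 0)], so that [coord_fun n] is a genuine coordinate for
    every [n]. *)
Definition coord_index (n : nat) : rat * nat := odflt (0, 0%N) (unpickle n).

(** Takes over on paths the role of [g] in the results on [test_fun] and [gt0_set], for which it is
    enough that the positivity sets generate the Borel sets. *)
Definition coord_fun (n : nat) (w : paths R X) : R :=
  g (coord_index n).2 (rpath w (ratr (coord_index n).1)).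

Lemma continuous_coord_fun n : continuous (coord_fun n).
Proof.
move=> w A /= hA.
have [/= B [oB Bw BA]] : exists B : set X,
  [/\ open B, B (rpath w (ratr (coord_index n).1))
    & B `<=` g (coord_index n).2 @^-1` A].
  have := cg hA; rewrite nbhsE => -[B [oB Bx] BA]; by exists B.
have := @open_tube (ratr (coord_index n).1) (ratr (coord_index n).1) _ oB => oT.
apply: (@filterS _ _ _ (tube (ratr (coord_index n).1) (ratr (coord_index n).1) B)).
  by move=> w' /(_ (ratr (coord_index n).1)); rewrite lexx => /(_ isT) /BA.
apply: open_nbhs_nbhs; split => // r; rewrite -eq_le => /eqP <-//.
Qed.

Local Notation S := <<s range (fun n => [set w | 0 < coord_fun n w]) >>.

Lemma rat_coord_measurable (q : rat) B : borel B -> S [set w | B (rpath w (ratr q))].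
Proof.
move=> /borel_base.
have : <<s range (fun j => [set x | 0 < g j x]) >> `<=`
    [set B | S [set w | B (rpath w (ratr q))]].
  apply: smallest_sub; first split => /=.
  - exact: (@measurable0 _ (g_sigma_algebraType _)).
  - move=> A SA; rewrite (_ : [set w | _] = ~` [set w | A (rpath w (ratr q))]).
      exact: (@measurableC _ (g_sigma_algebraType _)).
    by apply/seteqP; split => w /=; [case|split].
  - move=> F SF; exact: (@bigcupT_measurable _ (g_sigma_algebraType _)).
  move=> _ [j _ <-] /=; apply: sub_sigma_algebra.
  by exists (pickle (q, j)) => //; rewrite /coord_fun /coord_index pickleK.
by apply.
Qed.

(** By compactness of the interval, a path is in the tube exactly when some [m.+1%:R^-1] bounds
    [g j] from below along it; by continuity this bound need only be checked at rational times. *)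
Lemma tube_measurable (a b : rat) j :
  S (tube (ratr a) (ratr b) [set x | 0 < g j x]).
Proof.
pose E m (q : rat) : set (paths R X) := if (a <= q <= b)%R then
  [set w | m.+1%:R^-1 <= g j (rpath w (ratr q))] else setT.
rewrite (_ : tube _ _ _ = \bigcup_m \bigcap_q E m q).
  apply: (@bigcupT_measurable _ (g_sigma_algebraType _)) => m.
  rewrite -[X in measurable X]setCK setC_bigcap.
  apply: (@measurableC _ (g_sigma_algebraType _)).
  apply: (@bigcupT_measurable_rat _ (g_sigma_algebraType _)) => q.
  apply: (@measurableC _ (g_sigma_algebraType _)).
  rewrite /E; case: ifP => _; last exact: (@measurableT _ (g_sigma_algebraType _)).
  apply: (@rat_coord_measurable q [set x | m.+1%:R^-1 <= g j x]).
  rewrite -[X in borel X]setCK; apply: (@measurableC _ (borelType X)).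
  apply: sub_sigma_algebra; apply: closed_openC.
  by apply: (closed_comp (f := g j) (D := [set s | m.+1%:R^-1 <= s])) => [p _|];
    [exact: cg|exact: closed_ge].
apply/seteqP; split => w.
  move=> wU; pose f r := g j (rpath w r).
  have cf : continuous f.
    by move=> r; apply: (@continuous_comp _ _ _ (rpath w) (g j));
      [exact: continuous_rpath|exact: cg].
  have [ab|ba] := leP a b; last first.
    exists 0%N => // q _; rewrite /E; case: ifP => // /andP[aq qb].
    by have := le_trans aq qb; rewrite leNgt ba.
  have [|c cab cmin] := @EVT_min R f (ratr a) (ratr b) _ (continuous_subspaceT cf).
    by rewrite ler_rat.
  have fc : 0 < f c by apply: wU; move: cab; rewrite in_itv.
  have [m] := ltr_add_invr fc; rewrite add0r => mfc.
  exists m => // q _; rewrite /E; case: ifP => // /andP[aq qb] /=.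
  rewrite (le_trans (ltW mfc))// cmin// in_itv/=.
  by rewrite !ler_rat aq.
move=> [m _ wE] r /andP[ar rb] /=.
pose f r := g j (rpath w r).
have cf : continuous f.
  by move=> s; apply: (@continuous_comp _ _ _ (rpath w) (g j));
    [exact: continuous_rpath|exact: cg].
(* The left endpoint is itself a rational test time. At any other [r], a rational just to the left
   of [r] and still above [a] contradicts a value below the bound. *)
have [->|ra] := eqVneq r (ratr a).
  have := wE a I; rewrite /E lexx; case: ifP => [_ /=|]; last first.
    by rewrite -(ler_rat R) (le_trans ar).
  by move=> h; apply: lt_le_trans h; rewrite invr_gt0.
rewrite -/(f r); apply: (@lt_le_trans _ _ m.+1%:R^-1); first by rewrite invr_gt0.
rewrite leNgt; apply/negP => frm.
have /nbhs_ballP[e /= e0 be] : \forall s \near r, f s < m.+1%:R^-1.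
  apply: (cf r [set s | s < m.+1%:R^-1]); apply: open_nbhs_nbhs; split => //.

have : Num.max (ratr a) (r - e) < r by rewrite gt_max lt_neqAle eq_sym ra ar/=
  ltrBlDr ltrDl.
move=> /rat_in_itvoo[q]; rewrite in_itv/= gt_max => /andP[/andP[aq rq] qr].
have := wE q I; rewrite /E -!(ler_rat R) (ltW aq)/= (le_trans (ltW qr) rb)/=.
rewrite leNgt => /negP; apply; apply: be.
by rewrite /ball/= gtr0_norm ?subr_gt0// ltrBlDr addrC -ltrBlDr.
Qed.

Let boxes (l : seq (rat * rat * nat)) : set (paths R X) :=
  [set w | forall c, c \in l ->
     tube (ratr c.1.1) (ratr c.1.2) [set x | 0 < g c.2 x] w].

Let open_boxes (w : paths R X) (O : set (paths R X)) : open O -> O w ->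
  exists2 l, boxes l w & boxes l `<=` O.
Proof.
move=> [V oV <-] /= Vw.
(* It suffices that the filter [F] of boxes around [w] converges to [w]. *)
pose F : set_system {compact-open, time R -> X} :=
  [set A | exists2 l, boxes l w & forall w', boxes l w' -> A (path_at w')].
have FF : Filter F.
  split.
  - by exists [::].
  - move=> A B [l1 l1w l1A] [l2 l2w l2B]; exists (l1 ++ l2).
      by move=> c; rewrite mem_cat => /orP[/l1w|/l2w].
    move=> w' h; split.
      by apply: l1A => c cl; apply: h; rewrite mem_cat cl.
    by apply: l2B => c cl; apply: h; rewrite mem_cat cl orbT.
  - by move=> A B AB [l lw lA]; exists l => // w' /lA /AB.
suff : F --> (path_at w : {compact-open, time R -> X}).
  move=> /(_ V); apply; exact: open_nbhs_nbhs.
apply/compact_open_cvgP => K U cK oU wKU.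
(* Compactness in covering form: it is enough to find, for each time [t] of [K], one box that
   controls the times near [t]. *)
have /compact_near_coveringP/near_covering_withinP := cK.
move=> /(_ _ F (fun f t => U (f t)) FF) h.
suff : \forall f \near F, K `<=` (fun t => U (f t)).
  by apply: filterS => f fKU _ [t Kt <-]; exact: fKU.
apply: h => t Kt.
have [|j gj jU] := baseg (A := U) (x := path_at w t).
  by apply: open_nbhs_nbhs; split => //; apply: wKU; exists t.
(* By continuity the path stays in the basic set on a rational interval around [t]. Near time [0]
   the left end is negative, which [rpath] allows. *)
have [a [b [/andP[la tb] tabw]]] : exists a b : rat, ratr a < t%:num < ratr b /\
    tube (ratr a) (ratr b) [set x | 0 < g j x] w.
  have /nbhs_ballP[e /= e0 be] : \forall s \near (t%:num : R), 0 < g j (rpath w s).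
    apply: (@continuous_rpath R X w t%:num [set x | 0 < g j x]).
    by apply: open_nbhs_nbhs; split; [exact: open_gt0|rewrite rpath_num].
  have /rat_in_itvoo[a] : t%:num - e < t%:num by rewrite ltrBlDr ltrDl.
  have /rat_in_itvoo[b] : t%:num < t%:num + e by rewrite ltrDl.
  rewrite !in_itv/= => /andP[tb be'] /andP[ea la].
  exists a, b; rewrite la tb; split => // r /andP[ar rb].
  apply: be; rewrite /ball/= ltr_distlC (lt_le_trans ea)//=.
  by rewrite (le_lt_trans rb).
have nt : \forall s \near t, ratr a < s%:num < ratr b.
  apply: (@continuous_num R t [set r | ratr a < r < ratr b]).
  apply: open_nbhs_nbhs; split; last by rewrite /= la.
  rewrite (_ : [set r | _] = `]ratr a, ratr b[%classic); first exact: itv_open.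
  by apply/seteqP; split => r /=; rewrite in_itv.
exists ([set s | ratr a < s%:num < ratr b],
    [set f | forall s, ratr a < s%:num < ratr b -> 0 < g j (f s)]) => /=.
  split => //; exists [:: (a, b, j)].
    by move=> c; rewrite inE => /eqP ->.
  move=> w' /(_ (a, b, j)); rewrite inE eqxx => /(_ isT) h' s /andP[la' sb].
  by have := h' s%:num; rewrite /= rpath_num; apply; rewrite !ltW.
by move=> [s f] /= [sab fab] Ks; apply: jU; exact: fab.
Qed.

(** Boxes are coded by finite sequences of rationals and indices, so an open set is a countable
    union of the boxes inside it, and a box is a finite intersection of measurable tubes. *)
Lemma borel_coord_fun : @borel (paths R X) `<=` S.
Proof.
apply: smallest_sub; first exact: smallest_sigma_algebra.
move=> O oO.
pose B n := if unpickle n is Some l then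
  (if `[< boxes l `<=` O >] then boxes l else set0) else set0.
rewrite (_ : O = \bigcup_n B n).
  apply: (@bigcupT_measurable _ (g_sigma_algebraType _)) => n.
  rewrite /B; case: unpickle => [l|]; last exact: measurable0.
  case: ifP => _; last exact: measurable0.
  elim: l => [|c l ih].
    rewrite (_ : boxes _ = setT);
      first exact: (@measurableT _ (g_sigma_algebraType _)).
    by apply/seteqP; split => w // _ c; rewrite in_nil.
  rewrite (_ : boxes _ = tube (ratr c.1.1) (ratr c.1.2) [set x | 0 < g c.2 x]
    `&` boxes l).
    apply: (@measurableI _ (g_sigma_algebraType _)) => //.
    exact: tube_measurable.
  apply/seteqP; split => w.
    move=> h; split; first by apply: h; rewrite mem_head.
    by move=> c' c'l; apply: h; rewrite in_cons c'l orbT.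
  by move=> [h1 h2] c'; rewrite in_cons => /orP[/eqP ->|/h2].
apply/seteqP; split => [w Ow|w [n _]].
  have [l lw lO] := open_boxes oO Ow.
  by exists (pickle l) => //; rewrite /B pickleK asboolT.
rewrite /B; case: unpickle => // l; case: ifPn => // /asboolP; exact.
Qed.

(** By continuity, the value at [s y] lies in an open [U] exactly when some rational interval around
    [s y] is mapped by the path into a basic set inside [U]. These are countably many conditions,
    each of which separates [s] from [W]. *)
Lemma measurable_fun_rpath d (Y : measurableType d) (W : Y -> paths R X)
  (s : Y -> R) :
  measurable_fun [set: Y] (W : Y -> borelType (paths R X)) ->
  measurable_fun [set: Y] s ->
  measurable_fun [set: Y] ((fun y => rpath (W y) (s y)) : Y -> borelType X).
Proof.
move=> mW ms.
apply: (@measurability _ _ Y (borelType X) setT _ (@open X)) => //.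
move=> _ [U oU <-]; rewrite setTI.
pose B n : set Y := if unpickle n is Some (a, b, j) then
  (if `[< [set x | 0 < g j x] `<=` U >] then
     s @^-1` `[ratr a, ratr b] `&`
     W @^-1` tube (ratr a) (ratr b) [set x | 0 < g j x]
   else set0) else set0.
rewrite (_ : _ @^-1` _ = \bigcup_n B n).
  apply: bigcupT_measurable => n.
  rewrite /B; case: unpickle => [[[a b] j]|]; last exact: measurable0.
  case: ifP => _; last exact: measurable0.
  apply: measurableI; rewrite -[X in measurable X]setTI; first exact: ms.
  apply: mW => //; apply: sub_sigma_algebra; apply: open_tube; exact: open_gt0.
apply/seteqP; split => [y /= Uy|y [n _]].
  have [|j gj jU] := baseg (A := U) (x := rpath (W y) (s y)).
    by apply: open_nbhs_nbhs.
  have /nbhs_ballP[e /= e0 be] : \forall r \near s y, 0 < g j (rpath (W y) r).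
    apply: (@continuous_rpath R X (W y) (s y) [set x | 0 < g j x]).
    by apply: open_nbhs_nbhs; split => //; exact: open_gt0.
  have /rat_in_itvoo[a] : s y - e < s y by rewrite ltrBlDr ltrDl.
  have /rat_in_itvoo[b] : s y < s y + e by rewrite ltrDl.
  rewrite !in_itv/= => /andP[tb be'] /andP[ea la].
  exists (pickle (a, b, j)); [exact: I|rewrite /B pickleK asboolT//; split].
    by rewrite /= in_itv/= !ltW.
  move=> r /andP[ar rb]; apply: be; rewrite /ball/= ltr_distlC (lt_le_trans ea)//=.
  by rewrite (le_lt_trans rb).
rewrite /B; case: unpickle => [[[a b] j]|//]; case: ifPn => // /asboolP jU.
by move=> [/=]; rewrite in_itv/= => sab /(_ _ sab) /jU.
Qed.

Lemma measurable_fun_paths d (Y : measurableType d) (W : Y -> paths R X) :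
  (forall q : rat, measurable_fun [set: Y]
     ((fun y => rpath (W y) (ratr q)) : Y -> borelType X)) ->
  measurable_fun [set: Y] (W : Y -> borelType (paths R X)).
Proof.
move=> mW.
apply: (@measurability _ _ Y (borelType (paths R X)) setT _
  (range (fun n => [set w | 0 < coord_fun n w]))).
  apply/seteqP; split; first exact: borel_coord_fun.
  apply: smallest_sub; first exact: smallest_sigma_algebra.
  move=> _ [n _ <-]; apply: sub_sigma_algebra.
  by apply: (@open_comp (paths R X) R (coord_fun n) [set r | 0 < r]) => // w _;
    exact: continuous_coord_fun.
move=> _ [_ [n _ <-] <-].
apply: (mW (coord_index n).1 measurableT [set x | 0 < g (coord_index n).2 x]).
by apply: sub_sigma_algebra; exact: open_gt0.
Qed.

End borel_paths.

(** * Stopping times and the sigma-algebra [F_tau] *)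

Section stopping.
Context (R : realType) (X : ptopologicalType) (g : nat -> X -> R).
Hypothesis cg : forall j, continuous (g j).
Hypothesis baseg : forall x (A : set X), nbhs x A ->
  exists2 j, 0 < g j x & [set y | 0 < g j y] `<=` A.
Implicit Types (w : paths R X) (t s : time R).

Definition agree (c : R) w w' : Prop :=
  forall r, 0 <= r <= c -> rpath w r = rpath w' r.

Let stop_continuous t w : continuous (fun r : R => rpath w (Num.min r t%:num)).
Proof.
move=> r; apply: (@continuous_comp R R X (fun r => Num.min r t%:num) (rpath w)).
  by apply: (@continuous_min R R id (cst t%:num)) => //; exact: cst_continuous.
exact: continuous_rpath.
Qed.

Definition stop t w : paths R X := mkpath (@stop_continuous t w).

Lemma agree_stop c t w : c <= t%:num -> agree c w (stop t w).
Proof.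
move=> ct r /andP[r0 rc]; rewrite mkpathE ger0_norm// min_l//.
exact: le_trans ct.
Qed.

Lemma agree_sym c w w' : agree c w w' -> agree c w' w.
Proof. by move=> h r /h. Qed.

Lemma agree_le c d w w' : c <= d -> agree d w w' -> agree c w w'.
Proof. by move=> cd h r /andP[r0 rc]; apply: h; rewrite r0 (le_trans rc). Qed.

Lemma paste_continuous (f1 f2 : R -> X) (c : R) : continuous f1 -> continuous f2 ->
  f1 c = f2 c -> continuous (fun r => if r <= c then f1 r else f2 r).
Proof.
move=> c1 c2 f12 r A /=.
have [rc|cr|->] := ltgtP r c; rewrite ?lexx => hA.
- rewrite (_ : nbhs _ _ = \forall s \near r, A (if s <= c then f1 s else f2 s))//.
  near=> s; rewrite ifT; first by near: s; exact: c1 hA.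
  by apply: ltW; near: s; exact: lt_nbhsl.
- rewrite (_ : nbhs _ _ = \forall s \near r, A (if s <= c then f1 s else f2 s))//.
  near=> s; rewrite ifF; first by near: s; exact: c2 hA.
  by apply/negbTE; rewrite -ltNge; near: s; exact: lt_nbhsr.
- rewrite (_ : nbhs _ _ = \forall s \near c, A (if s <= c then f1 s else f2 s))//.
  near=> s; case: ifP => _; first by near: s; exact: c1 hA.
  by near: s; apply: (c2 c A); rewrite -f12.
Unshelve. all: by end_near. Qed.

Let splice_continuous t w w' : continuous (fun r : R =>
  if r <= t%:num then rpath w r
  else if `[< rpath w' 0 = path_at w t >] then rpath w' (r - t%:num)
  else path_at w t).
Proof.
apply: paste_continuous.
- exact: continuous_rpath.
- case: asboolP => _; last exact: cst_continuous.
  move=> r; apply: (@continuous_comp R R X (fun r => r - t%:num) (rpath w')).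
    by apply: (@continuousB R R R) => //; exact: cst_continuous.
  exact: continuous_rpath.
- by rewrite rpath_num; case: asboolP => // <-; rewrite subrr.
Qed.

(* When [w'] does not start at [w t], the path stays at [w t] after time [t]. *)
Definition splice t w w' : paths R X := mkpath (@splice_continuous t w w').

Lemma agree_splice t w w' : agree t%:num w (splice t w w').
Proof. by move=> r /andP[r0 rt]; rewrite mkpathE ger0_norm// rt. Qed.

Lemma shift_splice t w w' : path_at w' (time0 R) = path_at w t ->
  Defs.shift t (splice t w w') = w'.
Proof.
move=> ww'; have {}ww' : rpath w' 0 = path_at w t.
  by rewrite -ww' /rpath; congr (path_at _ _); apply: val_inj; rewrite /= normr0.
apply: path_ext => r r0; rewrite rpath_shift// mkpathE ger0_norm ?addr_ge0//.
case: ifPn => [|_]; last by rewrite asboolT// addrC addKr.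
rewrite gerDl => r0'; have -> : r = 0 by apply/le_anti; rewrite r0 r0'.
by rewrite addr0 rpath_num ww'.
Qed.

(** The sets that do not separate [w] from [w'] form a sigma-algebra, which contains the coordinate
    events up to time [t]. *)
Lemma filtration_agree t A w w' :
  filtration t A -> agree t%:num w w' -> A w -> A w'.
Proof.
move=> fA ww'.
have : filtration t `<=` [set A | A w <-> A w'].
  apply: smallest_sub; first split => /=.
  - by [].
  - by move=> B [h1 h2]; split => -[_ nB]; split => // ?; apply: nB;
      [exact: h2|exact: h1].
  - by move=> F hF; split => -[n _ Fn]; exists n => //; exact/(hF n).
  move=> _ [r /= rt] [B bB <-] /=.
  have := ww' r%:num; rewrite !rpath_num => ->//; rewrite rt andbT.
  exact: ge0.
by move=> /(_ A fA) /= [h _].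
Qed.

Lemma measurable_coord (r : R) :
  measurable_fun [set: borelType (paths R X)]
    ((fun w => rpath w r) : borelType (paths R X) -> borelType X).
Proof.
apply: (@measurable_fun_rpath R X g cg baseg _ (borelType (paths R X)) id (cst r)).
  exact: (@measurable_id _ (borelType (paths R X))).
exact: (@measurable_cst _ _ (borelType (paths R X))).
Qed.

Lemma filtration_borel t : filtration t `<=` @borel (paths R X).
Proof.
apply: smallest_sub; first exact: smallest_sigma_algebra.
move=> _ [r /= rt] [B bB <-].
have := measurable_coord r%:num (@measurableT _ (borelType (paths R X))) bB.
rewrite setTI; congr borel; apply/seteqP.
by split => w /=; rewrite rpath_num.
Qed.

(** Each coordinate of [stop t w] at a rational time is a coordinate of [w] at a time not after
    [t]. *)
Lemma stop_filtration t A : borel A -> filtration t (stop t @^-1` A).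
Proof.
move=> bA; pose G := [set (@path_at R X)^~ r @^-1` B |
  r in [set r : time R | r%:num <= t%:num]
                               & B in @borel X] : set (set (paths R X)).
have : measurable_fun [set: g_sigma_algebraType G]
    (stop t : g_sigma_algebraType G -> borelType (paths R X)).
  apply: (measurable_fun_paths cg baseg) => q _ B bB; rewrite setTI.
  apply: sub_sigma_algebra.
  exists (rtime (Num.min `|ratr q : R| t%:num)).
    by rewrite /= [X in X <= _]ger0_norm ?ge_min ?lexx ?orbT// le_min normr_ge0 ge0.
  by exists B.
by move=> /(_ measurableT _ bA); rewrite setTI.
Qed.

Section fixed_time.
Variable tau : paths R X -> time R.
Hypothesis stau : stopping_time tau.

(** The event that [tau] is at most [tau w] belongs to the filtration at time [tau w] and contains
    [w], hence [w']. So the paths agree up to [tau w'] as well, and the argument can be run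
    backwards. *)
Lemma stopping_agree w w' : agree (tau w)%:num w w' -> tau w' = tau w.
Proof.
move=> ww'.
have le1 : (tau w')%:num <= (tau w)%:num by have st := @stau (tau w);
  have := filtration_agree st ww'; apply; exact: lexx.
apply/val_inj/le_anti; rewrite le1/=.
have w'w : agree (tau w')%:num w' w by apply: agree_sym; exact: agree_le ww'.
by have st := @stau (tau w'); have := filtration_agree st w'w; apply; exact: lexx.
Qed.

Lemma stopped_agree A w w' : stopped tau A -> agree (tau w)%:num w w' -> A w -> A w'.
Proof.
move=> [_ /(_ (tau w)) fA] ww' Aw.
by have [] := filtration_agree fA ww' (conj Aw (lexx _)).
Qed.

(* Galmarini's test: [F_tau] consists of the Borel sets which depend on the
   path up to time [tau] only. *)
Lemma stopped_saturated A : borel A ->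
  (forall w w', agree (tau w)%:num w w' -> A w -> A w') -> stopped tau A.
Proof.
move=> bA satA; split => // s.
pose G := [set (@path_at R X)^~ r @^-1` B | r in [set r : time R | r%:num <= s%:num]
                               & B in @borel X] : set (set (paths R X)).
(* Where [tau] is at most [s], the paths [w] and [stop s w] agree up to [tau w], so [A] contains
   both or neither. *)
rewrite (_ : _ `&` _ = stop s @^-1` A `&` [set w | (tau w)%:num <= s%:num]).
  by apply: (@measurableI _ (g_sigma_algebraType G));
    [exact: stop_filtration|exact: stau].
apply/seteqP; split => w [Aw ws]; split => //=.
  by apply: satA Aw; exact: agree_stop.
have sw := agree_stop w ws.
by apply: satA Aw; rewrite (stopping_agree sw); exact: agree_sym.
Qed.

Lemma stopped_sigma_algebra : sigma_algebra setT (stopped tau).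
Proof.
split.
- by apply: stopped_saturated => //; exact: (@measurable0 _ (borelType (paths R X))).
- move=> A sA; apply: stopped_saturated.
    rewrite setTD; apply: (@measurableC _ (borelType (paths R X))).
    by case: sA.
  move=> w w' ww' [_ nA]; split => // Aw'; apply: nA.
  by apply: stopped_agree sA _ Aw'; rewrite (stopping_agree ww'); exact: agree_sym.
- move=> F sF; apply: stopped_saturated.
    by apply: (@bigcupT_measurable _ (borelType (paths R X))) => n; case: (sF n).
  by move=> w w' ww' [n _ Fw]; exists n => //; exact: stopped_agree Fw.
Qed.

(** With [F_tau] as the measurable structure of a type, [F_tau]-measurability becomes an instance of
    [measurable_fun]. *)
Lemma stopped_measurableE :
  @measurable _ (g_sigma_algebraType (stopped tau)) = stopped tau.
Proof. exact: (smallest_id stopped_sigma_algebra). Qed.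

Lemma measurable_fun_stopped d (V : measurableType d) (f : paths R X -> V) :
  measurable_fun [set: borelType (paths R X)] f ->
  (forall w w', agree (tau w)%:num w w' -> f w' = f w) ->
  measurable_fun [set: g_sigma_algebraType (stopped tau)] f.
Proof.
move=> mf sf _ B mB; rewrite setTI stopped_measurableE; apply: stopped_saturated.
  by have := mf measurableT _ mB; rewrite setTI.
by move=> w w' ww' /=; rewrite (sf _ _ ww').
Qed.

Lemma measurable_fun_stoppedW d (V : measurableType d) (f : paths R X -> V) :
  measurable_fun [set: g_sigma_algebraType (stopped tau)] f ->
  measurable_fun [set: borelType (paths R X)] f.
Proof.
move=> mf _ B mB; have := mf measurableT _ mB.
by rewrite !setTI stopped_measurableE => -[].
Qed.

Lemma measurable_stopping : measurable_fun [set: borelType (paths R X)]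
  (fun w => (tau w)%:num : R).
Proof.
apply: (@measurability _ _ (borelType (paths R X)) R setT _ (@RGenInftyO.G R)).
  exact: RGenInftyO.measurableE.
move=> _ [_ [c ->] <-]; rewrite setTI.
(* A stopping time gives only the events [tau <= s] with [s] non-negative; at a negative level the
   event is empty. *)
rewrite (_ : _ @^-1` _ = \bigcup_n [set w | (tau w)%:num <= c - n.+1%:R^-1]).
  apply: (@bigcupT_measurable _ (borelType (paths R X))) => n.
  have [d0|d0] := leP 0 (c - n.+1%:R^-1).
    by apply: (@filtration_borel (NngNum d0)); exact: stau.
  rewrite (_ : [set w | _] = set0); first exact: measurable0.
  apply/seteqP; split => w //= h.
  by have := le_lt_trans h d0; rewrite ltNge ge0.
apply/seteqP; split => w /=; rewrite in_itv/=.
  by move=> /ltr_add_invr[n h]; exists n => //=; rewrite lerBrDr ltW.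
by move=> [n _ /= h]; rewrite (le_lt_trans h)// ltrBlDr ltrDl invr_gt0.
Qed.

Lemma measurable_theta : measurable_fun [set: borelType (paths R X)]
  (theta tau : borelType (paths R X) -> borelType (paths R X)).
Proof.
apply: (measurable_fun_paths cg baseg) => q.
rewrite (_ : (fun w => _) = fun w => rpath w ((tau w)%:num + `|ratr q|)).
  apply: (@measurable_fun_rpath R X g cg baseg _ (borelType (paths R X)) id).
    exact: (@measurable_id _ (borelType (paths R X))).
  apply: measurable_funD; first exact: measurable_stopping.
  exact: (@measurable_cst _ _ (borelType (paths R X))).
by apply/funext => w; rewrite -rpath_norm /theta rpath_shift.
Qed.

Lemma measurable_path_at_stop : measurable_fun
  [set: g_sigma_algebraType (stopped tau)]
  (path_at_stop tau : paths R X -> borelType X).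
Proof.
apply: measurable_fun_stopped.
  rewrite (_ : path_at_stop tau = fun w => rpath w (tau w)%:num).
    apply: (@measurable_fun_rpath R X g cg baseg _ (borelType (paths R X)) id).
      exact: (@measurable_id _ (borelType (paths R X))).
    exact: measurable_stopping.
  by apply/funext => w; rewrite rpath_num.
move=> w w' ww'; rewrite /path_at_stop (stopping_agree ww') -!rpath_num.
by rewrite ww'// lexx ge0.
Qed.

End fixed_time.
End stopping.

(** * The discounted functionals and their continuity *)

Section discounted_integral.
Context (R : realType).
Local Notation mu := (@lebesgue_measure R).

(** Density of the exponential law of rate [n.+1]; being normalized, it keeps the functionals in
    [[0, 1]]. *)
Definition dexp (n : nat) (t : R) : R := n.+1%:R * expR (- (n.+1%:R * t)).

Lemma dexp_ge0 n t : 0 <= dexp n t.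
Proof. by rewrite mulr_ge0// expR_ge0. Qed.

Lemma continuous_dexp n : continuous (dexp n).
Proof.
move=> t; apply: (@continuousM R R (cst n.+1%:R)
  (fun t => expR (- (n.+1%:R * t)))); first exact: cst_continuous.
apply: (@continuous_comp R R R (fun t => - (n.+1%:R * t)) expR);
  last exact: continuous_expR.
apply: (@continuousN R R R); apply: (@continuousM R R (cst n.+1%:R) id) => //.
exact: cst_continuous.
Qed.

Lemma dexpD n c t : dexp n (c + t) = expR (- (n.+1%:R * c)) * dexp n t.
Proof. by rewrite /dexp mulrDr opprD expRD mulrCA. Qed.

Definition disc_int (n : nat) (u : R -> R) : \bar R :=
  (\int[mu]_(t in `[0%R, +oo[) (dexp n t * u t)%:E)%E.

Lemma disc_int1 n : disc_int n (cst 1) = 1%E.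
Proof.
rewrite /disc_int.
under eq_integral do rewrite mulr1.
rewrite (@ge0_continuous_FTC2y _ _ (fun x => - expR (- (n.+1%:R * x))) _ 0)//.
- by rewrite mulr0 oppr0 expR0 EFinN oppeK add0e.
- by move=> x _; exact: dexp_ge0.
- exact/continuous_subspaceT/continuous_dexp.
- rewrite -oppr0; apply: (@cvgN R R^o).
  rewrite (_ : (fun x => expR (- (n.+1%:R * x))) =
               (fun z => expR (- z)) \o (fun z => n.+1%:R * z))//.
  apply: (@cvg_comp _ _ _ _ _ _ (pinfty_nbhs R)); last exact: cvgr_expR.
  by apply: gt0_cvgMry => //.
- apply: cvg_at_right_filter; apply: (@cvgN R R^o).
  apply: (@continuous_comp R R R (fun t => - (n.+1%:R * t)) expR);
    last exact: continuous_expR.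
  apply: (@continuousN R R R); apply: (@continuousM R R (cst n.+1%:R) id) => //.
  exact: cst_continuous.
- move=> x _.
  rewrite derive1E; have : is_derive x 1 (fun x => - expR (- (n.+1%:R * x)))
    (dexp n x).
    apply: is_derive_eq.
    by rewrite mulrN opprK /GRing.scale/= mulr1 mulrC.
  by move=> ?; exact: derive_val.
Qed.

Lemma measurable_disc n (u : R -> R) (D : set R) : continuous u ->
  measurable_fun D (fun t => (dexp n t * u t)%:E).
Proof.
move=> cu; apply/measurable_EFinP; apply: measurable_funTS.
apply: continuous_measurable_fun => t; apply: (@continuousM R R (dexp n) u).
  exact: continuous_dexp.
exact: cu.
Qed.

(** Substituting [c + t] for [t] factors the weight by [dexpD], so the integral after time [c] is a
    rescaled copy of a whole one. Dynamic programming rests on this identity. *)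
Lemma disc_int_shift n (u : R -> R) (c : R) : continuous u ->
  (forall t, 0 <= u t) -> 0 <= c ->
  (disc_int n u = \int[mu]_(t in `[0%R, c[) (dexp n t * u t)%:E +
    (expR (- (n.+1%:R * c)))%:E * disc_int n (fun t => u (c + t)%R))%E.
Proof.
move=> cu u0 c0; rewrite /disc_int.
have e : `[0, +oo[%classic = `[0, c[%classic `|` `[c, +oo[%classic :> set R.
  by rewrite -itv_bndbnd_setU// ?bnd_simp.
rewrite {1}e ge0_integral_setU//=; last 3 first.
- exact: measurable_disc.
- by move=> t _; rewrite lee_fin mulr_ge0// dexp_ge0.
- apply/disj_set2P; rewrite -subset0 => t [] /=; rewrite !in_itv/= => /andP[_ tc].
  by rewrite andbT leNgt tc.
congr (_ + _)%E.
have cshift (v : R -> R) : continuous v -> continuous (fun t => v (c + t)).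
  move=> cv t; apply: (@continuous_comp R R R (fun t => c + t) v); last exact: cv.
  by apply: (@continuousD R R R) => //; exact: cst_continuous.
rewrite -ge0_integralZl_EFin//=; last 2 first.
- by move=> t _; rewrite lee_fin mulr_ge0// dexp_ge0.
- by apply: measurable_disc; exact: cshift.
have d1 : derive1 (fun t : R => c + t) = cst 1.
  apply/funext => t; rewrite derive1E.
  have : is_derive t 1 (fun t : R => c + t) 1.
    by apply: is_derive_eq; rewrite add0r mulr1.
  by move=> ?; exact: derive_val.
rewrite -[in LHS](addr0 c).
rewrite (@increasing_ge0_integration_by_substitutiony _ (fun t => c + t)
  (fun t => dexp n t * u t)).
- apply: eq_integral => t _ /=; rewrite d1 -EFinM; congr EFin.
  by rewrite -[LHS]/(dexp n (c + t) * u (c + t) * 1) mulr1 dexpD -mulrA.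
- by move=> x y _ _ xy; rewrite ltrD2l.
- by rewrite d1 => t _; exact: cst_continuous.
- by rewrite d1; apply: is_cvg_cst.
- by rewrite d1; apply: is_cvg_cst.
- split.
    by move=> t _.
  apply: cvg_at_right_filter.
  by apply: (@continuousD R R R) => //; exact: cst_continuous.
- exact: cvg_addrl.
- apply: continuous_subspaceT => t; apply: (@continuousM R R (dexp n) u).
    exact: continuous_dexp.
  exact: cu.
- by move=> t _; rewrite mulr_ge0// dexp_ge0.
Qed.

Lemma disc_int_le n (u v : R -> R) : continuous u -> continuous v ->
  (forall t, 0 <= t -> 0 <= u t <= v t) -> (disc_int n u <= disc_int n v)%E.
Proof.
move=> cu cv uv; apply: ge0_le_integral => //.
- move=> t; rewrite /= in_itv/= andbT => /uv /andP[u0 _].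
  by rewrite lee_fin mulr_ge0// dexp_ge0.
- exact: measurable_disc.
- exact: measurable_disc.
- move=> t; rewrite /= in_itv/= andbT => /uv /andP[_ h].
  by rewrite lee_fin ler_wpM2l// dexp_ge0.
Qed.

Lemma disc_int_cst n (c : R) : 0 <= c -> disc_int n (cst c) = c%:E.
Proof.
move=> c0; rewrite -[RHS]mule1 -(disc_int1 n) /disc_int -ge0_integralZl_EFin//=.
- by apply: eq_integral => t _; rewrite -EFinM mulr1 mulrC.
- by move=> t _; rewrite lee_fin mulr1 dexp_ge0.
- by apply: measurable_disc => t; exact: cst_continuous.
Qed.

Section laplace.
Context (X : ptopologicalType) (n : nat) (f : X -> R).
Hypotheses (cf : continuous f) (f01 : forall x, 0 <= f x <= 1).

Let f0 x : 0 <= f x. Proof. by case/andP: (f01 x). Qed.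
Let f1 x : f x <= 1. Proof. by case/andP: (f01 x). Qed.

Let cfw (w : paths R X) : continuous (fun t => f (rpath w t)).
Proof.
move=> t; apply: (@continuous_comp R X R (rpath w) f); last exact: cf.
exact: continuous_rpath.
Qed.

Definition lap (w : paths R X) : R := fine (disc_int n (fun t => f (rpath w t))).

Let disc_ge0 w : (0 <= disc_int n (fun t => f (rpath w t)))%E.
Proof. by apply: integral_ge0 => t _; rewrite lee_fin mulr_ge0// dexp_ge0. Qed.

Let disc_le1 w : (disc_int n (fun t => f (rpath w t)) <= 1)%E.
Proof.
rewrite -(disc_int1 n); by apply: disc_int_le => // t; exact: cst_continuous.
Qed.

Lemma lapE w : (lap w)%:E = disc_int n (fun t => f (rpath w t)).
Proof.
by rewrite fineK// ge0_fin_numE// (le_lt_trans (disc_le1 w))// ltry.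
Qed.

Lemma lap_ge0 w : 0 <= lap w. Proof. by rewrite -lee_fin lapE. Qed.

Lemma lap_le1 w : lap w <= 1. Proof. by rewrite -lee_fin lapE. Qed.

(** The reward collected before time [c]. The difference makes [lap_shift] immediate; the integral
    form in [lap_beforeE] then shows that it is non-negative and depends on the path up to [c]
    only. *)
Definition lap_before (c : time R) (w : paths R X) : R :=
  lap w - expR (- (n.+1%:R * c%:num)) * lap (Defs.shift c w).

Lemma lap_shift (c : time R) w :
  lap w = lap_before c w + expR (- (n.+1%:R * c%:num)) * lap (Defs.shift c w).
Proof. by rewrite /lap_before subrK. Qed.

Lemma lap_beforeE c w : (lap_before c w)%:E =
  (\int[mu]_(t in `[0%R, c%:num[) (dexp n t * f (rpath w t))%:E)%E.
Proof.
have c0 : 0 <= c%:num by [].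
have := @disc_int_shift n (fun t => f (rpath w t)) c%:num (@cfw w) (fun=> f0 _) c0.
rewrite -lapE (_ : disc_int n (fun t => f (rpath w (c%:num + t))) =
    (lap (Defs.shift c w))%:E); last first.
  rewrite lapE; apply: eq_integral => t; rewrite inE/= in_itv/= andbT => t0.
  by rewrite rpath_shift.
by rewrite /lap_before EFinB EFinM => ->; rewrite addeK.
Qed.

Lemma lap_before_ge0 c w : 0 <= lap_before c w.
Proof.
rewrite -lee_fin lap_beforeE; apply: integral_ge0 => t _.
by rewrite lee_fin mulr_ge0// dexp_ge0.
Qed.

Lemma lap_before_le c w : lap_before c w <= lap w.
Proof.
by rewrite /lap_before lerBlDr lerDl mulr_ge0 ?expR_ge0// lap_ge0.
Qed.

Lemma lap_before_agree (c : time R) w w' : agree c%:num w w' ->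
  lap_before c w' = lap_before c w.
Proof.
move=> ww'; apply: EFin_inj; rewrite !lap_beforeE; apply: eq_integral => t.
rewrite inE/= in_itv/= => /andP[t0 tc].
by rewrite ww'// t0 ltW.
Qed.

(** One [e] pays for the tail after time [c], the other for the change of [f] along the path up to
    [c]. *)
Let lap_close (c : time R) (e : R) w w' : 0 <= e ->
  expR (- (n.+1%:R * c%:num)) <= e ->
  (forall t, 0 <= t <= c%:num -> f (rpath w' t) <= f (rpath w t) + e) ->
  lap w' <= lap w + e + e.
Proof.
move=> e0 ce ww'; rewrite (lap_shift c w'); apply: lerD; last first.
  apply: le_trans ce; rewrite -[leRHS]mulr1 ler_wpM2l ?expR_ge0//.
  exact: lap_le1.
apply: (@le_trans _ _ (lap_before c w + e)); last by rewrite lerD2r lap_before_le.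
have cfe : continuous (fun t => f (rpath w t) + e).
  move=> t; apply: (@continuousD R R R) => //; [exact: cfw|exact: cst_continuous].
rewrite -lee_fin [in leRHS]EFinD !lap_beforeE.
have -> : e%:E = disc_int n (cst e) by rewrite disc_int_cst.
apply: (@le_trans _ _ (\int[mu]_(t
  in `[0%R, c%:num[) (dexp n t * (f (rpath w t) + e))%:E)%E).
  apply: ge0_le_integral => //.
  - by move=> t _; rewrite lee_fin mulr_ge0// dexp_ge0.
  - exact: measurable_disc.
  - by apply: measurable_disc.
  - move=> t; rewrite /= in_itv/= => /andP[t0 tc].
    by rewrite lee_fin ler_wpM2l ?dexp_ge0// ww'// t0 ltW.
under eq_integral do rewrite mulrDr EFinD.
rewrite ge0_integralD//=; last 4 first.
- by move=> t _; rewrite lee_fin mulr_ge0// dexp_ge0.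
- exact: measurable_disc.
- by move=> t _; rewrite lee_fin mulr_ge0// dexp_ge0.
- by apply: (@measurable_disc n (cst e)) => t; exact: cst_continuous.
apply: leeD => //; apply: ge0_subset_integral => //.
- by apply: (@measurable_disc n (cst e)) => t; exact: cst_continuous.
- by move=> t _; rewrite lee_fin mulr_ge0// dexp_ge0.
- by move=> t; rewrite /= !in_itv/= => /andP[->].
Qed.

(** Around each time [t], the paths near [w] share with [w] a tube on which [f] is within [e / 2] of
    its value at [rpath w t]; compactness of [[0, c]] makes this uniform. *)
Lemma near_uniform w (c e : R) : 0 < e ->
  \forall w' \near w, forall t, 0 <= t <= c -> `|f (rpath w' t) - f (rpath w t)| < e.
Proof.
move=> e0.
have /compact_near_coveringP/near_covering_withinP := @segment_compact R 0 c.
move=> /(_ _ (nbhs w) (fun w' t => `|f (rpath w' t) - f (rpath w t)| < e)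
  (@nbhs_filter (paths R X) w)) h.
suff : \forall w' \near w, `[0, c]%classic `<=`
  (fun t => `|f (rpath w' t) - f (rpath w t)| < e).
  by apply: filterS => w' hw' t tc; apply: hw'; rewrite /= in_itv.
apply: h => t _.
pose U := [set x | `|f x - f (rpath w t)| < e / 2].
have oU : open U.
  apply: (@open_comp X R f [set r | `|r - f (rpath w t)| < e / 2]) => //.
  rewrite (_ : [set r | _] = ball (f (rpath w t)) (e / 2)).
    by apply: ball_open; rewrite divr_gt0.
  by apply/seteqP; split => r; rewrite /ball/= distrC.
have /nbhs_ballP[d /= d0 bd] : \forall s \near t, U (rpath w s).
  apply: (@continuous_rpath R X w t U); apply: open_nbhs_nbhs; split => //.
  by rewrite /U/= subrr normr0 divr_gt0.
have tU : tube (t - d / 2) (t + d / 2) U w.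
  move=> r /andP[tr rt]; apply: bd; rewrite /ball/= ltr_distlC.
  have d2 : d / 2 < d by rewrite ltr_pdivrMr// ltr_pMr// ltr1n.
  by rewrite (lt_le_trans _ tr) ?(le_lt_trans rt)// ?ltrD2l// ltrN2.
exists (ball t (d / 2), tube (t - d / 2) (t + d / 2) U).
  split; first by apply: nbhsx_ballx; rewrite divr_gt0.
  by apply: open_nbhs_nbhs; split => //; exact: open_tube.
move=> [s w'] /= [] ts w'U _.
have sd : t - d / 2 <= s <= t + d / 2.
  by move: ts; rewrite /ball/= ltr_distlC => /andP[/ltW -> /ltW ->].
have := w'U s sd; have := tU s sd; rewrite /U/= => h1 h2.
rewrite (splitr e) -(subrKA (f (rpath w t))) (le_lt_trans (ler_normD _ _))//.
by rewrite ltrD// distrC.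
Qed.

Lemma continuous_lap : continuous lap.
Proof.
move=> w A /= /nbhs_ballP[e /= e0 eA].
(* [lap_close] loses [d] twice, and [d + d = e / 2] leaves a strict inequality. *)
pose d := e / 2 / 2; have d0 : 0 < d by rewrite !divr_gt0.
have [c cd] : exists c : time R, expR (- (n.+1%:R * c%:num)) <= d.
  (* This time suffices for every [n], since the rate [n.+1] is at least [1]. *)
  have c0 : 0 <= Num.max 0 (- ln d) by rewrite le_max lexx.
  exists (NngNum c0) => /=; rewrite -[leRHS]lnK ?posrE// ler_expR lerNl.
  rewrite (@le_trans _ _ (Num.max 0 (- ln d)))//.
    by rewrite le_max lexx orbT.
  by rewrite ler_peMl// ler1n.
apply: (@filterS _ _ (@nbhs_filter (paths R X) w) _ _ _ (near_uniform w c%:num d0)).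
move=> w' ww'; apply: eA; rewrite /ball/=.
have de : d + d < e.
  by rewrite /d -splitr ltr_pdivrMr// ltr_pMr// ltr1n.
have h1 : lap w' <= lap w + d + d.
  apply: (lap_close (ltW d0) cd) => t /ww'.
  by rewrite ltr_distl => /andP[_ /ltW].
have h2 : lap w <= lap w' + d + d.
  apply: (lap_close (ltW d0) cd) => t /ww'.
  by rewrite distrC ltr_distl => /andP[_ /ltW].
rewrite ltr_distl; apply/andP; split.
  by rewrite ltrBlDr (le_lt_trans h1)// -addrA ltrD2l.
by rewrite (le_lt_trans h2)// -addrA ltrD2l.
Qed.

End laplace.
End discounted_integral.

(** * Mixtures, kernels and almost sure equality *)

Section mixture_law.
Context (R : realType) (T : ptopologicalType) d (S : measurableType d).
Variables (P : probability S R) (k : S -> probability (borelType T) R).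
Hypothesis mk : forall B, measurable B -> measurable_fun [set: S] (fun s => k s B).

Definition mixture (B : set (borelType T)) : \bar R := (\int[P]_s k s B)%E.

Let mixture0 : mixture set0 = 0%E.
Proof. by apply: integral0_eq => s _; rewrite measure0. Qed.

Let mixture_ge0 B : (0 <= mixture B)%E.
Proof. exact: integral_ge0. Qed.

Let mixture_sigma_additive : semi_sigma_additive mixture.
Proof.
move=> F mF tF mUF; rewrite /mixture.
rewrite (_ : (\int[P]_s k s (\bigcup_n F n) =
    \int[P]_s (\sum_(0 <= n <oo) k s (F n)))%E); last first.
  by apply: eq_integral => s _; apply/esym/cvg_lim => //;
    exact: measure_semi_sigma_additive.
rewrite integral_nneseries//; last by move=> n; exact: mk.
by apply: is_cvg_nneseries => n _ _; exact: integral_ge0.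
Qed.

HB.instance Definition _ := isMeasure.Build _ _ _ mixture
  mixture0 mixture_ge0 mixture_sigma_additive.

Let mixture_setT : mixture [set: borelType T] = 1%E.
Proof.
rewrite /mixture -(probability_setT P) -[RHS]mul1e -integral_cst//.
by apply: eq_integral => s _; exact: probability_setT.
Qed.

HB.instance Definition _ :=
  Measure_isProbability.Build _ _ _ mixture mixture_setT.

Lemma mixture_law : exists M : law R T,
  forall B, borel B -> M B = (\int[P]_s k s B)%E.
Proof. exact: (law_of_probability mixture). Qed.

End mixture_law.

Section probability_kernel.
Context (R : realType) d d' (S : measurableType d) (Y : measurableType d').
Variable k : S -> probability Y R.
Hypothesis mk : forall B, measurable B -> measurable_fun [set: S] (fun s => k s B).

Definition family_kernel (s : S) : {measure set Y -> \bar R} := k s.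

HB.instance Definition _ := isKernel.Build _ _ _ _ _ family_kernel mk.

Let family_kernel_prob s : family_kernel s [set: Y] = 1%E.
Proof. exact: probability_setT. Qed.

HB.instance Definition _ :=
  Kernel_isProbability.Build _ _ _ _ _ family_kernel family_kernel_prob.

Lemma measurable_fun_integral_family (H : S * Y -> \bar R) :
  (forall z, (0 <= H z)%E) -> measurable_fun [set: S * Y] H ->
  measurable_fun [set: S] (fun s => \int[k s]_y H (s, y))%E.
Proof.
move=> H0 mH; have := @measurable_fun_integral_finite_kernel _ _ S Y R H
  family_kernel H0 mH.
by [].
Qed.

End probability_kernel.

Section ae_eq_subalgebra.
Context (R : realType) d dS (T : measurableType d) (S : measurableType dS).
Variables (P : probability T R) (p : T -> S) (mp : measurable_fun [set: T] p).
Let mp_mixin := isMeasurableFun.Build _ _ _ _ _ mp.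
Let mp_pack : {mfun _ >-> _} := HB.pack p mp_mixin.
Variables f1 f2 : S -> \bar R.
Hypothesis mf1 : measurable_fun [set: S] f1.
Hypothesis mf2 : measurable_fun [set: S] f2.
Hypothesis f1b : forall s, (0 <= f1 s <= 1)%E.
Hypothesis f2b : forall s, (0 <= f2 s <= 1)%E.

(** The image of [P] under [p] turns the hypothesis into equality of integrals over all measurable
    sets of [S]. For the identity from the Borel sets to [F_tau] this is almost sure uniqueness of
    conditional expectations. *)
Lemma ae_eq_subalgebra :
  (forall A, measurable A ->
    \int[P]_(x in p @^-1` A) f1 (p x) = \int[P]_(x in p @^-1` A) f2 (p x))%E ->
  P (p @^-1` [set s | f1 s != f2 s]) = 0%E.
Proof.
move=> f12; pose nu := distribution P mp_pack.
have intf1 : nu.-integrable setT f1.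
  apply/integrableP; split => //.
  apply: (@le_lt_trans _ _ (\int[nu]_x (cst 1 x))%E).
    apply: ge0_le_integral => //; first exact: measurableT_comp.
    by move=> s _; rewrite gee0_abs; case/andP: (f1b s).
  rewrite integral_cst// mul1e.
  by rewrite [X in (X < _)%E](probability_setT nu) ltry.
have : ae_eq nu setT f1 f2.
  apply: integral_ae_eq => // E _ mE.
  have pf f : measurable_fun [set: S] f -> (forall s, (0 <= f s <= 1)%E) ->
      (\int[nu]_(s in E) f s = \int[P]_(x in p @^-1` E) f (p x))%E.
    move=> mf fb; rewrite (ge0_integral_pushforward mp)//.
      exact: measurable_funTS.
    by move=> s _; case/andP: (fb s).
  by rewrite !pf// f12.
move=> [N [mN N0 subN]].
apply/eqP; rewrite -measure_le0 -[leRHS]N0; apply: le_measure; rewrite ?inE.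
- rewrite -[X in measurable X]setTI; apply: mp => //.
  rewrite -[X in measurable X]setTI; exact: measurable_neqe.
- by rewrite -[X in measurable X]setTI; exact: mp.
- move=> x /= /eqP f12x; apply: subN => /= /(_ I); exact: f12x.
Qed.

End ae_eq_subalgebra.

(** * Integrals and null sets relative to [F_tau] *)

Section stopped_integrals.
Context (R : realType) (X : ptopologicalType) (g : nat -> X -> R).
Hypothesis cg : forall j, continuous (g j).
Hypothesis baseg : forall x (A : set X), nbhs x A ->
  exists2 j, 0 < g j x & [set y | 0 < g j y] `<=` A.
Variable tau : paths R X -> time R.
Hypothesis stau : stopping_time tau.
Local Notation Om := (borelType (paths R X)).
Local Notation Fm := (g_sigma_algebraType (stopped tau)).

Lemma stopped_borel A : stopped tau A -> borel A. Proof. by case. Qed.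

(** The image of a law under this identity is its restriction to [F_tau]. *)
Lemma measurable_id_stopped : measurable_fun [set: Om] (id : Om -> Fm).
Proof.
move=> _ B; rewrite (stopped_measurableE cg baseg stau) setTI.
exact: stopped_borel.
Qed.

Lemma measurable_wrt_stoppedP (f : paths R X -> \bar R) :
  measurable_wrt (stopped tau) f <-> measurable_fun [set: Fm] f.
Proof.
rewrite /measurable_wrt borel_ereal; split=> mf.
  by move=> _ B mB; rewrite setTI (stopped_measurableE cg baseg stau); exact: mf.
move=> B mB; have := mf measurableT B mB.
by rewrite setTI (stopped_measurableE cg baseg stau).
Qed.

Lemma measurable_wrt_stoppedRP (f : paths R X -> R) :
  measurable_wrt (stopped tau) f <-> measurable_fun [set: Fm] f.
Proof.
rewrite /measurable_wrt borel_real; split=> mf.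
  by move=> _ B mB; rewrite setTI (stopped_measurableE cg baseg stau); exact: mf.
move=> B mB; have := mf measurableT B mB.
by rewrite setTI (stopped_measurableE cg baseg stau).
Qed.

Lemma stopped_measurable (A : set Fm) : measurable A -> stopped tau A.
Proof. by rewrite (stopped_measurableE cg baseg stau). Qed.

Lemma eq_integral_stopped (P M : law R (paths R X)) :
  (forall A, stopped tau A -> M A = P A) ->
  forall b : paths R X -> \bar R, (forall w, (0 <= b w)%E) ->
  measurable_fun [set: Fm] b -> (\int[M]_w b w = \int[P]_w b w)%E.
Proof.
move=> MP b b0 mb.
have m1 : measurable_fun [set: Om] (cst 1 : Om -> R) by exact: measurable_cst.
have := @ge0_integral_weight R _ _ _ Om Om Fm M P id id (cst 1) (cst 1)
  measurable_id_stopped measurable_id_stopped m1 m1 (fun=> ler01) (fun=> ler01)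
    _ b b0 mb.
have e1 (mu : law R (paths R X)) A : borel A ->
    (\int[mu]_(x in A) ((cst 1 : Om -> R) x)%:E = mu A)%E.
  move=> bA; rewrite -[RHS]mul1e -integral_cst//.
move=> h.
rewrite (_ : (\int[M]_w b w = \int[M]_w
  (b (id w) * ((cst 1 : Om -> R) w)%:E))%E); last first.
  by apply: eq_integral => w _; rewrite mule1.
rewrite h; first by apply: eq_integral => w _; rewrite mule1.
by move=> A /stopped_measurable sA; rewrite !e1 ?MP//; exact: stopped_borel.
Qed.

Lemma integral_in_stopped (P : law R (paths R X)) (A : set (paths R X))
    (f : paths R X -> \bar R) : borel A ->
  (\int[P]_(w in A) f w = \int[P]_w (f w * (\1_A w)%:E))%E.
Proof.
move=> bA; rewrite integral_mkcond; apply: eq_integral => w _.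
rewrite patchE indicE; case: (w \in A); rewrite ?mule1 ?mule0//.
Qed.

Lemma stopped_ae_eq (P : law R (paths R X)) (f1 f2 : paths R X -> \bar R) :
  measurable_fun [set: Fm] f1 -> measurable_fun [set: Fm] f2 ->
  (forall s, 0 <= f1 s <= 1)%E -> (forall s, 0 <= f2 s <= 1)%E ->
  (forall A, stopped tau A -> \int[P]_(x in A) f1 x = \int[P]_(x in A) f2 x)%E ->
  stopped tau [set w | f1 w != f2 w] /\ P [set w | f1 w != f2 w] = 0%E.
Proof.
move=> mf1 mf2 f1b f2b f12; split.
  apply: stopped_measurable; rewrite -[X in measurable X]setTI.
  exact: measurable_neqe.
apply: (ae_eq_subalgebra measurable_id_stopped mf1 mf2 f1b f2b) => A.
move=> /stopped_measurable; exact: f12.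
Qed.

End stopped_integrals.

Section almost_sure.
Context (R : realType) d (T : measurableType d) (P : probability T R).

Lemma probability_setI1 (A S : set T) : measurable A -> measurable S ->
  P S = 1%E -> P A = P (A `&` S).
Proof.
move=> mA mS PS.
have PnS : P (~` S) = 0%E by rewrite probability_setC// PS subee.
rewrite -[in LHS](setIT A) -(setUv S) setIUr measureU.
- rewrite [X in (_ + X)%E](_ : _ = 0%E) ?adde0//.
  apply/eqP; rewrite -measure_le0 -[leRHS]PnS; apply: le_measure; rewrite ?inE.
  + by apply: measurableI => //; exact: measurableC.
  + exact: measurableC.
  + exact: subIsetr.
- exact: measurableI.
- by apply: measurableI => //; exact: measurableC.
- by rewrite setIACA setICr setI0.
Qed.

Lemma measure_bigcup_null (N : nat -> set T) : (forall n, measurable (N n)) ->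
  (forall n, P (N n) = 0%E) -> P (\bigcup_n N n) = 0%E.
Proof.
move=> mN N0; apply: measure_negligible; first exact: bigcupT_measurable.
by apply: negligible_bigcup => n; apply/negligibleP; [exact: mN|exact: N0].
Qed.

End almost_sure.

Lemma pushforward_law (R : realType) (T : ptopologicalType) d (S : measurableType d)
    (P : probability S R) (f : S -> borelType T) : measurable_fun [set: S] f ->
  exists Q : law R T, forall B, borel B -> Q B = P (f @^-1` B).
Proof.
move=> mf; pose fm : {mfun S >-> borelType T} :=
  HB.pack f (isMeasurableFun.Build _ _ _ _ _ mf).
exact: (law_of_probability (distribution P fm)).
Qed.

Lemma integral_law_image (R : realType) (T : ptopologicalType) d
  (S : measurableType d)
    (P : probability S R) (f : S -> borelType T) (Q : law R T) :
  measurable_fun [set: S] f -> (forall B, borel B -> Q B = P (f @^-1` B)) ->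
  forall H : T -> R, measurable_fun [set: borelType T] (H : borelType T -> R) ->
  (forall x, 0 <= H x) -> (\int[Q]_x (H x)%:E = \int[P]_s (H (f s))%:E)%E.
Proof.
move=> mf QE H mH H0.
pose fm : {mfun S >-> borelType T} := HB.pack f (isMeasurableFun.Build _ _ _ _ _ mf).
transitivity (\int[distribution P fm]_x (H x)%:E)%E.
  by apply: eq_measure_integral => A mA _; exact: QE.
rewrite (ge0_integral_pushforward mf)//.
- by apply: measurable_funTS; exact/measurable_EFinP.
- by move=> x _; rewrite lee_fin.
Qed.

(** * Existence of the concatenation *)

Section concatenation.
Context (R : realType) (X : ptopologicalType) (g : nat -> X -> R).
Hypothesis cg : forall j, continuous (g j).
Hypothesis baseg : forall x (A : set X), nbhs x A ->
  exists2 j, 0 < g j x & [set y | 0 < g j y] `<=` A.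
Hypothesis sepg : forall x y, (forall j, (0 < g j x) = (0 < g j y)) -> x = y.

(** Points of [X] are equal exactly when they lie in the same basic sets, a countable condition. *)
Lemma measurable_fun_eqX d (Y : measurableType d) (f1 f2 : Y -> X) :
  measurable_fun [set: Y] (f1 : Y -> borelType X) ->
  measurable_fun [set: Y] (f2 : Y -> borelType X) ->
  measurable_fun [set: Y] (fun y => `[< f1 y = f2 y >]).
Proof.
move=> mf1 mf2; apply: (@measurable_fun_bool _ _ setT _ true); rewrite setTI.
pose E j (f : Y -> X) := f @^-1` [set x | 0 < g j x].
have mE j f : measurable_fun [set: Y] (f : Y -> borelType X) -> measurable (E j f).
  move=> mf; rewrite -[X in measurable X]setTI; apply: mf => //.
  by apply: sub_sigma_algebra; exact: open_gt0.
rewrite (_ : _ @^-1` _ = \bigcap_j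
  ((E j f1 `&` E j f2) `|` (~` E j f1 `&` ~` E j f2))).
  apply: bigcapT_measurable => j.
  by apply: measurableU; apply: measurableI; try apply: measurableC; exact: mE.
apply/seteqP; split => y /=.
  move=> /asboolP f12 j _; rewrite /E/= f12.
  by case: (boolP (0 < g j (f2 y))) => h; [left|right; split; apply/negP].
move=> h; apply/asboolP; apply: sepg => j.
by have [[-> ->]|[/negP/negbTE -> /negP/negbTE ->]] := h j I.
Qed.

Variable tau : paths R X -> time R.
Hypothesis stau : stopping_time tau.
Local Notation Om := (borelType (paths R X)).
Local Notation Fm := (g_sigma_algebraType (stopped tau)).

Lemma measurable_splice : measurable_fun [set: Om * Om]
  ((fun p => splice (tau p.1) p.1 p.2) : Om * Om -> Om).
Proof.
have mfst : measurable_fun [set: Om * Om] (fst : Om * Om -> Om)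
  by exact: measurable_fst.
have msnd : measurable_fun [set: Om * Om] (snd : Om * Om -> Om)
  by exact: measurable_snd.
have mtau : measurable_fun [set: Om * Om] (fun p : Om * Om => (tau p.1)%:num : R).
  by apply: (measurableT_comp (measurable_stopping cg baseg stau) mfst).
have meval (W : Om * Om -> Om) (s : Om * Om -> R) : measurable_fun setT W ->
    measurable_fun setT s -> measurable_fun [set: Om * Om]
      ((fun p => rpath (W p) (s p)) : Om * Om -> borelType X).
  exact: (measurable_fun_rpath cg baseg).
apply: (measurable_fun_paths cg baseg) => q.
pose r : R := `|ratr q|.
rewrite (_ : (fun p => _) = fun p : Om * Om => if r <= (tau p.1)%:num then rpath
  p.1 r
    else if `[< rpath p.2 0 = rpath p.1 (tau p.1)%:num >] then rpath p.2
      (r - (tau p.1)%:num)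
    else rpath p.1 (tau p.1)%:num :> borelType X); last first.
  by apply/funext => p; rewrite mkpathE rpath_num.
apply: measurable_fun_ifT.
- by apply: measurable_fun_ler => //; exact: measurable_cst.
- by apply: meval => //; exact: measurable_cst.
- apply: measurable_fun_ifT.
  + by apply: measurable_fun_eqX; apply: meval => //; exact: measurable_cst.
  + by apply: meval => //; apply: measurable_funB => //; exact: measurable_cst.
  + by apply: meval.
Qed.

Variables (P : law R (paths R X)) (Q : paths R X -> law R (paths R X)).
Hypothesis mQ : forall B, borel B -> measurable_fun [set: Fm] (fun w => Q w B).
Hypothesis Qstart : forall w,
  Q w [set w' | path_at w' (time0 R) = path_at_stop tau w] = 1%E.

Let gl w w' := splice (tau w) w w'.

Let mglr w : measurable_fun [set: Om] (gl w : Om -> Om).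
Proof.
have h : measurable_fun [set: Om] ((fun w' => (w, w')) : Om -> Om * Om).
  by apply: measurable_fun_pair; [exact: measurable_cst|exact: measurable_id].
exact: (measurableT_comp measurable_splice h).
Qed.

(** Given [w], draw a continuation from [Q w] and splice it to [w] at time [tau w]; this gives
    [k w], and [M] is the average of [k] over [P]. Then [k] is a conditional law of [M] given
    [F_tau], and the shifted laws of any other version agree with [Q w] almost surely on a countable
    pi-system. *)
Lemma concat_exists : exists M, is_concat P tau Q M.
Proof.
have hk w : exists kw : law R (paths R X), forall B, borel B ->
    kw B = Q w (gl w @^-1` B) by exact: pushforward_law (mglr w).
have [k kE] := choice hk.
have mgl w B : borel B -> borel (gl w @^-1` B).
  by move=> bB; have := mglr w measurableT bB; rewrite setTI.
(* Spliced paths agree with [w] up to [tau w], so under [k w] an event of [F_tau] is sure or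
   impossible according to whether it contains [w]. *)
have kI A w B : stopped tau A -> borel B ->
    k w (A `&` B) = (k w B * (\1_A w)%:E)%E.
  move=> sA bB; have bA := stopped_borel sA.
  rewrite !kE//; last exact: (@measurableI _ Om).
  rewrite indicE; case: (boolP (w \in A)) => wA.
    rewrite mule1; congr (Q w _); apply/seteqP; split => w' /=; first by case.
    move=> Bg; split => //.
    exact: (stopped_agree sA (@agree_splice R X (tau w) w w') (set_mem wA)).
  rewrite mule0 (_ : _ @^-1` _ = set0) ?measure0//; apply/seteqP; split =>
    w' // [] gA _.
  move: wA; rewrite notin_setE; apply.
  have ag := @agree_splice R X (tau w) w w'.
  apply: (stopped_agree sA) gA.
  by rewrite (stopping_agree stau ag); exact: agree_sym.
have mkb B : borel B -> measurable_fun [set: Om] (fun w => k w B).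
  move=> bB.
  have m1 : measurable_fun [set: Om] (\1_B : Om -> R) by exact: measurable_indic.
  rewrite (_ : (fun w => _) = fun w =>
    (\int[Q w]_w' (\1_B (splice (tau w) w w'))%:E)%E).
    apply: (@measurable_fun_integral_family R _ _ Om Om Q _
      (fun p => (\1_B (splice (tau p.1) p.1 p.2))%:E)).
    - by move=> C bC; apply: (measurable_fun_stoppedW cg baseg stau); exact: mQ.
    - by move=> p; rewrite lee_fin.
    - by apply/measurable_EFinP; exact: (measurableT_comp m1 measurable_splice).
  apply/funext => w; rewrite kE// -[in LHS](setIT (_ @^-1` _)) -integral_indic//.
  exact: mgl.
have mk B : borel B -> measurable_fun [set: Fm] (fun w => k w B).
  move=> bB; apply: (measurable_fun_stopped cg baseg stau); first exact: mkb.
  move=> w w' ww'; have tw := stopping_agree stau ww'.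
  rewrite !kE//.
  (* For each Borel [C], the event that [Q v C] equals [Q w C] is in [F_tau] and contains [w], hence
     [w']. *)
  have -> : Q w' = Q w.
    apply: law_ext => C bC.
    have sC : stopped tau [set v | Q v C = Q w C].
      apply: (stopped_measurable cg baseg stau).
      have := mQ bC measurableT (emeasurable_set1 (Q w C)).
      by rewrite setTI.
    by have := stopped_agree sC ww' erefl.
  congr (Q w (_ @^-1` B)); apply/funext => w''.
  apply: path_ext => r r0; rewrite /gl tw !mkpathE ger0_norm//.
  rewrite -!rpath_num (ww' (tau w)%:num) ?lexx ?ge0//.
  by case: ifPn => // rt; rewrite ww'// r0 rt.
have [M ME] := @mixture_law R (paths R X) _ Om P k mkb.
have MI A B : stopped tau A -> borel B ->
    M (A `&` B) = (\int[P]_w (k w B * (\1_A w)%:E))%E.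
  move=> sA bB; have bA := stopped_borel sA.
  rewrite ME; last exact: (@measurableI _ Om).
  by apply: eq_integral => w _; exact: kI.
have MP A : stopped tau A -> M A = P A.
  move=> sA; have bA := stopped_borel sA; rewrite -[in LHS](setIT A) MI//;
    last first.
    exact: (@measurableT _ Om).
  under eq_integral do rewrite probability_setT mul1e.
  by rewrite integral_indic ?setIT.
have m1A A : stopped tau A -> measurable_fun [set: Fm] (fun w => (\1_A w)%:E :
  \bar R).
  move=> sA; apply/measurable_EFinP; apply: (@measurable_indic _ Fm).
  by rewrite (stopped_measurableE cg baseg stau).
have PM A (b : paths R X -> \bar R) : stopped tau A -> (forall w, 0 <= b w)%E ->
    measurable_fun [set: Fm] b ->
    (\int[P]_w (b w * (\1_A w)%:E) = \int[M]_(w in A) b w)%E.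
  move=> sA b0 mb; rewrite [in RHS]integral_in_stopped//;
    last exact: stopped_borel sA.
  apply/esym/(eq_integral_stopped cg baseg stau MP).
    by move=> w; rewrite mule_ge0// lee_fin.
  by apply: emeasurable_funM => //; exact: m1A.
have rk : is_rcpd M tau k.
  split=> [B bB|A B sA bB]; first by apply/(measurable_wrt_stoppedP cg baseg
    stau); exact: mk.
  by rewrite MI// PM//; exact: mk.
exists M; split; first exact: MP.
split; first by exists k.
move=> k' [mk' rk'].
have mth B : borel B -> borel (theta tau @^-1` B).
  by move=> bB; have := measurable_theta cg baseg stau measurableT bB; rewrite setTI.
(* Shifting undoes the splice on paths that start where [w] is at time [tau w], and these carry
   [Q w]. *)
have kth w B : borel B -> k w (theta tau @^-1` B) = Q w B.
  move=> bB; rewrite kE; last exact: mth.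
  pose S := [set w' | path_at w' (time0 R) = path_at_stop tau w].
  (* A [law] is [0] off the Borel sets, whereas [Q w] gives [S] the mass [1]. *)
  have bS : borel S.
    apply: contrapT => /(law_out (Q w)); rewrite Qstart => -[] /eqP.
    by rewrite oner_eq0.
  rewrite (@probability_setI1 _ _ _ (Q w) _ S)//; last by apply: mgl; exact: mth.
  rewrite [RHS](@probability_setI1 _ _ _ (Q w) _ S)//.
  congr (Q w _); apply/seteqP.
  have thgl w' : S w' -> theta tau (gl w w') = w'.
    move=> Sw'; rewrite /theta (stopping_agree stau
      (@agree_splice R X (tau w) w w')).
    exact: shift_splice.
  by split => w' [] /= h Sw'; split => //; move: h; rewrite thgl.
pose f1 s w := k' w (theta tau @^-1` gt0_set (coord_fun g) s).
pose f2 s w := Q w (gt0_set (coord_fun g) s).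
have bs s : borel (gt0_set (@coord_fun R X g) s).
  by apply: measurable_gt0_set => n; exact: continuous_coord_fun.
have h s : stopped tau [set w | f1 s w != f2 s w] /\ M [set w | f1 s w !=
  f2 s w] = 0%E.
  have b01 (mu : law R (paths R X)) B : borel B -> (0 <= mu B <= 1)%E.
    by move=> bB; rewrite measure_ge0 probability_le1.
  apply: (stopped_ae_eq cg baseg stau).
  - by apply/(measurable_wrt_stoppedP cg baseg stau); apply: mk'; exact: mth.
  - exact: mQ.
  - by move=> w; apply: b01; exact: mth.
  - by move=> w; exact: b01.
  move=> A sA; rewrite -rk'//; last exact: mth.
  rewrite MI//; last exact: mth.
  under eq_integral do rewrite kth//.
  by rewrite PM//; exact: mQ.
(* One null set for each finite list [s], and the empty set for integers that code none. *)
pose N n := if unpickle n is Some s then [set w | f1 s w != f2 s w] else set0.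
have sN n : stopped tau (N n).
  rewrite /N; case: unpickle => [s|]; first by case: (h s).
  by rewrite -(stopped_measurableE cg baseg stau); exact: measurable0.
exists (\bigcup_n N n); split.
- by apply: (@bigcupT_measurable _ Om) => n; exact: stopped_borel (sN n).
- apply: (@measure_bigcup_null _ _ Om) => n; first exact: stopped_borel (sN n).
  by rewrite /N; case: unpickle => [s|]; [case: (h s)|rewrite measure0].
move=> w nNw; exists (Q w) => //.
have [nu nuE] := pushforward_law (k' w) (measurable_theta cg baseg stau).
have cc n : continuous (coord_fun g n : paths R X -> R)
  by exact: continuous_coord_fun.
have bc := @borel_coord_fun R X g cg baseg.
move=> B bB; rewrite -nuE//; apply: (gt0_set_unique cc bc) B bB => s.
rewrite nuE//; apply/eqP; rewrite eq_sym; apply: contraT => f12.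
exfalso; apply: nNw; exists (pickle s) => //.
by rewrite /N pickleK.
Qed.

End concatenation.

(** * The weak topology on laws *)

Lemma continuous_borel_fun (T U : topologicalType) (f : T -> U) :
  continuous f -> borel_fun f.
Proof.
move=> /continuousP cf; have [s0 sC sU] := smallest_sigma_algebra setT (@open T).
have h : @borel U `<=` [set B | borel (f @^-1` B)].
  apply: smallest_sub; first split.
  - by rewrite /= preimage_set0.
  - by move=> A bA; rewrite /= setTD preimage_setC -setTD; exact: sC.
  - by move=> F bF; rewrite /= preimage_bigcup; exact: sU.
  by move=> B oB; apply: sub_sigma_algebra; exact: cf.
by move=> B /h.
Qed.

Section law_topology.
Context (R : realType) (T : ptopologicalType).

Lemma continuous_law_int (f : T -> R) : continuous f -> bounded_fun f ->
  continuous (law_int f : law R T -> R).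
Proof.
move=> cf bf P; pose F : Cb R T := exist _ f (conj cf bf).
have : nbhs P --> P by [].
move=> /cvg_sup /(_ F) h A /= fA.
apply: h; exact: (@initial_continuous (law R T) R (law_int f) P A fA).
Qed.

Lemma bounded_fun01 (f : T -> R) : (forall x, 0 <= f x <= 1) -> bounded_fun f.
Proof.
move=> f01; exists 1; split; first exact: num_real.
move=> y y1 x _ /=; have /andP[f0 f1] := f01 x.
by rewrite ger0_norm// (le_trans f1)// ltW.
Qed.

Lemma law_intE (f : T -> R) (P : law R T) : (forall x, 0 <= f x <= 1) ->
  measurable_fun [set: borelType T] (f : borelType T -> R) ->
  (law_int f P)%:E = (\int[P]_x (f x)%:E)%E.
Proof.
move=> f01 mf; rewrite /law_int /Rintegral fineK//.
have f0 : (0 <= \int[P]_x (f x)%:E)%E.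
  by apply: integral_ge0 => x _; rewrite lee_fin; case/andP: (f01 x).
rewrite ge0_fin_numE//; apply: (@le_lt_trans _ _ (\int[P]_x (cst 1 x))%E).
  apply: ge0_le_integral => //.
  - by move=> x _; rewrite lee_fin; case/andP: (f01 x).
  - exact/measurable_EFinP.
  - by move=> x _; rewrite lee_fin; case/andP: (f01 x).
by rewrite integral_cst// mul1e [X in (X < _)%E](probability_setT P) ltry.
Qed.

Lemma law_int01 (f : T -> R) (P : law R T) : (forall x, 0 <= f x <= 1) ->
  measurable_fun [set: borelType T] (f : borelType T -> R) ->
  0 <= law_int f P <= 1.
Proof.
move=> f01 mf; rewrite -!lee_fin law_intE//; apply/andP; split.
  by apply: integral_ge0 => x _; rewrite lee_fin; case/andP: (f01 x).
rewrite -(probability_setT P) -[leRHS]mul1e -integral_cst//.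
apply: ge0_le_integral => //.
- by move=> x _; rewrite lee_fin; case/andP: (f01 x).
- exact/measurable_EFinP.
- by move=> x _; rewrite lee_fin; case/andP: (f01 x).
Qed.

Section separating.
Variable g : nat -> T -> R.
Hypothesis cg : forall j, continuous (g j).
Hypothesis bg : @borel T `<=` <<s range (fun j => [set x | 0 < g j x]) >>.

Lemma test_fun01 L x : 0 <= test_fun g L x <= 1.
Proof. by rewrite test_fun_ge0 test_fun_le1. Qed.

Definition test_int (n : nat) : law R T -> R :=
  law_int (test_fun g (odflt ([::], 0%N) (unpickle n))).

Lemma continuous_test_int n : continuous (test_int n).
Proof.
apply: continuous_law_int; first exact: test_fun_continuous.
by apply: bounded_fun01 => x; exact: test_fun01.
Qed.

Lemma test_int_separates (P Q : law R T) :
  (forall n, test_int n P = test_int n Q) -> P = Q.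
Proof.
move=> PQ; apply: law_ext; apply: (test_fun_separates cg bg) => L.
rewrite -!law_intE; try exact: test_fun01; try exact: measurable_test_fun.
by congr EFin; have := PQ (pickle L); rewrite /test_int pickleK.
Qed.

(** The continuous real functions [test_int n] separate laws, and the real line is Hausdorff. *)
Lemma hausdorff_law : hausdorff_space (law R T).
Proof.
move=> P Q PQ; apply: test_int_separates => n.
apply: (@norm_hausdorff _ R) => A B PA QB.
have [M [MA MB]] := PQ _ _ (continuous_test_int PA) (continuous_test_int QB).
by exists (test_int n M).
Qed.

End separating.
End law_topology.

(** * Dynamic programming at a stopping time *)

Section dynamic_programming.
Context (R : realType) (X : ptopologicalType) (g : nat -> X -> R).
Hypothesis cg : forall j, continuous (g j).
Hypothesis baseg : forall x (A : set X), nbhs x A ->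
  exists2 j, 0 < g j x & [set y | 0 < g j y] `<=` A.
Variables (n : nat) (f : X -> R).
Hypotheses (cf : continuous f) (f01 : forall x, 0 <= f x <= 1).
Variable tau : paths R X -> time R.
Hypothesis stau : stopping_time tau.
Local Notation Om := (borelType (paths R X)).
Local Notation Fm := (g_sigma_algebraType (stopped tau)).
Local Notation Phi := (lap n f).

Lemma lap01 w : 0 <= Phi w <= 1.
Proof. by rewrite lap_ge0// lap_le1. Qed.

Lemma measurable_lap : measurable_fun [set: Om] (Phi : Om -> R).
Proof. by apply: continuous_borel; exact: continuous_lap. Qed.

Definition discount (w : paths R X) : R := expR (- (n.+1%:R * (tau w)%:num)).

Definition running (w : paths R X) : R := lap_before n f (tau w) w.

Lemma discount_gt0 w : 0 < discount w.
Proof. exact: expR_gt0. Qed.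

Lemma running_ge0 w : 0 <= running w.
Proof. exact: lap_before_ge0. Qed.

Lemma running_le1 w : running w <= 1.
Proof. by rewrite (le_trans (lap_before_le n cf f01 _ w))// lap_le1. Qed.

Lemma discount_le1 w : discount w <= 1.
Proof. by rewrite -expR0 ler_expR oppr_le0 mulr_ge0. Qed.

Lemma lap_running w : Phi w = running w + discount w * Phi (theta tau w).
Proof. exact: lap_shift. Qed.

Lemma measurable_discount : measurable_fun [set: Fm] (discount : Fm -> R).
Proof.
apply: (measurable_fun_stopped cg baseg stau); last first.
  by move=> w w' ww'; rewrite /discount (stopping_agree stau ww').
apply: measurableT_comp; first exact: measurable_expR.
apply: measurable_funN.
apply: measurable_funM; first exact: measurable_cst.
exact: (measurable_stopping cg baseg stau).
Qed.

Lemma measurable_lap_theta : measurable_fun [set: Om] ((Phi \o theta tau) : Om -> R).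
Proof. exact: (measurableT_comp measurable_lap
  (measurable_theta cg baseg stau)). Qed.

Lemma measurable_running : measurable_fun [set: Fm] (running : Fm -> R).
Proof.
apply: (measurable_fun_stopped cg baseg stau); last first.
  move=> w w' ww'; rewrite /running (stopping_agree stau ww').
  exact: lap_before_agree.
rewrite /running /lap_before; apply: measurable_funB; first exact: measurable_lap.
apply: measurable_funM; last exact: measurable_lap_theta.
exact: (measurable_fun_stoppedW cg baseg stau measurable_discount).
Qed.

(** Conditional expectation of the reward of the shifted path, computed from the version [k]. *)
Definition future (k : paths R X -> law R (paths R X)) (w : paths R X) : R :=
  fine (\int[k w]_w' (Phi (theta tau w'))%:E)%E.

Lemma lap_theta_int01 (P : law R (paths R X)) :
  (0 <= \int[P]_w (Phi (theta tau w))%:E <= 1)%E.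
Proof.
have h := @law_intE R (paths R X) (Phi \o theta tau) P (fun w => lap01 _)
  measurable_lap_theta.
rewrite -[X in (_ <= X <= _)%E]h !lee_fin.
by apply: law_int01; [move=> w; exact: lap01|exact: measurable_lap_theta].
Qed.

Lemma futureE k w : (future k w)%:E = (\int[k w]_w' (Phi (theta tau w'))%:E)%E.
Proof.
have /andP[h0 h1] := lap_theta_int01 (k w).
by rewrite fineK// ge0_fin_numE// (le_lt_trans h1)// ltry.
Qed.

Lemma future01 k w : 0 <= future k w <= 1.
Proof. by rewrite -!lee_fin futureE; exact: lap_theta_int01. Qed.

Lemma futureP (k : paths R X -> law R (paths R X)) (nu : law R (paths R X)) w :
  (forall B, borel B -> nu B = k w (theta tau @^-1` B)) -> future k w =
    law_int Phi nu.
Proof.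
move=> nuE; apply: EFin_inj.
rewrite futureE law_intE; [|exact: lap01|exact: measurable_lap].
apply/esym/(integral_law_image (measurable_theta cg baseg stau) nuE);
  first exact: measurable_lap.
by move=> w'; case/andP: (lap01 w').
Qed.

Lemma measurable_future P k : is_rcpd P tau k -> measurable_fun [set: Fm]
  (future k : Fm -> R).
Proof.
move=> [mk _]; apply/measurable_EFinP.
rewrite (_ : _ \o _ = fun w => \int[k w]_w' (Phi (theta tau w'))%:E)%E; last first.
  by apply/funext => w /=; rewrite futureE.
apply: (@measurable_fun_integral_kernel _ _ Fm Om R (fun w => k w)).
- by move=> B bB; apply/(measurable_wrt_stoppedP cg baseg stau); exact: mk.
- by move=> w; rewrite lee_fin; case/andP: (lap01 (theta tau w)).
- by apply/measurable_EFinP; exact: measurable_lap_theta.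
Qed.

(** Expected reward under [P] if the continuation after [tau] is worth [v w]. The rewards of [P] and
    of its concatenations all have this form, which reduces their comparison to that of the
    functions [v]. *)
Let value (P : law R (paths R X)) (v : paths R X -> R) : \bar R :=
  (\int[P]_w (running w)%:E + \int[P]_w ((discount w)%:E * (v w)%:E))%E.

Let mdisc : measurable_fun [set: Om] (discount : Om -> R).
Proof. exact: (measurable_fun_stoppedW cg baseg stau measurable_discount). Qed.

Let mrun : measurable_fun [set: Om] (running : Om -> R).
Proof. exact: (measurable_fun_stoppedW cg baseg stau measurable_running). Qed.

(** [running] and [discount] are [F_tau]-measurable, so conditioning acts only on the reward after
    [tau]. *)
Lemma rcpd_value P k : is_rcpd P tau k -> (law_int Phi P)%:E = value P (future k).
Proof.
move=> rk; have [mk hk] := rk.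
rewrite law_intE; [|exact: lap01|exact: measurable_lap].
under eq_integral do rewrite lap_running EFinD.
have p0 w : 0 <= Phi (theta tau w) by case/andP: (lap01 (theta tau w)).
rewrite ge0_integralD//; first last.
- by apply/measurable_EFinP; apply: measurable_funM => //;
    exact: measurable_lap_theta.
- by move=> w _; rewrite lee_fin mulr_ge0// ltW// discount_gt0.
- exact/measurable_EFinP.
- by move=> w _; rewrite lee_fin running_ge0.
congr (_ + _)%E.
under eq_integral do rewrite EFinM.
(* The measures with densities [Phi \o theta tau] and [future k] with respect to [P] agree on
   [F_tau], hence integrate [discount] alike. *)
apply: (@ge0_integral_weight R _ _ _ Om Om Fm P P id id (Phi \o theta tau) (future k)
  (measurable_id_stopped cg baseg stau) (measurable_id_stopped cg baseg stau)
  measurable_lap_theta (measurable_fun_stoppedW cg baseg stau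
    (measurable_future rk)) _ _ _
  (EFin \o discount)).
- by move=> w; exact: p0.
- by move=> w; case/andP: (future01 k w).
- move=> A /(stopped_measurable cg baseg stau) sA; have bA := stopped_borel sA.
  rewrite [RHS](eq_integral (fun w : Om =>
    \int[k w]_w' (Phi (theta tau w'))%:E)%E); last first.
    by move=> w _; rewrite futureE.
  apply: (@integral_mixture R _ _ _ Om Om Om P P id (fun w => k w) A A bA bA _ _ _
    (fun w => (Phi (theta tau w))%:E)).
  + exact: measurable_id.
  + move=> B bB; apply: (measurable_fun_stoppedW cg baseg stau).
    by apply/(measurable_wrt_stoppedP cg baseg stau); exact: mk.
  + by move=> B bB; exact: hk.
  + by move=> w; rewrite lee_fin p0.
  + by apply/measurable_EFinP; exact: measurable_lap_theta.
- by move=> w; rewrite lee_fin ltW// discount_gt0.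
- by apply/measurable_EFinP; exact: measurable_discount.
Qed.

(** [M] agrees with [P] on [F_tau], and its conditional laws after [tau] are the [Q w], so
    [future k] is almost surely the reward of [Q w]. *)
Lemma concat_value P Q M : is_concat P tau Q M ->
  measurable_fun [set: Fm] ((fun w => law_int Phi (Q w)) : Fm -> R) ->
  (law_int Phi M)%:E = value P (fun w => law_int Phi (Q w)).
Proof.
move=> [MP [[k rk] /(_ k rk)[N [bN MN hN]]]] mQ.
rewrite (rcpd_value rk) /value.
have Q01 w : 0 <= law_int Phi (Q w) <= 1.
  by apply: law_int01; [exact: lap01|exact: measurable_lap].
have mQE : measurable_fun [set: Fm]
  (fun w => (discount w)%:E * (law_int Phi (Q w))%:E)%E.
  by apply/measurable_EFinP; apply: measurable_funM => //;
    exact: measurable_discount.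
congr (_ + _)%E.
  apply: (eq_integral_stopped cg baseg stau MP).
    by move=> w; rewrite lee_fin running_ge0.
  by apply/measurable_EFinP; exact: measurable_running.
(* The [F_tau]-measurable integrand is moved from [P] to [M], the law for which [N] is null. *)
rewrite -(eq_integral_stopped cg baseg stau MP); last 2 first.
- by move=> w; rewrite mule_ge0 ?lee_fin// ?(ltW (discount_gt0 _))//;
    case/andP: (Q01 w).
- exact: mQE.
apply: ge0_ae_eq_integral => //.
- by apply/measurable_EFinP; apply: measurable_funM => //;
    exact: (measurable_fun_stoppedW cg baseg stau (measurable_future rk)).
- exact: (measurable_fun_stoppedW cg baseg stau mQE).
- by move=> w _; rewrite mule_ge0 ?lee_fin// ?(ltW (discount_gt0 _))//;
    case/andP: (future01 k w).
- by move=> w _; rewrite mule_ge0 ?lee_fin// ?(ltW (discount_gt0 _))//;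
    case/andP: (Q01 w).
exists N; split => // w; apply: contra_notP => nNw _.
have [nu -> nuE] := hN w nNw.
by rewrite (futureP nuE).
Qed.

End dynamic_programming.

Section weighted_comparison.
Context (R : realType) d (T : measurableType d) (P : probability T R).
Variables (e v1 v2 : T -> R) (N : set T).
Hypotheses (me : measurable_fun [set: T] e) (mv1 : measurable_fun [set: T] v1)
  (mv2 : measurable_fun [set: T] v2).
Hypotheses (e0 : forall x, 0 < e x) (e1 : forall x, e x <= 1).
Hypotheses (v101 : forall x, 0 <= v1 x <= 1) (v201 : forall x, 0 <= v2 x <= 1).
Hypotheses (mN : measurable N) (PN : P N = 0%E)
  (v12 : forall x, ~ N x -> v1 x <= v2 x).

Let mev v : measurable_fun [set: T] v ->
  measurable_fun [set: T] (fun x => (e x)%:E * (v x)%:E)%E.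
Proof. by move=> mv; apply/measurable_EFinP; exact: measurable_funM. Qed.

Let ev0 v : (forall x, 0 <= v x <= 1) -> forall x, (0 <= (e x)%:E * (v x)%:E)%E.
Proof. by move=> v01 x; rewrite mule_ge0// lee_fin ?(ltW (e0 _))//;
  case/andP: (v01 x). Qed.

Lemma weighted_le : (\int[P]_x ((e x)%:E * (v1 x)%:E) <=
  \int[P]_x ((e x)%:E * (v2 x)%:E))%E.
Proof.
apply: ae_ge0_le_integral => //.
- by move=> x _; exact: ev0.
- exact: mev.
- by move=> x _; exact: ev0.
- exact: mev.
exists N; split => // x; apply: contra_notP => nNx _.
by rewrite -!EFinM lee_fin ler_wpM2l ?v12// ltW.
Qed.

(** The weighted integrals coincide and the weight is positive, so the difference [v2 - v1], almost
    surely non-negative, vanishes almost surely. This makes optimality in expectation an almost sure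
    statement. *)
Lemma weighted_lt_null :
  (\int[P]_x ((e x)%:E * (v2 x)%:E) <= \int[P]_x ((e x)%:E * (v1 x)%:E))%E ->
  P [set x | v1 x < v2 x] = 0%E.
Proof.
move=> le21; pose v x := Num.max 0 (v2 x - v1 x).
have mv : measurable_fun [set: T] v.
  by apply: measurable_maxr => //; exact: measurable_funB.
have v01 x : 0 <= v x <= 1.
  rewrite /v le_max lexx/= ge_max ler01/= lerBlDr.
  by have /andP[h1 _] := v101 x; have /andP[_ h2] := v201 x;
    rewrite (le_trans h2)// lerDl.
have eq2 : (\int[P]_x ((e x)%:E * (v2 x)%:E) =
    \int[P]_x ((e x)%:E * (v1 x)%:E) + \int[P]_x ((e x)%:E * (v x)%:E))%E.
  rewrite -ge0_integralD//; [|by move=> x _; exact: ev0|exact: mev|by move=> x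
    _; exact: ev0|exact: mev].
  apply: ge0_ae_eq_integral => //.
  - exact: mev.
  - by apply: emeasurable_funD; exact: mev.
  - by move=> x _; exact: ev0.
  - by move=> x _; rewrite adde_ge0// ev0.
  exists N; split => // x; apply: contra_notP => nNx _.
  by rewrite -!EFinM -EFinD -mulrDr /v max_r ?subr_ge0 ?v12// addrC subrK.
(* Finiteness allows this term to be cancelled below. *)
have fin1 : (\int[P]_x ((e x)%:E * (v1 x)%:E))%E \is a fin_num.
  rewrite ge0_fin_numE; last by apply: integral_ge0 => x _; exact: ev0.
  apply: (@le_lt_trans _ _ (\int[P]_x (cst 1 x))%E).
    apply: ge0_le_integral => //.
    - by move=> x _; exact: ev0.
    - exact: mev.
    - move=> x _; rewrite -EFinM lee_fin mulr_ile1 ?(ltW (e0 x))//;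
      by case/andP: (v101 x).
  by rewrite integral_cst// mul1e [X in (X < _)%E](probability_setT P) ltry.
have ev_null : (\int[P]_x `|(e x)%:E * (v x)%:E| = 0)%E.
  under eq_integral do rewrite gee0_abs ?ev0//.
  apply/eqP; rewrite eq_le; apply/andP; split; last first.
    by apply: integral_ge0 => x _; exact: ev0.
  by rewrite -(leeD2lE _ _ fin1) adde0 -eq2.
have [N' [mN' PN' sub]] := (ae_eq_integral_abs P measurableT (mev mv)).1 ev_null.
have mA : measurable [set x | v1 x < v2 x].
  by rewrite -[X in measurable X]setTI;
    exact: (measurable_fun_ltr mv1 mv2 measurableT).
apply/eqP; rewrite -measure_le0 -[leRHS]PN'; apply: le_measure; rewrite ?inE//.
move=> x /= v12x; apply: sub => /= /(_ I) /eqP.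
rewrite -EFinM eqe mulf_eq0 gt_eqF//= /v => /eqP.
by rewrite max_r ?subr_ge0 ?(ltW v12x)// => /eqP; rewrite subr_eq0 gt_eqF.
Qed.

End weighted_comparison.

(** * Maximization preserves the Markovian structure *)

Section krylov.
Context (R : realType) (X : ptopologicalType) (g : nat -> X -> R).
Hypothesis cg : forall j, continuous (g j).
Hypothesis baseg : forall x (A : set X), nbhs x A ->
  exists2 j, 0 < g j x & [set y | 0 < g j y] `<=` A.
Hypothesis sepg : forall x y, (forall j, (0 < g j x) = (0 < g j y)) -> x = y.
Local Notation Om := (borelType (paths R X)).
Implicit Types (D : X -> set (law R (paths R X))).

Definition started D := forall x P, D x P ->
  P [set w | path_at w (time0 R) = x] = 1%E.

Definition conditioning_stable D := forall x P, D x P -> forall tau,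
  stopping_time tau ->
  shift_cond_as P tau (stopped tau) (fun w => D (path_at_stop tau w)).

Definition concat_stable D := forall x P, D x P -> forall tau, stopping_time tau ->
  forall Q, measurable_selection_at tau D Q ->
  forall M, is_concat P tau Q M -> D x M.

Definition markovian D :=
  [/\ selectable D, started D, conditioning_stable D & concat_stable D].

Let ccf n : continuous (coord_fun g n : paths R X -> R).
Proof. exact: continuous_coord_fun. Qed.

Lemma borel_selection D : selectable D ->
  exists2 h : X -> law R (paths R X), borel_fun h & forall x, D x (h x).
Proof.
have bcf := borel_coord_fun cg baseg.
apply: (@selectable_selection R X _ (hausdorff_law ccf bcf)
  (test_int (coord_fun g))).
  exact: (continuous_test_int ccf).
exact: (test_int_separates ccf bcf).
Qed.

(** The position at time [tau] is [F_tau]-measurable, hence so is a Borel selector read there. Its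
    laws start at that position, as [concat_exists] requires. *)
Lemma markov_concat D (h : X -> law R (paths R X)) tau :
  started D -> borel_fun h -> (forall x, D x (h x)) -> stopping_time tau ->
  measurable_selection_at tau D (fun w => h (path_at_stop tau w)) /\
  forall P, exists M, is_concat P tau (fun w => h (path_at_stop tau w)) M.
Proof.
move=> sD bh hD stau.
have mF (f : Cb R (paths R X)) : measurable_wrt (stopped tau)
    (fun w => law_int (proj1_sig f) (h (path_at_stop tau w))).
  move=> B bB; have [cf bf] := proj2_sig f.
  have b1 := continuous_borel_fun (continuous_law_int cf bf :
    continuous (_ : law R _ -> R)) bB.
  have := measurable_path_at_stop cg baseg stau measurableT (bh _ b1).
  by rewrite setTI (stopped_measurableE cg baseg stau).
split; first by split.
move=> P; apply: (concat_exists cg baseg sepg stau) => [|w].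
  apply: (measurable_law_family ccf (borel_coord_fun cg baseg)) => L.
  have cF : continuous (test_fun (coord_fun g) L : paths R X -> R)
    by exact: test_fun_continuous.
  have bF : bounded_fun (test_fun (coord_fun g) L : paths R X -> R).
    by apply: bounded_fun01 => w; exact: test_fun01.
  pose F : Cb R (paths R X) := exist _ _ (conj cF bF).
  rewrite (_ : (fun w => _) = EFin \o
    (fun w => law_int (test_fun (coord_fun g) L) (h (path_at_stop tau w)))).
    by apply/measurable_EFinP/(measurable_wrt_stoppedRP cg baseg stau);
      exact: (mF F).
  apply/funext => w /=; rewrite law_intE//; first by move=> w'; exact: test_fun01.
  exact: measurable_test_fun.
exact: sD (hD _).
Qed.

Section improvement.
Variables (n : nat) (f : X -> R).
Hypotheses (cf : continuous f) (f01 : forall x, 0 <= f x <= 1).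
Local Notation Phi := (law_int (lap n f) : law R (paths R X) -> R).

Lemma continuous_Phi : continuous Phi.
Proof.
apply: continuous_law_int; first exact: continuous_lap.
by apply: bounded_fun01 => w; exact: lap01.
Qed.

Let Phi01 nu : 0 <= Phi nu <= 1.
Proof. by apply: law_int01; [exact: lap01|exact: measurable_lap]. Qed.

Let running_int_fin tau (P : law R (paths R X)) : stopping_time tau ->
  (\int[P]_w (running n f tau w)%:E)%E \is a fin_num.
Proof.
move=> stau; have m := measurable_running cg baseg n cf f01 stau.
rewrite -law_intE//; first by move=> w; rewrite running_ge0// running_le1.
exact: (measurable_fun_stoppedW cg baseg stau m).
Qed.

Lemma markovian_argmax D : markovian D -> markovian (argmax Phi D).
Proof.
move=> [selD sD condD concD].
have selA := argmax_selectable continuous_Phi selD.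
split=> //.
- by move=> x P [/sD].
- move=> x P [DP maxP] tau stau.
  have [exk hk] := condD x P DP tau stau; split => // k rk.
  have [N [sN PN hN]] := hk k rk.
  (* Several maximizers may still exist at a point; the separating functionals provide a Borel
     choice among them, and [v] is the optimal reward of a continuation. *)
  have [h bh hA] := borel_selection selA.
  have hD y : D y (h y) by case: (hA y).
  have [selQ /(_ P) [M hM]] := markov_concat sD bh hD stau.
  pose v w := Phi (h (path_at_stop tau w)).
  have mv : measurable_fun [set: g_sigma_algebraType (stopped tau)] v.
    have bl : bounded_fun (lap n f : paths R X -> R).
      by apply: bounded_fun01 => w; exact: lap01.
    apply/(measurable_wrt_stoppedRP cg baseg stau).
    pose F : Cb R (paths R X) := exist _ (lap n f : paths R X -> R)
      (conj (continuous_lap cf f01) bl).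
    by have [hs _] := selQ; exact: (hs F).
  have mfut := measurable_future cg baseg n cf f01 stau rk.
  have le_fut w : ~ N w -> future n f tau k w <= v w.
    move=> nNw; have [nu Dnu nuE] := hN w nNw.
    rewrite (futureP cg baseg n cf f01 stau nuE).
    by have [_ ] := hA (path_at_stop tau w); apply.
  (* Where the conditional law falls short of the optimum. This set is null because the
     concatenation [M] stays in [D x] and so cannot beat [P]. *)
  pose A := [set w | future n f tau k w < v w].
  have sA : stopped tau A.
    apply: (stopped_measurable cg baseg stau).
    rewrite -[X in measurable X]setTI;
      exact: (measurable_fun_ltr mfut mv measurableT).
  have PA : P A = 0%E.
    have DM : D x M by exact: concD hM.
    apply: (@weighted_lt_null R _ Om P (discount n tau) (future n f tau k) v N)
      => //.
    + exact: (measurable_fun_stoppedW cg baseg stau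
        (measurable_discount cg baseg n stau)).
    + exact: (measurable_fun_stoppedW cg baseg stau mfut).
    + exact: (measurable_fun_stoppedW cg baseg stau mv).
    + by move=> w; exact: discount_gt0.
    + by move=> w; exact: discount_le1.
    + by move=> w; exact: future01.
    + by move=> w; exact: Phi01.
    + exact: stopped_borel sN.
    have := maxP M DM; rewrite -lee_fin.
    rewrite (rcpd_value cg baseg n cf f01 stau rk)
      (concat_value cg baseg cf f01 stau hM mv).
    by rewrite leeD2lE// running_int_fin.
  exists (N `|` A); split.
  + rewrite -(stopped_measurableE cg baseg stau); apply: measurableU.
      by rewrite (stopped_measurableE cg baseg stau).
    by rewrite (stopped_measurableE cg baseg stau).
  + by rewrite (@measureU0 _ Om R P)//;
      [exact: stopped_borel sN|exact: stopped_borel sA].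
  + move=> w nNA; have nNw : ~ N w by move=> Nw; apply: nNA; left.
    have [nu Dnu nuE] := hN w nNw; exists nu => //; split => // q Dq.
    have [_ hmax] := hA (path_at_stop tau w); apply: (le_trans (hmax _ Dq)).
    rewrite -(futureP cg baseg n cf f01 stau nuE) leNgt; apply/negP => h'.
    by apply: nNA; right.
- move=> x P [DP maxP] tau stau Q [mQ hQ] M hM.
  have QD w : D (path_at_stop tau w) (Q w) by case: (hQ w).
  have DM : D x M by apply: (concD x P DP tau stau Q).
  (* It suffices that [M] does at least as well as [P]: the continuations [Q w] are optimal in [D],
     where those of [P] almost surely lie. *)
  split => // q Dq; apply: (le_trans (maxP q Dq)).
  have bl : bounded_fun (lap n f : paths R X -> R).
    by apply: bounded_fun01 => w; exact: lap01.
  pose F : Cb R (paths R X) := exist _ (lap n f : paths R X -> R)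
    (conj (continuous_lap cf f01) bl).
  have mv : measurable_fun [set: g_sigma_algebraType (stopped tau)]
    (fun w => Phi (Q w)).
    by apply/(measurable_wrt_stoppedRP cg baseg stau); exact: (mQ F).
  have [[k rk] hk] := condD x P DP tau stau; have [N [sN PN hN]] := hk k rk.
  rewrite -lee_fin (rcpd_value cg baseg n cf f01 stau rk)
    (concat_value cg baseg cf f01 stau hM mv).
  rewrite leeD2lE ?running_int_fin//.
  apply: (@weighted_le R _ Om P (discount n tau) (future n f tau k)
    (fun w => Phi (Q w)) N) => //.
  + exact: (measurable_fun_stoppedW cg baseg stau
      (measurable_discount cg baseg n stau)).
  + exact: (measurable_fun_stoppedW cg baseg stau
      (measurable_future cg baseg n cf f01 stau rk)).
  + exact: (measurable_fun_stoppedW cg baseg stau mv).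
  + by move=> w; exact: discount_gt0.
  + by move=> w; exact: future01.
  + exact: stopped_borel sN.
  move=> w nNw; have [nu Dnu nuE] := hN w nNw.
  rewrite (futureP cg baseg n cf f01 stau nuE).
  by have [_ ] := hQ w; apply.
Qed.
End improvement.

End krylov.

(** * Lerch's theorem for bounded continuous functions *)

Section lerch.
Context (R : realType).
Local Notation mu := (@lebesgue_measure R).
Local Notation D := (`[0%R, +oo[%classic : set R).

Let integrable_disc (k : R -> R) (M : R) : measurable_fun [set: R] k ->
  (forall t, 0 <= t -> `|k t| <= M) ->
  mu.-integrable D (EFin \o (fun t => dexp 0 t * k t)).
Proof.
move=> mk kM.
have M0 : 0 <= M by rewrite (le_trans _ (kM 0 _)).
have mf : measurable_fun D (fun t => dexp 0 t * k t).
  apply: measurable_funM; apply: measurable_funTS => //.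
  by apply: continuous_measurable_fun; exact: continuous_dexp.
apply/integrableP; split; first exact/measurable_EFinP.
apply: (@le_lt_trans _ _ (disc_int 0 (cst M))); last by rewrite disc_int_cst// ltry.
apply: ge0_le_integral => //.
- by apply: measurableT_comp => //; exact/measurable_EFinP.
- by apply: measurable_disc => t; exact: cst_continuous.
- move=> t; rewrite /= in_itv/= andbT => t0.
  by rewrite lee_fin normrM ger0_norm ?dexp_ge0// ler_wpM2l ?dexp_ge0// kM.
Qed.

Variables u v : R -> R.
Hypotheses (cu : continuous u) (cv : continuous v).
Hypotheses (u01 : forall t, 0 <= u t <= 1) (v01 : forall t, 0 <= v t <= 1).
Hypothesis uv : forall n, disc_int n u = disc_int n v.

Let g t := u t - v t.

Let g1 t : `|g t| <= 1.
Proof.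
rewrite ler_norml /g; have /andP[a b] := u01 t; have /andP[c d] := v01 t.
by apply/andP; split; lra.
Qed.

Let mg : measurable_fun [set: R] g.
Proof. by apply: measurable_funB; exact: continuous_measurable_fun. Qed.

Let e t : R := expR (- t).

Let me_ : measurable_fun [set: R] e.
Proof. by apply: measurableT_comp => //; exact: measurable_funN. Qed.

Let e01 t : 0 <= t -> 0 <= e t <= 1.
Proof. by move=> t0; rewrite expR_ge0 -expR0 ler_expR oppr_le0. Qed.

Let mpoly (p : {poly R}) : measurable_fun [set: R] (fun t => p.[e t]).
Proof.
apply: (measurableT_comp _ me_).
by apply: continuous_measurable_fun; exact: continuous_horner.
Qed.

Let poly_bounded (p : {poly R}) : exists2 M, 0 <= M & forall t, 0 <= t ->
  `|p.[e t]| <= M.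
Proof.
elim/poly_ind: p => [|p c [M M0 hM]].
  by exists 0 => // t _; rewrite horner0 normr0.
exists (M + `|c|); first by rewrite addr_ge0.
move=> t t0; rewrite !hornerE (le_trans (ler_normD _ _))// lerD2r normrM.
have /andP[a b] := e01 t0; rewrite (ger0_norm a) -[leRHS]mulr1.
by rewrite ler_pM// hM.
Qed.

Let integrable_poly (p : {poly R}) :
  mu.-integrable D (EFin \o (fun t => dexp 0 t * (p.[e t] * g t))).
Proof.
have [M M0 hM] := poly_bounded p.
apply: (@integrable_disc _ M); first exact: measurable_funM.
by move=> t t0; rewrite normrM -[leRHS]mulr1 ler_pM// hM.
Qed.

(** In the variable [e t], the weight [dexp j] is [j.+1] times [dexp 0] times the [j]-th power, so
    equal transforms at the integer rates mean equal moments. *)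
Let moment (j : nat) : (\int[mu]_(t in D) (dexp 0 t * (('X^j).[e t] * g t)))%R = 0.
Proof.
have iu (w : R -> R) : (continuous w) -> (forall t, 0 <= w t <= 1) ->
    mu.-integrable D (EFin \o (fun t => dexp 0 t * (('X^j).[e t] * w t))).
  move=> cw w01; have [M M0 hM] := poly_bounded 'X^j.
  apply: (@integrable_disc _ M).
    by apply: measurable_funM => //; exact: continuous_measurable_fun.
  move=> t t0; rewrite normrM -[leRHS]mulr1 ler_pM// ?hM//.
  by have /andP[a b] := w01 t; rewrite ger0_norm.
have key (w : R -> R) : (continuous w) -> (forall t, 0 <= w t <= 1) ->
    fine (disc_int j w) = j.+1%:R *
      (\int[mu]_(t in D) (dexp 0 t * (('X^j).[e t] * w t)))%R.
  move=> cw w01; rewrite -RintegralZl//; last exact: iu.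
  apply: eq_Rintegral => t _; rewrite mulrA mulrA; congr (_ * _).
  rewrite /dexp hornerXn /e -expRM_natl mul1r mul1r -mulrA; congr (_ * _).
  by rewrite -expRD; congr expR; rewrite -[j.+1%:R]natr1; ring.
have : j.+1%:R * (\int[mu]_(t in D) (dexp 0 t * (('X^j).[e t] * u t)))%R =
       j.+1%:R * (\int[mu]_(t in D) (dexp 0 t * (('X^j).[e t] * v t)))%R.
  by rewrite -!key// uv.
move=> /(mulfI (lt0r_neq0 (ltr0Sn _ _))) uvj.
transitivity (\int[mu]_(t in D) (dexp 0 t * (('X^j).[e t] * u t) - dexp 0 t *
  (('X^j).[e t] * v t)))%R.
  by apply: eq_Rintegral => t _; rewrite /g !mulrBr.
by rewrite RintegralB// ?uvj ?subrr//; exact: iu.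
Qed.

Let poly_integral0 (p : {poly R}) :
  (\int[mu]_(t in D) (dexp 0 t * (p.[e t] * g t)))%R = 0.
Proof.
(* [poly_ind] builds a polynomial as [q * 'X + c]; the extra factor ['X^j] absorbs the ['X] in the
   induction. *)
suff h (q : {poly R}) j : (\int[mu]_(t in D)
  (dexp 0 t * ((q * 'X^j).[e t] * g t)))%R = 0.
  by have := h p 0%N; rewrite expr0 mulr1.
elim/poly_ind: q j => [|q c ih] j.
  rewrite mul0r; under eq_Rintegral do rewrite horner0 mul0r mulr0.
  by rewrite Rintegral_cst// mul0r.
rewrite mulrDl -mulrA -exprS.
transitivity (\int[mu]_(t in D) (dexp 0 t * ((q * 'X^(j.+1)).[e t] * g t) +
    c * (dexp 0 t * (('X^j).[e t] * g t))))%R.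
  by apply: eq_Rintegral => t _; rewrite hornerD mulrDl mulrDr hornerCM;
    congr (_ + _); ring.
rewrite RintegralD//; last first.
  by rewrite (_ : _ \o _ = fun t =>
    (c%:E * (dexp 0 t * (('X^j).[e t] * g t))%:E)%E)//; apply: integrableZl =>
    //; exact: integrable_poly.
by rewrite ih RintegralZl// moment mulr0 addr0.
Qed.

(** Every polynomial in [e t] has integral [0] against [g] under the weight [dexp 0]. If [g] were at
    least [c > 0] on [[t0, t0 + d]], where [e t] runs through [[a, b]], then high powers of a
    parabola peaked at the midpoint of [[a, b]] would give a positive integral. *)
Lemma laplace_le t0 : 0 <= t0 -> u t0 <= v t0.
Proof.
move=> t00; rewrite leNgt; apply/negP => vu.
pose c := (u t0 - v t0) / 2.
have c0 : 0 < c by rewrite divr_gt0// subr_gt0.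
have cg0 : c < g t0 by rewrite /c /g; lra.
clearbody c.
have [d d0 hd] : exists2 d, 0 < d & forall t, t0 <= t <= t0 + d -> c <= g t.
  have cg : continuous g by move=> t; apply: (@continuousB R R R);
    [exact: cu|exact: cv].
  have /nbhs_ballP[d /= d0 hd] : \forall t \near t0, c < g t.
    apply: (cg t0 [set r | c < r]); apply: open_nbhs_nbhs; split => //;
      exact: open_gt.
  exists (d / 2); first by rewrite divr_gt0.
  move=> t /andP[tt0 ttd]; apply/ltW/hd; rewrite /ball/= ltr_distlC; apply/andP;
    split; lra.
pose a := e (t0 + d); pose b := e t0; pose s1 := (a + b) / 2; pose h := (b - a) / 2.
have ab : a < b by rewrite ltr_expR ltrN2 ltrDl.
have a0 : 0 < a by exact: expR_gt0.
have b1 : b <= 1 by case/andP: (e01 t00).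
have h0 : 0 < h by rewrite divr_gt0// subr_gt0.
have h1 : h < 1 by rewrite /h; lra.
pose q : {poly R} := 1 - ('X - s1%:P) ^+ 2.
have qE t : q.[e t] = 1 - (e t - s1) ^+ 2 by rewrite /q !hornerE.
(* [m1] bounds [q] from below on the middle half of [[a, b]], and [m2] bounds it from above outside
   [[a, b]]. *)
pose m1 := 1 - (h / 2) ^+ 2; pose m2 := 1 - h ^+ 2.
have m21 : m2 < m1 by rewrite /m1 /m2; nra.
have m20 : 0 < m2 by rewrite /m2; nra.
(* Between the times [t2] and [t3], [e t] runs through the middle half of [[a, b]]; their mass under
   [dexp 0] is the length [h] of that half. *)
pose t2 := - ln (s1 + h / 2); pose t3 := - ln (s1 - h / 2).
have s20 : 0 < s1 + h / 2 by rewrite /s1 /h; lra.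
have s30 : 0 < s1 - h / 2 by rewrite /s1 /h; lra.
have e2 : e t2 = s1 + h / 2 by rewrite /e opprK lnK.
have e3 : e t3 = s1 - h / 2 by rewrite /e opprK lnK.
have e_le r t : (e r <= e t) = (t <= r) by rewrite /e ler_expR lerN2.
have e_lt r t : (e r < e t) = (t < r) by rewrite /e ltr_expR ltrN2.
have t20 : 0 <= t2.
  by rewrite -e_le e2 /e oppr0 expR0 /s1 /h; lra.
have t23 : t2 < t3 by rewrite -e_lt e2 e3; lra.
have before (r : R) : 0 <= r ->
  (\int[mu]_(t in `[0%R, r[) (dexp 0 t)%:E = (1 - e r)%:E)%E.
  have c1 : continuous (cst 1 : R -> R) by move=> t; exact: cst_continuous.
  move=> r0; have := @disc_int_shift R 0 (cst 1) r c1 (fun=> ler01) r0.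
  rewrite (_ : (fun t => cst 1 (r + t)%R) = cst 1 :> (R -> R))// disc_int1 mule1
    mul1r.
  move=> h'.
  rewrite EFinB [X in (X - _)%E]h' addeK//.
  by apply: eq_integral => t _; rewrite mulr1.
have intJ : (\int[mu]_(t in `[t2, t3[) (dexp 0 t)%:E = h%:E)%E.
  have := before t3 (le_trans t20 (ltW t23)).
  have -> : `[0, t3[%classic = `[0, t2[%classic `|` `[t2, t3[%classic :> set R.
    by rewrite -itv_bndbnd_setU// ?bnd_simp// ltW.
  rewrite ge0_integral_setU//=; last 3 first.
  - apply/measurable_EFinP; apply: measurable_funTS.
    by apply: continuous_measurable_fun; exact: continuous_dexp.
  - by move=> t _; rewrite lee_fin dexp_ge0.
  - apply/disj_set2P; rewrite -subset0 => t [] /=; rewrite !in_itv/= => /andP[_ tc].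
    by rewrite leNgt tc.
  rewrite before// => h'.
  have : (h%:E = (1 - e t3)%:E - (1 - e t2)%:E)%E.
    by rewrite -EFinB e2 e3; congr EFin; lra.
  by rewrite -h' addeAC subee// add0e.
have m10 : 0 < m1 by exact: lt_trans m21.
have [c_ge0 m1_ge0 m2_ge0] : [/\ 0 <= c, 0 <= m1 & 0 <= m2] by rewrite !ltW.
(* [k] is a minorant of the [N]-th power of [q] times [g]. Off [[t0, t0 + d]] only the bound [1] on
   the absolute value of [g] is available, which costs [m2 ^+ N]. *)
have key N : c * (h * m1 ^+ N) <= m2 ^+ N.
  pose k t : R := c * m1 ^+ N * \1_(`[t2, t3[%classic) t - m2 ^+ N.
  have mk : measurable_fun [set: R] k.
    apply: measurable_funB; last exact: measurable_cst.
    by apply: measurable_funM; [exact: measurable_cst|exact: measurable_indic].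
  have ik1 : mu.-integrable D (EFin \o
    (fun t => dexp 0 t * \1_(`[t2, t3[%classic) t)).
    apply: (@integrable_disc _ 1); first exact: measurable_indic.
    by move=> t _; rewrite indicE; case: (_ \in _); rewrite ?normr1 ?normr0.
  have ik2 : mu.-integrable D (EFin \o (fun t => dexp 0 t * cst 1 t)).
    by apply: (@integrable_disc _ 1) => // t _; rewrite normr1.
  have ik : mu.-integrable D (EFin \o (fun t => dexp 0 t * k t)).
    apply: (@integrable_disc _ (c * m1 ^+ N + m2 ^+ N)) => // t _.
    rewrite (le_trans (ler_normB _ _))// normrM !ger0_norm ?mulr_ge0 ?exprn_ge0//.
    rewrite lerD2r -[leRHS]mulr1 ler_wpM2l ?mulr_ge0 ?exprn_ge0//.
  have kq t : 0 <= t -> k t <= (q ^+ N).[e t] * g t.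
    move=> t00'; rewrite horner_exp qE /k.
    have /andP[et0 et1] := e01 t00'.
    have q0 : 0 <= 1 - (e t - s1) ^+ 2 by rewrite /s1; nra.
    have gN1 : - 1 <= g t by have := g1 t; rewrite ler_norml => /andP[].
    have m2N : 0 <= m2 ^+ N by rewrite exprn_ge0// ltW.
    have [tJ|tJ] := boolP (t0 <= t <= t0 + d); last first.
      have nJ : (t \in `[t2, t3[%classic) = false.
        apply/negbTE; apply: contra tJ; rewrite inE/= in_itv/= => /andP[tt2 tt3].
        rewrite -[t0 <= t]e_le -[t <= t0 + d]e_le -/a -/b; move: tt2 tt3.
        rewrite -[t2 <= t]e_le -[t < t3]e_lt e2 e3 => tt2 tt3.
        by apply/andP; split; rewrite /s1 /h in tt2 tt3 *; lra.
      rewrite indicE nJ mulr0 add0r.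
      have qm : 1 - (e t - s1) ^+ 2 <= m2.
        move: tJ; rewrite negb_and -!ltNge -[t < t0]e_lt -[t0 + d < t]e_lt -/a
          -/b /m2 /h /s1 => /orP[] tJ; nra.
      have : (1 - (e t - s1) ^+ 2) ^+ N <= m2 ^+ N by rewrite lerXn2r ?nnegrE// ltW.
      have := exprn_ge0 N q0; nra.
    have gc := hd t tJ.
    rewrite indicE; case: (boolP (t \in _)) => tin; last first.
      rewrite mulr0 add0r (le_trans (y := 0))// ?oppr_le0//.
      by rewrite mulr_ge0 ?exprn_ge0// (le_trans (ltW c0)).
    rewrite mulr1 (le_trans (y := c * m1 ^+ N))//; first by rewrite gerBl.
    rewrite mulrC ler_pM ?exprn_ge0 ?(ltW c0) ?(ltW (lt_trans m20 m21))//.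
    rewrite lerXn2r ?nnegrE ?(ltW (lt_trans m20 m21))//.
    move: tin; rewrite inE/= in_itv/= -[t2 <= t]e_le -[t < t3]e_lt e2 e3 =>
      /andP[i1 i2].
    by rewrite /m1; nra.
  have := @le_Rintegral _ _ R mu D _ _ _ ik (integrable_poly (q ^+ N)) _.
  rewrite poly_integral0 => /(_ _ _) le0.
  have : (\int[mu]_(t in D) (dexp 0 t * k t))%R <= 0.
    apply: le0 => // t; rewrite /= in_itv/= andbT => t00'.
    by rewrite ler_wpM2l ?dexp_ge0// kq.
  have -> : (\int[mu]_(t in D) (dexp 0 t * k t))%R =
      (\int[mu]_(t in D) ((c * m1 ^+ N) * (dexp 0 t * \1_(`[t2, t3[%classic) t)
        - m2 ^+ N * (dexp 0 t * cst 1 t)))%R.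
    by apply: eq_Rintegral => t _; rewrite /k /=; ring.
  rewrite RintegralB//; last 2 first.
  - by rewrite (_ : _ \o _ = fun t =>
      ((c * m1 ^+ N)%:E * (dexp 0 t * \1_(`[t2, t3[%classic) t)%:E)%E)//;
      apply: integrableZl.
  - by rewrite (_ : _ \o _ = fun t =>
      ((m2 ^+ N)%:E * (dexp 0 t * cst 1 t)%:E)%E)//; apply: integrableZl.
  rewrite !RintegralZl//.
  have -> : (\int[mu]_(t in D) (dexp 0 t * cst 1 t))%R = 1.
    by rewrite /Rintegral -/(disc_int 0 (cst 1)) disc_int1.
  have -> : (\int[mu]_(t in D) (dexp 0 t * \1_(`[t2, t3[%classic) t))%R = h.
    rewrite /Rintegral (_ : (\int[mu]_(t in D) _)%E = h%:E)// -intJ.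
    have DJ : `[t2, t3[%classic = D `&` `[t2, t3[%classic :> set R.
      apply/esym/setIidr => t; rewrite /= !in_itv/= andbT => /andP[tt2 _].
      exact: le_trans tt2.
    rewrite [in RHS]DJ integral_mkcondr; apply: eq_integral => t _.
    by rewrite patchE indicE; case: ifP => _; rewrite ?mulr1 ?mulr0.
  by move=> h'; lra.
have rho : m2 / m1 < 1 by rewrite ltr_pdivrMr ?mul1r// (lt_trans m20).
have ch : 0 < c * h by rewrite mulr_gt0.
have cvg0 : (m2 / m1) ^+ N @[N --> \oo] --> (0 : R).
  apply: cvg_expr; rewrite ger0_norm// divr_ge0// ltW//.
have : \forall N \near \oo, (m2 / m1) ^+ N < c * h.
  by apply: cvgr_lt cvg0 _ ch.
case=> N _ /(_ N (leqnn _)) /=.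
by rewrite ltNge expr_div_n ler_pdivlMr ?exprn_gt0// -mulrA key.
Qed.

End lerch.

(** * One-dimensional marginals from the rewards *)

Section marginals.
Context (R : realType) (X : ptopologicalType) (g : nat -> X -> R).
Hypothesis cg : forall j, continuous (g j).
Hypothesis baseg : forall x (A : set X), nbhs x A ->
  exists2 j, 0 < g j x & [set y | 0 < g j y] `<=` A.
Local Notation Om := (borelType (paths R X)).
Local Notation mu := (@lebesgue_measure R).

Section one_function.
Variables (f : X -> R).
Hypotheses (cf : continuous f) (f01 : forall x, 0 <= f x <= 1).

Definition marginal_int (P : law R (paths R X)) (t : R) : R :=
  law_int (fun w => f (rpath w t)) P.

Let mft t : measurable_fun [set: Om] ((fun w => f (rpath w t)) : Om -> R).
Proof.
exact: (measurableT_comp (continuous_borel cf) (measurable_coord cg baseg t)).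
Qed.

Lemma marginal_int01 P t : 0 <= marginal_int P t <= 1.
Proof. by apply: law_int01 => // w; exact: f01. Qed.

(** Dominated convergence with bound [1]; the interval of radius [1] around [t] is an arbitrary
    choice. *)
Lemma continuous_marginal_int P : continuous (marginal_int P).
Proof.
move=> t.
have m1 : P.-integrable setT (EFin \o (cst 1 : Om -> R)).
  by apply: finite_measure_integrable_cst.
have /= := @continuity_under_integral R _ Om P (fun t w => f (rpath w t)) setT
  measurableT
  (t - 1) (t + 1) _ _ (cst 1) m1 _ t.
apply.
- move=> s _; apply: (le_integrable measurableT _ _ m1).
    by apply/measurable_EFinP; exact: mft.
  move=> w _ /=; rewrite lee_fin normr1; have /andP[a b] := f01 (rpath w s).
  by rewrite ger0_norm.
- apply: aeW => w _ s _.
  apply: (@continuous_comp R X R (rpath w) f); first exact: continuous_rpath.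
  exact: cf.
- move=> s _; apply: aeW => w _; have /andP[a b] := f01 (rpath w s).
  by rewrite ger0_norm.
- by rewrite inE/= in_itv/=; apply/andP; split; rewrite ?ltrBlDr ltrDl.
Qed.

(** Tonelli's theorem; the indicator in [F] extends the time integral from the half-line to the
    whole line. *)
Lemma lap_marginal_int n P :
  (law_int (lap n f) P)%:E = disc_int n (marginal_int P).
Proof.
rewrite law_intE; [|by move=> w; exact: lap01|exact: measurable_lap].
pose F (p : Om * R) : \bar R :=
  (dexp n p.2 * f (rpath p.1 p.2) * \1_(`[0%R, +oo[%classic : set R) p.2)%:E.
have F0 p : (0 <= F p)%E.
  rewrite lee_fin !mulr_ge0 ?dexp_ge0//.
  by have /andP[] := f01 (rpath p.1 p.2).
have mF : measurable_fun [set: Om * R] F.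
  apply/measurable_EFinP; apply: measurable_funM; first apply: measurable_funM.
  - apply: (measurableT_comp _ measurable_snd).
    by apply: continuous_measurable_fun; exact: continuous_dexp.
  - apply: (measurableT_comp (continuous_borel cf)).
    by apply: (measurable_fun_rpath cg baseg);
      [exact: measurable_fst|exact: measurable_snd].
  - by apply: (measurableT_comp _ measurable_snd); exact: measurable_indic.
transitivity (\int[P]_w \int[mu]_t F (w, t))%E.
  apply: eq_integral => w _; rewrite lapE// /disc_int integral_mkcond.
  apply: eq_integral => t _; rewrite patchE /F/= indicE.
  by case: ifP => _; rewrite ?mulr1 ?mulr0.
rewrite (@fubini_tonelli _ _ Om _ R P mu F mF F0) /disc_int [in RHS]integral_mkcond.
apply: eq_integral => t _; rewrite patchE /F/= indicE.
case: ifP => _; last by apply: integral0_eq => w _; rewrite mulr0.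
under eq_integral do rewrite mulr1 EFinM.
rewrite ge0_integralZl_EFin ?dexp_ge0//; last 2 first.
- by move=> w _; rewrite lee_fin; case/andP: (f01 (rpath w t)).
- by apply/measurable_EFinP; exact: mft.
by rewrite [in RHS]EFinM /marginal_int law_intE.
Qed.

End one_function.

(** Lerch's theorem identifies the expectation at time [t] of every test function on [X], and these
    functions separate laws on [X]. *)
Lemma marginal_unique (P Q : law R (paths R X)) :
  (forall n L, law_int (lap n (test_fun g L)) P = law_int (lap n (test_fun g L))
    Q) ->
  forall t B, 0 <= t -> borel B -> P [set w | B (rpath w t)] =
    Q [set w | B (rpath w t)].
Proof.
move=> PQ t B t0 bB.
have [p pE] := pushforward_law P (measurable_coord cg baseg t).
have [q qE] := pushforward_law Q (measurable_coord cg baseg t).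
rewrite -[LHS]pE// -[RHS]qE//; move: B bB.
apply: (@test_fun_separates R X g cg (borel_base baseg) p q) => L.
have cL : continuous (test_fun g L) by exact: test_fun_continuous.
have L01 : forall x, 0 <= test_fun g L x <= 1 by exact: test_fun01.
have pf (M : law R (paths R X)) (m : law R X) :
  (forall B, borel B -> m B = M [set w | B (rpath w t)]) ->
    (\int[m]_x (test_fun g L x)%:E)%E = (marginal_int (test_fun g L) M t)%:E.
  move=> mE; rewrite law_intE//; last first.
    exact: (measurableT_comp (continuous_borel cL) (measurable_coord cg baseg t)).
  apply: (integral_law_image (measurable_coord cg baseg t) mE);
    first exact: continuous_borel.
  by move=> x; case/andP: (L01 x).
rewrite (pf P)// (pf Q)//; congr EFin; apply/le_anti/andP; split.
  apply: laplace_le t0; try exact: continuous_marginal_int;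
    try exact: marginal_int01.
  by move=> n; rewrite -!lap_marginal_int// PQ.
apply: laplace_le t0; try exact: continuous_marginal_int; try exact: marginal_int01.
by move=> n; rewrite -!lap_marginal_int// PQ.
Qed.

End marginals.

(** * Uniqueness from the one-dimensional marginals *)

Lemma gt0_setP (R : realType) (T : ptopologicalType) (g : nat -> T -> R) s x :
  gt0_set g s x <-> forall j, j \in s -> 0 < g j x.
Proof.
rewrite /gt0_set/= -natr_prod -[1]/(1%:R); split=> [/eqP|h].
  rewrite eqr_nat; elim: s => // i s ih; rewrite big_cons muln_eq1 =>
    /andP[gi /ih h] j.
  by rewrite in_cons => /orP[/eqP ->|/h//]; move: gi; case: ltP.
congr (_%:R); apply: big1_seq => j /andP[_ js].
by rewrite h.
Qed.

Section uniqueness.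
Context (R : realType) (X : ptopologicalType) (g : nat -> X -> R).
Hypothesis cg : forall j, continuous (g j).
Hypothesis baseg : forall x (A : set X), nbhs x A ->
  exists2 j, 0 < g j x & [set y | 0 < g j y] `<=` A.
Hypothesis sepg : forall x y, (forall j, (0 < g j x) = (0 < g j y)) -> x = y.
Local Notation Om := (borelType (paths R X)).
Implicit Types (t s : R) (P Q : law R (paths R X)).

Variable D : X -> set (law R (paths R X)).
Hypothesis markovD : markovian D.
Hypothesis marginalD : forall x P Q, D x P -> D x Q ->
  forall t B, 0 <= t -> borel B -> P [set w | B (rpath w t)] =
    Q [set w | B (rpath w t)].

Let borel_coord t B : borel B -> borel [set w : paths R X | B (rpath w t)].
Proof.
by move=> bB; have := measurable_coord cg baseg t measurableT bB; rewrite setTI.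
Qed.

Lemma stopping_cst (s : time R) : stopping_time (fun _ : paths R X => s).
Proof.
move=> t; pose G := [set (@path_at R X)^~ r @^-1` B |
  r in [set r : time R | r%:num <= t%:num]
                               & B in @borel X] : set (set (paths R X)).
have [st|ts] := boolP (s%:num <= t%:num).
  by rewrite (_ : [set w | _] = setT);
    [exact: (@measurableT _ (g_sigma_algebraType G))|exact/seteqP].
by rewrite (_ : [set w | _] = set0);
  [exact: (@measurable0 _ (g_sigma_algebraType G))|apply/seteqP; split => w //=;
  exact/negP].
Qed.

Variable h : X -> law R (paths R X).
Hypotheses (bh : borel_fun h) (hD : forall x, D x (h x)).

(** Read off from a Borel selection for measurability in [y]; at times [r >= 0], by [marginalD], any
    other law in [D y] gives the same value on Borel sets. *)
Definition transition (r : R) (B : set X) (y : X) : \bar R :=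
  h y [set w | B (rpath w r)].

Lemma measurable_transition r B : borel B ->
  measurable_fun [set: borelType X] (transition r B : borelType X -> \bar R).
Proof.
move=> bB; have ccf n : continuous (coord_fun g n : paths R X -> R)
  by exact: continuous_coord_fun.
apply: (measurable_law_family ccf (borel_coord_fun cg baseg) (k := h)
  (S := borelType X)); last exact: borel_coord.
move=> L.
have cF : continuous (test_fun (coord_fun g) L : paths R X -> R)
  by exact: test_fun_continuous.
have bF : bounded_fun (test_fun (coord_fun g) L : paths R X -> R).
  by apply: bounded_fun01 => w; exact: test_fun01.
rewrite (_ : (fun w => _) = EFin \o (fun y => law_int (test_fun (coord_fun g) L)
  (h y))).
  apply/measurable_EFinP => _ B' mB'; rewrite setTI; apply: (bh (B := _ @^-1` B')).
  apply: (continuous_borel_fun (continuous_law_int cF bF)).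
  by rewrite borel_real.
apply/funext => w /=; rewrite law_intE//; first by move=> w'; exact: test_fun01.
exact: measurable_test_fun.
Qed.

(** Conditioning at the constant time [s] almost surely yields a law in [D] at the current position,
    and that law has the marginals of [h] there. *)
Lemma markov_transition x P (s : time R) r A B : D x P -> 0 <= r ->
  filtration s A -> borel B ->
  P (A `&` [set w | B (rpath w (s%:num + r))]) =
  (\int[P]_(w in A) transition r B (rpath w s%:num))%E.
Proof.
move=> DP r0 fA bB.
have [selD sD condD concD] := markovD.
have st := stopping_cst s.
have [[k rk] hk] := condD x P DP _ st; have [N [sN PN hN]] := hk k rk.
have bA := filtration_borel cg baseg fA.
have sA : stopped (fun _ => s) A.
  by apply: (stopped_saturated cg baseg st bA) => w w'; exact: filtration_agree.
have bB' := borel_coord r bB.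
have thB : theta (fun _ => s) @^-1` [set w | B (rpath w r)] =
  [set w | B (rpath w (s%:num + r))].
  by apply/seteqP; split => w /=; rewrite /theta rpath_shift.
rewrite -thB; have [mk ->//] := rk; last by rewrite thB; exact: borel_coord.
apply: ge0_ae_eq_integral => //.
- apply: measurable_funTS; apply: (measurable_fun_stoppedW cg baseg st).
  by apply/(measurable_wrt_stoppedP cg baseg st); apply: mk; rewrite thB;
    exact: borel_coord.
- apply: measurable_funTS.
  exact: (measurableT_comp (measurable_transition r bB)
    (measurable_coord cg baseg s%:num)).
exists N; split => //; first exact: stopped_borel sN.
move=> w; apply: contra_notP => nNw Aw.
have [nu Dnu nuE] := hN w nNw.
rewrite -nuE// /transition.
have -> : rpath w s%:num = path_at_stop (fun _ => s) w by rewrite rpath_num.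
exact: marginalD Dnu (hD _) _ _ r0 bB.
Qed.

Let later (c d : R * nat) := d.1 <= c.1.

Let cyl (l : seq (R * nat)) : set (paths R X) :=
  [set w | forall c, c \in l -> 0 < g c.2 (rpath w c.1)].

Let cyl_cons c l : cyl (c :: l) = [set w | 0 < g c.2 (rpath w c.1)] `&` cyl l.
Proof.
apply/seteqP; split => w.
  by move=> hw; split=> [|d dl]; apply: hw; rewrite in_cons ?eqxx// dl orbT.
by move=> [h1 h2] d; rewrite in_cons => /orP[/eqP ->|/h2].
Qed.

Let borel_cyl l : borel (cyl l).
Proof.
elim: l => [|c l ih].
  by rewrite (_ : cyl _ = setT); [exact: (@measurableT _ Om)|apply/seteqP; split].
rewrite cyl_cons; apply: (@measurableI _ Om) => //.
by apply: (@borel_coord c.1 [set x | 0 < g c.2 x]); apply: sub_sigma_algebra;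
  exact: open_gt0.
Qed.

Let filtration_cyl (t : time R) l : (forall c, c \in l -> 0 <= c.1 <= t%:num) ->
  filtration t (cyl l).
Proof.
move=> lt; rewrite (_ : cyl l = stop t @^-1` cyl l).
  by apply: (stop_filtration cg baseg); exact: borel_cyl.
apply/seteqP; split => w hw c cl; have := hw c cl; have ct := lt c cl.
  by rewrite -(agree_stop w (lexx t%:num) ct).
by rewrite (agree_stop w (lexx t%:num) ct).
Qed.

(* [later] puts the latest time first, so that the Markov property at the head
   of [l] reduces the last coordinate to a function of the previous one. *)
Let cyl_unique x P Q l (T : R) B : D x P -> D x Q ->
  sorted later l -> 0 <= T -> (forall c, c \in l -> 0 <= c.1 <= T) -> borel B ->
  P (cyl l `&` [set w | B (rpath w T)]) = Q (cyl l `&` [set w | B (rpath w T)]).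
Proof.
move=> DP DQ; elim: l T B => [|c l ih] T B sl T0 lT bB.
  have -> : cyl [::] = setT by apply/seteqP; split.
  by rewrite !setTI; exact: (marginalD DP DQ T0 bB).
have /andP[c0 cT] := lT c (mem_head _ _).
have tr : transitive later by move=> a b d ab bd; exact: le_trans bd ab.
have lc d : d \in l -> 0 <= d.1 <= c.1.
  move=> dl; have /andP[-> _] := lT d (mem_behead (s := c :: l) dl).
  by have /allP := order_path_min tr sl; apply.
pose s : time R := NngNum c0.
have fc : filtration s (cyl (c :: l)).
  apply: filtration_cyl => d; rewrite in_cons => /orP[/eqP ->|/lc//].
  by rewrite c0/=.
have bcl := borel_cyl l.
have -> : T = s%:num + (T - c.1) by rewrite /= addrC subrK.
have r0 : 0 <= T - c.1 by rewrite subr_ge0.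
rewrite (markov_transition DP r0 fc bB) (markov_transition DQ r0 fc bB).
(* The condition at time [c.1] and the transition from there form a function of the position at
   [c.1]. Only [cyl l] remains as a weight, so the induction hypothesis with last time [c.1]
   applies. *)
pose b y : \bar R := (transition (T - c.1) B y * (\1_[set x | 0 < g c.2 x] y)%:E)%E.
have bU : borel [set x | 0 < g c.2 x] by apply: sub_sigma_algebra; exact: open_gt0.
have mtr := measurable_transition (T - c.1) bB.
have tr0 y : (0 <= transition (T - c.1) B y)%E by exact: measure_ge0.
have key (M : law R (paths R X)) :
  (\int[M]_(w in cyl (c :: l)) transition (T - c.1) B (rpath w s%:num) =
    \int[M]_w (b (rpath w c.1) * (\1_(cyl l) w)%:E))%E.
  rewrite integral_mkcond; apply: eq_integral => w _.
  rewrite patchE cyl_cons in_setI /b !indicE -muleA.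
  rewrite (_ : (rpath w c.1 \in [set x | 0 < g c.2 x]) =
    (w \in [set w | 0 < g c.2 (rpath w c.1)])).
    by case: (_ \in _) => /=; case: (_ \in _); rewrite ?mul0e ?mule0 ?mul1e ?mule1.
  by apply/idP/idP; rewrite !inE.
rewrite !key.
apply: (@ge0_integral_weight R _ _ _ Om Om (borelType X) P Q (fun w => rpath w c.1)
  (fun w => rpath w c.1) (\1_(cyl l)) (\1_(cyl l))).
- exact: measurable_coord.
- exact: measurable_coord.
- exact: (@measurable_indic _ Om).
- exact: (@measurable_indic _ Om).
- by move=> w; rewrite indicE.
- by move=> w; rewrite indicE.
- move=> A mA; rewrite !integral_indic//; try exact: borel_coord.
  by apply: ih => //; exact: path_sorted sl.
- by move=> y; rewrite /b mule_ge0// lee_fin.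
- apply: emeasurable_funM => //; apply/measurable_EFinP.
  exact: (@measurable_indic _ (borelType X)).
Qed.

Lemma markovian_unique x P Q : D x P -> D x Q -> P = Q.
Proof.
move=> DP DQ; apply: law_ext.
have ccf n : continuous (coord_fun g n : paths R X -> R)
  by exact: continuous_coord_fun.
apply: (gt0_set_unique ccf (borel_coord_fun cg baseg)) => l.
(* A negative rational time is replaced by its absolute value, where [rpath] takes the same
   value. *)
pose l' := [seq (`|ratr (coord_index n).1 : R|, (coord_index n).2) | n <- l].
have El : gt0_set (coord_fun g) l = cyl (sort later l').
  apply/seteqP; split => w.
    move=> /gt0_setP hw c; rewrite mem_sort => /mapP[n nl ->] /=.
    by rewrite rpath_norm; exact: hw.
  move=> hw; apply/gt0_setP => n nl; rewrite /coord_fun -rpath_norm.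
  apply: (hw (`|ratr (coord_index n).1|, (coord_index n).2)).
  by rewrite mem_sort; apply/mapP; exists n.
(* The sum of the times is an upper bound for each of them; the condition imposed at [T] is the
   trivial one. *)
pose T : R := \sum_(c <- l') c.1.
have l0 c : c \in l' -> 0 <= c.1 by move=> /mapP[n _ ->] /=.
have T0 : 0 <= T by rewrite /T big_seq; apply: sumr_ge0 => c; exact: l0.
have := @cyl_unique x P Q (sort later l') T setT DP DQ _ T0 _
  (@measurableT _ (borelType X)).
rewrite (_ : [set w | _] = setT) ?setIT -?El; last exact/seteqP.
apply.
  by apply: sort_sorted => a b; exact: le_total.
move=> c; rewrite mem_sort => cl; rewrite l0//= /T (big_rem c)//= lerDl.
by rewrite big_seq; apply: sumr_ge0 => d /mem_rem; exact: l0.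
Qed.

End uniqueness.

(** * The lexicographic maximization and its single law *)

Section lexicographic.
Context (R : realType) (X : ptopologicalType) (g : nat -> X -> R).
Hypothesis cg : forall j, continuous (g j).
Hypothesis baseg : forall x (A : set X), nbhs x A ->
  exists2 j, 0 < g j x & [set y | 0 < g j y] `<=` A.
Hypothesis sepg : forall x y, (forall j, (0 < g j x) = (0 < g j y)) -> x = y.
Local Notation Om := (borelType (paths R X)).

(** Enumerates all rates and all test functions on [X]; integers that code nothing give the empty
    product at the first rate. *)
Definition reward (i : nat) : law R (paths R X) -> R :=
  let c := odflt (0%N, ([::], 0%N)) (unpickle i) in law_int
    (lap c.1 (test_fun g c.2)).

Lemma continuous_reward i : continuous (reward i).
Proof.
apply: continuous_Phi; first exact: test_fun_continuous.
exact: test_fun01.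
Qed.

Lemma markovian_lex_argmax D : markovian D -> markovian (lex_argmax reward D).
Proof.
move=> markD.
have markDn n : markovian (iter_argmax reward D n).
  elim: n => //= n ih; apply: (markovian_argmax cg baseg sepg) => //.
    exact: test_fun_continuous.
  exact: test_fun01.
have ccf n : continuous (coord_fun g n : paths R X -> R)
  by exact: continuous_coord_fun.
have hL := hausdorff_law ccf (borel_coord_fun cg baseg).
split.
- by apply: (lex_argmax_selectable hL continuous_reward); have [] := markD.
- by move=> x P /(_ 0%N I) DP; have [_ sD _ _] := markD; exact: sD.
- move=> x P DP tau stau.
  have condn n : shift_cond_as P tau (stopped tau)
      (fun w => iter_argmax reward D n (path_at_stop tau w)).
    have [_ _ cn _] := markDn n; exact: cn (DP n I) tau stau.
  split=> [|k rk]; first by case: (condn 0%N).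
  have hN n : exists N, [/\ stopped tau N, P N = 0%E & forall w, ~ N w ->
      exists2 nu, iter_argmax reward D n (path_at_stop tau w) nu &
        forall B, borel B -> nu B = k w (theta tau @^-1` B)].
    by have [_ /(_ k rk)] := condn n.
  have [N hN'] := choice hN.
  exists (\bigcup_n N n); split.
  + rewrite -(stopped_measurableE cg baseg stau); apply: bigcupT_measurable => n.
    by rewrite (stopped_measurableE cg baseg stau); case: (hN' n).
  + apply: (@measure_bigcup_null _ _ Om) => n; last by case: (hN' n).
    by case: (hN' n) => sN _ _; exact: stopped_borel sN.
  + move=> w nN.
    have nu n : exists2 nu, iter_argmax reward D n (path_at_stop tau w) nu &
        forall B, borel B -> nu B = k w (theta tau @^-1` B).
      by have [_ _] := hN' n; apply => Nw; apply: nN; exists n.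
    (* On Borel sets the witnesses of all stages are determined by [k w], so they are one and the
       same law. *)
    have [nu0 _ nu0E] := nu 0%N; exists nu0 => // n _.
    have [nun Dn nunE] := nu n; rewrite (_ : nu0 = nun)//.
    by apply: law_ext => B bB; rewrite nu0E// nunE.
- move=> x P DP tau stau Q [mQ hQ] M hM n _.
  have [_ _ _ cn] := markDn n; apply: (cn x P (DP n I) tau stau Q _ M hM).
  by split => // w; exact: (hQ w n I).
Qed.

Lemma lex_argmax_reward_unique D x P Q : markovian D ->
  lex_argmax reward D x P -> lex_argmax reward D x Q -> P = Q.
Proof.
move=> markD DP DQ; have markL := markovian_lex_argmax markD.
have [selL _ _ _] := markL.
have [h bh hL] := borel_selection cg baseg selL.
apply: (markovian_unique cg baseg markL _ bh hL DP DQ) => y P' Q' DP' DQ' t B t0 bB.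
apply: (marginal_unique cg baseg) => // n L.
have := lex_argmax_eq (pickle (n, L)) DP' DQ'.
by rewrite /reward pickleK.
Qed.

Lemma strong_markov_selection (C : X -> set (law R (paths R X))) : markovian C ->
  exists P : X -> law R (paths R X), [/\ borel_fun P, (forall x, C x (P x)) &
    (forall x tau, stopping_time tau ->
      shift_cond_as (P x) tau (stopped tau)
        (fun w => [set P (path_at_stop tau w)]))].
Proof.
move=> markC; have [selL sL condL concL] := markovian_lex_argmax markC.
have [h bh hL] := borel_selection cg baseg selL.
exists h; split => // [x|x tau stau]; first exact: (hL x 0%N I).
have [exk hk] := condL x (h x) (hL x) tau stau; split => // k rk.
have [N [sN PN hN]] := hk k rk; exists N; split => // w /hN[nu Lnu nuE].
(* The conditional law and [h] at the stopped position lie in the same set, which has one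
   element. *)
exists nu => //=; exact: lex_argmax_reward_unique markC Lnu (hL _).
Qed.

End lexicographic.

(** * The countable base of a Polish space, and the theorem *)

(** Each set [0 < g n] is a ball of radius the inverse of a positive integer about a point of a
    dense sequence, and [g n] is the radius minus the distance to the center, a function with
    Lipschitz constant [1]. *)
Lemma polish_base (R : realType) (X : ptopologicalType) : polish R X ->
  exists g : nat -> X -> R, [/\ forall j, continuous (g j),
    forall x (A : set X), nbhs x A -> exists2 j, 0 < g j x & [set y | 0 < g j y]
      `<=` A &
    forall x y, (forall j, (0 < g j x) = (0 < g j y)) -> x = y].
Proof.
move=> [[D /countable_injP[f finj] dD] [d [d0 dC dT dnbhs _]]].
have dge0 x y : 0 <= d x y.
  have := dT x y x; rewrite (d0 x x).2// (dC y x) -mulr2n.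
  by rewrite pmulrn_lge0.
(* The point of [D] with code [n], or the default [point] if there is none. *)
pose u n := xget point [set x | D x /\ f x = n].
have uD x : D x -> u (f x) = x.
  move=> Dx; rewrite /u; case: xgetP => [y _ [Dy fyx]|/(_ x)]; last by case.
  by apply: finj => //; rewrite inE.
pose g n x := let c := odflt (0%N, 0%N) (unpickle n) in c.2.+1%:R^-1 - d x (u c.1).
have base x (A : set X) : nbhs x A -> exists2 j, 0 < g j x & [set y | 0 < g j y]
  `<=` A.
  move=> /dnbhs[e e0 eA].
  have e20 : 0 < e / 2 by rewrite divr_gt0.
  (* With a radius below [e / 2], the ball about a dense point [y] this close to [x] contains [x]
     and stays within distance [e] of it. *)
  have [k] := ltr_add_invr e20; rewrite add0r => ke.
  pose B := [set y | d x y < k.+1%:R^-1].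
  have nB : nbhs x B by apply/dnbhs; exists k.+1%:R^-1 => //; rewrite invr_gt0.
  have [y [By Dy]] : B^° `&` D !=set0.
    by apply: dD; [exists x|exact: open_interior].
  have {}By := interior_subset By.
  exists (pickle (f y, k)).
    by rewrite /g pickleK/= uD// subr_gt0.
  move=> z; rewrite /g/= pickleK/= uD// subr_gt0 => dzy; apply: eA => /=.
  rewrite (le_lt_trans (dT x y z))// (splitr e) ltrD//.
    exact: lt_trans ke.
  by rewrite dC (lt_trans dzy).
exists g; split => //.
- move=> j x A /= /nbhs_ballP[e /= e0 eA].
  apply/dnbhs; exists e => // y dxy; apply: eA; rewrite /ball/= /g.
  set c := odflt _ _; have h1 := dT x y (u c.1); have h2 := dT y x (u c.1).
  rewrite (dC y x) in h2; move: dxy => /= dxy.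
  by rewrite ltr_norml; move: (c.2.+1%:R^-1) => K; apply/andP; split; lra.
- move=> x y gxy; apply: contrapT => nxy.
  have dxy : 0 < d x y.
    by rewrite lt_neqAle dge0 andbT eq_sym; apply/eqP => /d0.
  have [|j gjx jA] := base x [set z | d x z < d x y].
    by apply/dnbhs; exists (d x y).
  have : d x y < d x y by apply: jA; rewrite /= -gxy.
  by rewrite ltxx.
Qed.

Theorem theorem15 (R : realType) (X : ptopologicalType)
    (C : X -> set (law R (paths R X)))
    (polishX : polish R X)
    (C1 : forall x, [/\ C x !=set0, compact (C x) & convex_laws (C x)])
    (C2 : forall K : set (law R (paths R X)), closed K ->
      borel [set x | C x `&` K !=set0])
    (C3 : forall x P, C x P -> P [set w | path_at w (time0 R) = x] = 1%E)
    (MP1 : forall x P, C x P -> forall tau, stopping_time tau ->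
      shift_cond_as P tau (stopped tau) (fun w => C (path_at_stop tau w)))
    (MP2 : forall x P, C x P -> forall tau, stopping_time tau ->
      forall Q, measurable_selection_at tau C Q ->
      forall M, is_concat P tau Q M -> C x M) :
  exists P : X -> law R (paths R X),
    [/\ borel_fun P,
        (forall x, C x (P x))
      & (forall x tau, stopping_time tau ->
          shift_cond_as (P x) tau (stopped tau)
            (fun w => [set P (path_at_stop tau w)]))].
Proof.
have [g [cg baseg sepg]] := polish_base polishX.
apply: (strong_markov_selection cg baseg sepg); split => //.
by split=> // x; have [] := C1 x.
Qed.
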